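(* Let $$\mathcal{S}^\lambda_{[t_0,T]}=\Bigl\{\lambda(\cdot)\in H^1(t_0,T;\mathbb{R}^n)\ \Big|\ \exists\, v(\cdot)\in L^2(t_0,T;\mathbb{R}^m),\ z\in\mathbb{R}^n\ \text{s.t.}\ -\tfrac{d}{dt}\lambda(t)=F^*(t)\lambda(t)+H^*(t)v(t),\ \lambda(T)=\Sigma_T^{1/2}z\Bigr\},$$ equipped with the inner product $$\langle\lambda^1,\lambda^2\rangle_{\mathcal{S}^\lambda_{[t_0,T]}}=\langle\Pi_0\lambda^1(t_0),\lambda^2(t_0)\rangle+\langle z^1,z^2\rangle+\int_{t_0}^T\langle G(t)Q(t)G^*(t)\lambda^1(t),\lambda^2(t)\rangle dt+\int_{t_0}^T\langle R(t)v^1(t),v^2(t)\rangle dt,$$ where $(z^1,v^1(\cdot))$ and $(z^2,v^2(\cdot))$ are the representatives of $\lambda^1(\cdot)$ and $\lambda^2(\cdot)$ respectively. Then $(\mathcal{S}^\lambda_{[t_0,T]},\langle\cdot,\cdot\rangle_{\mathcal{S}^\lambda_{[t_0,T]}})$ is a (vector-valued) reproducing kernel Hilbert space, and its reproducing kernel is $$\Lambda(s,t|T)=\Phi_{F,\Pi}^*(T,s)\Sigma_T^{1/2}\bigl(\mathrm{Id}+\Sigma_T^{1/2}\Pi(T)\Sigma_T^{1/2}\bigr)^{-1}\Sigma_T^{1/2}\Phi_{F,\Pi}(T,t)+\int_{\max(s,t)}^{T}\Phi_{F,\Pi}^*(\tau,s)H^*(\tau)R^{-1}(\tau)H(\ta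u)\Phi_{F,\Pi}(\tau,t)\,d\tau.$$
   Context: Fix $t_0<T$ and positive integers $n,m,d$. $*$ denotes transposition, $\mathrm{Id}$ the identity, the dual $\mathbb{R}^{n,*}$ of $\mathbb{R}^n$ is identified with $\mathbb{R}^n$, and $H^1(t_0,T;\mathbb{R}^n)$ is the usual Sobolev space. Coefficients: $F\in L^1([t_0,T];\mathbb{R}^{n\times n})$, $G\in L^2([t_0,T];\mathbb{R}^{n\times d})$, $H\in L^2([t_0,T];\mathbb{R}^{m\times n})$, $Q\in L^1([t_0,T];\mathbb{R}^{d\times d})$ symmetric positive semidefinite, $R\in L^2([t_0,T];\mathbb{R}^{m\times m})$ symmetric with $R(\cdot)\succcurlyeq r\,\mathrm{Id}$ a.e. for some $r>0$. $\Pi_0,\Sigma_T\in\mathbb{R}^{n\times n}$ are symmetric positive semidefinite. Neither $Q$, $\Pi_0$ nor $\Sigma_T$ is assumed invertible. Square roots are the positive semidefinite ones. $\Pi(\cdot)$ is the symmetric positive semidefinite solution on $[t_0,T]$ (it exists on the whole interval) of the forward Riccati equation $$\tfrac{d}{dt}\Pi=F\Pi+\Pi F^*-\Pi H^*R^{-1}H\Pi+GQG^*,\quad\Pi(t_0)=\Pi_0,$$ and $\Phi_{F,\Pi}$ is the semigroup (transition matrix) given by $\partial_\tau\Phi_{F,\Pi}(\tau,t)=(F(\tau)-\Pi(\tau)H^*(\tau)R^{-1}(\tau)H(\tau))\Phi_{F,\Pi}(\tau,t)$, $\Phi_{F,\Pi}(t,t)=\mathrm{Id}$; $\Phi^*_{F,\Pi}(\tau,t)$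 is the transpose of $\Phi_{F,\Pi}(\tau,t)$. Representative: for $\lambda\in\mathcal{S}^\lambda_{[t_0,T]}$, among all pairs $(z,v(\cdot))$ satisfying the relations in the definition of $\mathcal{S}^\lambda_{[t_0,T]}$ for this $\lambda$, the representative of $\lambda$ is the unique one minimizing $\int_{t_0}^T\langle R(t)v(t),v(t)\rangle dt+\|z\|^2$. A Hilbert space $\mathcal{H}$ of functions $f:[t_0,T]\to\mathbb{R}^n$ is a (vector-valued) reproducing kernel Hilbert space with matrix-valued reproducing kernel $\Lambda$ on $[t_0,T]^2$ if for all $t\in[t_0,T]$ and all vectors $p$ in the dual of the value space: $\Lambda(\cdot,t)p\in\mathcal{H}$, and $\langle p,f(t)\rangle=\langle f,\Lambda(\cdot,t)p\rangle_{\mathcal{H}}$ for all $f\in\mathcal{H}$.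
   Formalization: As stated the claim can fail (F in L^1 only, or R unbounded); here λ is only absolutely continuous and v in L^2 must have finite cost ∫⟨Rv,v⟩dt, and the literal H^1 space with arbitrary v in L^2 is treated under the added assumptions F in L^2, H and R in L^∞. *)

(* Defs.v *)
From HB Require Import structures.
From mathcomp Require Import all_boot all_order all_algebra.
From mathcomp Require Import all_classical all_reals all_analysis.

Set Implicit Arguments.
Unset Strict Implicit.
Unset Printing Implicit Defensive.
Import Order.TTheory GRing.Theory Num.Theory.
Import numFieldNormedType.Exports.
Local Open Scope classical_set_scope.
Local Open Scope ring_scope.

Section LinearAlgebra.
Context {K : realType} {n : nat}.

Definition dot (x y : 'cV[K]_n) : K := \sum_i x i 0 * y i 0.

Definition psd (A : 'M[K]_n) : Prop :=
  A^T = A /\ forall x : 'cV[K]_n, 0 <= dot (A *m x) x.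

Definition is_psd_sqrt (S A : 'M[K]_n) : Prop := psd S /\ S *m S = A.

End LinearAlgebra.

Section FunctionSpaces.
Context {K : realType}.
Variables (t0 T : K) (p q : nat).
Local Notation mu := (@lebesgue_measure K).

(* The exponent e is an extended real, so that e = +oo is allowed. *)
Definition mx_Lp (e : \bar K) (f : K -> 'M[K]_(p, q)) : Prop :=
  forall i j, ((fun t => f t i j) \_ `[t0, T]) \in Lfun mu e.

Definition mx_int (A : set K) (f : K -> 'M[K]_(p, q)) : 'M[K]_(p, q) :=
  \matrix_(i, j) \int[mu]_(t in A) f t i j.

(* f is absolutely continuous on [t0, T] with a.e. derivative g. This is the
   sense given to every differential equation with integrable coefficients. *)
Definition has_derivative (f g : K -> 'M[K]_(p, q)) : Prop :=
  mx_Lp 1%E g /\ forall t, t \in `[t0, T] -> f t = f t0 + mx_int `[t0, t] g.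

(* W^{1,e}(t0, T), each class being identified with its continuous
   representative; H^1 is sobolev1 2. *)
Definition sobolev1 (e : \bar K) (f : K -> 'M[K]_(p, q)) : Prop :=
  exists g, mx_Lp e g /\ has_derivative f g.

End FunctionSpaces.

Section ReproducingKernel.
Context {K : realType}.

Record is_hilbert (V : lmodType K) (H : set V) (ip : V -> V -> K) : Prop := {
  hilbert_zero : H 0;
  hilbert_lin : forall a f g, H f -> H g -> H (a *: f + g);
  hilbert_sym : forall f g, H f -> H g -> ip f g = ip g f;
  hilbert_ip_lin : forall a f g h, H f -> H g -> H h ->
    ip (a *: f + g) h = a * ip f h + ip g h;
  hilbert_ge0 : forall f, H f -> 0 <= ip f f;
  hilbert_def : forall f, H f -> ip f f = 0 -> f = 0;
  hilbert_complete : forall u : nat -> V, (forall k, H (u k)) ->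
    (forall eps, 0 < eps -> exists N : nat, forall i j : nat,
       (N <= i)%N -> (N <= j)%N ->
       Num.sqrt (ip (u i - u j) (u i - u j)) < eps) ->
    exists2 f, H f &
      (fun k => Num.sqrt (ip (u k - f) (u k - f))) @ \oo --> (0 : K)
}.

Record is_rkhs (X : Type) (n : nat) (H : set (X -> 'cV[K]_n))
    (ip : (X -> 'cV[K]_n) -> (X -> 'cV[K]_n) -> K)
    (Lam : X -> X -> 'M[K]_n) : Prop := {
  rkhs_hilbert : is_hilbert H ip;
  rkhs_kernel_mem : forall t (p : 'cV[K]_n), H (fun s => Lam s t *m p);
  rkhs_reproducing : forall t (p : 'cV[K]_n) f, H f ->
    dot p (f t) = ip f (fun s => Lam s t *m p)
}.

End ReproducingKernel.

Section Control.
Context {K : realType}.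
Variables (t0 T : K) (n m d : nat).
Variables (F : K -> 'M[K]_n) (G : K -> 'M[K]_(n, d)) (H : K -> 'M[K]_(m, n)).
Variables (Q : K -> 'M[K]_d) (R : K -> 'M[K]_m).
Local Notation mu := (@lebesgue_measure K).

Definition is_riccati_solution (Pi0 : 'M[K]_n) (Pi : K -> 'M[K]_n) : Prop :=
  [/\ forall t, t \in `[t0, T] -> psd (Pi t),
      Pi t0 = Pi0 &
      has_derivative t0 T Pi (fun t =>
        F t *m Pi t + Pi t *m (F t)^T
        - Pi t *m (H t)^T *m invmx (R t) *m H t *m Pi t
        + G t *m Q t *m (G t)^T)].

Definition is_transition_matrix (Pi : K -> 'M[K]_n)
    (Phi : K -> K -> 'M[K]_n) : Prop :=
  forall t, t \in `[t0, T] ->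
    Phi t t = 1%:M /\
    has_derivative t0 T (Phi ^~ t) (fun tau =>
      (F tau - Pi tau *m (H tau)^T *m invmx (R tau) *m H tau) *m Phi tau t).

Variable sqrtSigmaT : 'M[K]_n.

(* Functions on [t0, T] are functions on the subtype of the interval; they are
   extended by 0 to the real line wherever a function of a real is needed. *)
Local Notation I := (set_type (`[t0, T] : set K)).

Definition ext (lam : I -> 'cV[K]_n) : K -> 'cV[K]_n := 'valL_0 lam.

Definition admissible (lam : I -> 'cV[K]_n)
    (zv : 'cV[K]_n * (K -> 'cV[K]_m)) : Prop :=
  [/\ mx_Lp t0 T 2%:E zv.2,
      has_derivative t0 T (ext lam)
        (fun t => - ((F t)^T *m ext lam t + (H t)^T *m zv.2 t)) &
      ext lam T = sqrtSigmaT *m zv.1].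

(* Valued in the extended reals: for an unbounded R the integral can be
   infinite for some square integrable v. *)
Definition cost (zv : 'cV[K]_n * (K -> 'cV[K]_m)) : \bar K :=
  (\int[mu]_(t in `[t0, T]) (dot (R t *m zv.2 t) (zv.2 t))%:E
   + (dot zv.1 zv.1)%:E)%E.

Definition is_representative (lam : I -> 'cV[K]_n)
    (zv : 'cV[K]_n * (K -> 'cV[K]_m)) : Prop :=
  admissible lam zv /\
  forall zv', admissible lam zv' -> (cost zv <= cost zv')%E.

Definition representative (lam : I -> 'cV[K]_n) :
    'cV[K]_n * (K -> 'cV[K]_m) :=
  xget (0, fun=> 0) [set zv | is_representative lam zv].

(* Uniqueness of the square integrable control is meant almost everywhere. *)
Definition unique_representatives (E : set (I -> 'cV[K]_n)) : Prop :=
  forall lam, E lam ->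
    (exists zv, is_representative lam zv) /\
    (forall zv zv', is_representative lam zv -> is_representative lam zv' ->
       zv.1 = zv'.1 /\
       {ae mu, forall t, t \in `[t0, T] -> zv.2 t = zv'.2 t}).

Definition S_H1 : set (I -> 'cV[K]_n) :=
  [set lam | sobolev1 t0 T 2%:E (ext lam) /\ exists zv, admissible lam zv].

(* The same relations, with lam only absolutely continuous (which is part of
   has_derivative) and a control of finite cost. It equals S_H1 when F is square
   integrable and H, R are essentially bounded. Without such bounds H^T v need
   not be square integrable nor the cost finite, and the sections of the kernel
   can fail to be in H^1: for n = m = 1, t0 = 0, T = 1, H = 0,
   R = sqrtSigmaT = 1 and F t = t^(-1/2), the set S_H1 is {0} whereas the kernel
   does not vanish. *)
Definition S_lambda : set (I -> 'cV[K]_n) :=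
  [set lam | exists zv, admissible lam zv /\ (cost zv < +oo)%E].

Definition ip_lambda (Pi0 : 'M[K]_n) (lam1 lam2 : I -> 'cV[K]_n) : K :=
  let zv1 := representative lam1 in
  let zv2 := representative lam2 in
  dot (Pi0 *m ext lam1 t0) (ext lam2 t0)
  + dot zv1.1 zv2.1
  + \int[mu]_(t in `[t0, T])
      dot (G t *m Q t *m (G t)^T *m ext lam1 t) (ext lam2 t)
  + \int[mu]_(t in `[t0, T]) dot (R t *m zv1.2 t) (zv2.2 t).

Definition kernel_lambda (Pi : K -> 'M[K]_n) (Phi : K -> K -> 'M[K]_n)
    (s t : I) : 'M[K]_n :=
  let s' : K := set_val s in
  let t' : K := set_val t in
  (Phi T s')^T *m sqrtSigmaT
    *m invmx (1%:M + sqrtSigmaT *m Pi T *m sqrtSigmaT)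
    *m sqrtSigmaT *m Phi T t'
  + mx_int `[Num.max s' t', T] (fun tau =>
      (Phi tau s')^T *m (H tau)^T *m invmx (R tau) *m H tau *m Phi tau t').

End Control.

Arguments unique_representatives {K} t0 T {n m} F H R sqrtSigmaT E.
Arguments S_H1 {K} t0 T {n m} F H sqrtSigmaT.
Arguments S_lambda {K} t0 T {n m} F H R sqrtSigmaT.
Arguments ip_lambda {K} t0 T {n m d} F G H Q R sqrtSigmaT Pi0 lam1 lam2.
Arguments kernel_lambda {K} t0 T {n m} H R sqrtSigmaT Pi Phi s t.

(* Main.v *)
Require Import Defs.
From HB Require Import structures.
From mathcomp Require Import all_boot all_order all_algebra.
From mathcomp Require Import all_classical all_reals all_analysis.
From mathcomp Require Import measurable_realfun ess_sup_inf ring lra.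
Import Order.TTheory GRing.Theory Num.Theory.
Import numFieldNormedType.Exports.
Local Open Scope classical_set_scope.
Local Open Scope ring_scope.

(** Write [S] for the square root of [SigmaT], [W = H^T R^-1 H] and
    [A = F - Pi W], so that [Phi] is the transition matrix of [A].

    The pairs [(z, v)] of a trajectory form an affine space, directed by the
    pairs of the zero trajectory. The representative is the point of least
    energy of this affine space; equivalently, it is orthogonal to all pairs of
    the zero trajectory ([repP]). It exists because pairs of finite energy form
    a complete space ([ctl_complete], [minimal_norm], [adm_limit]).

    The heart of the proof is an explicit control for the sections of the
    kernel. Fix [t] and [p], let [psi = Phi(., t) p] and let [lam] be the section
    [Lam(., t) p]. Factoring [Phi(s, t)] as [Phi(s, t0) Phi(t0, t)] separates the
    two variables of the kernel and shows that [lam] solves the adjoint equation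
    with
      [v s = R^-1 H (1_(t <= s) psi s - Pi lam s)] and
      [z = (1 + S Pi(T) S)^-1 S psi(T)]
    ([section_equation], [section_terminal]). Now let [(z', v')] be a pair of any
    trajectory [f]. Differentiate [<f, psi>] on [[t, T]] and [<f, Pi lam>] on
    [[t0, T]]: by the Riccati equation all terms with [F] cancel, and
      [<z', z> + int <R v', v> =
         <p, f(t)> - <Pi0 f(t0), lam(t0)> - int <G Q G^T f, lam>]
    ([section_form]). For [f = 0] the right-hand side vanishes, hence [(z, v)] is
    the representative of [lam]; for the representative of an arbitrary [f] the
    identity is the reproducing property.

    The kernel is bounded on the diagonal, so that by the reproducing property
    evaluations are bounded uniformly in time ([point_bound]). This gives
    definiteness, and it gives completeness: a Cauchy sequence of trajectories
    converges uniformly, its representatives converge in energy, and the limits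
    satisfy the relations that define the space ([Slam_complete]).

    Differential equations are understood in integrated form. The product rule
    for such equations is Fubini's theorem on a triangle ([prim_mul]), and
    uniqueness for linear equations is a Gronwall argument ([ode_zero]); the
    latter yields the semigroup property of [Phi] and its equation in the second
    variable ([hd_adjoint]).

    Two steps connect this to the theorem. Positivity of [Q] and [R] is known
    almost everywhere only, and both are first replaced on a null set
    ([S_lambda_rkhs]). When [F] is square integrable and [H], [R] are essentially
    bounded, the trajectories of class [H^1] are exactly those that have a
    control of finite cost ([S_H1_eq]). *)

Set Implicit Arguments.
Unset Strict Implicit.

(** * Integrability on an interval and the exchange of integrals *)

Section Predicates.
Context {K : realType} (a b : K).
Local Notation mu := (@lebesgue_measure K).

Definition meas_on (f : K -> K) : Prop :=
  @measurable_fun _ _ (measurableTypeR K) K `[a, b] f.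
Definition bd_on (f : K -> K) : Prop :=
  meas_on f /\ exists C, forall t, t \in `[a, b] -> `|f t| <= C.
Definition int_on (f : K -> K) : Prop := mu.-integrable `[a, b] (EFin \o f).
(** Measurability is asked of [f] itself: it does not follow from that of its
    square. *)
Definition sq_on (f : K -> K) : Prop :=
  meas_on f /\ int_on (fun t => f t ^+ 2).

Lemma itv_meas : @measurable _ (measurableTypeR K) `[a, b].
Proof. exact: measurable_itv. Qed.

Lemma meas_ext f g : (forall t, t \in `[a, b] -> f t = g t) ->
  meas_on f -> meas_on g.
Proof.
move=> fg mf; apply: eq_measurable_fun mf => t; rewrite inE /= => tI.
exact: fg.
Qed.

Lemma int_ext f g : (forall t, t \in `[a, b] -> f t = g t) ->
  int_on f -> int_on g.
Proof.
move=> fg; apply: eq_integrable => // t; rewrite inE /= => tI.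
by rewrite fg.
Qed.

Lemma int_meas f : int_on f -> meas_on f.
Proof. by move=> /integrableP[+ _] => /measurable_EFinP. Qed.

Lemma bd_meas f : bd_on f -> meas_on f. Proof. by case. Qed.

Lemma meas_cst c : meas_on (fun=> c). Proof. exact: measurable_cst. Qed.
Lemma meas_add f g : meas_on f -> meas_on g -> meas_on (fun t => f t + g t).
Proof. exact: measurable_funD. Qed.
Lemma meas_sub f g : meas_on f -> meas_on g -> meas_on (fun t => f t - g t).
Proof. exact: measurable_funB. Qed.
Lemma meas_mul f g : meas_on f -> meas_on g -> meas_on (fun t => f t * g t).
Proof. exact: measurable_funM. Qed.

Lemma int_dom f g : meas_on f -> int_on g ->
  (forall t, t \in `[a, b] -> `|f t| <= g t) -> int_on f.
Proof.
move=> mf ig fg; apply: (le_integrable itv_meas _ _ ig).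
  exact/measurable_EFinP.
move=> t tI /=; rewrite lee_fin; have fgt := fg t tI.
by rewrite (ger0_norm (le_trans (normr_ge0 _) fgt)).
Qed.

Lemma int0 : int_on (fun=> 0). Proof. exact: integrable0. Qed.
Lemma intD f g : int_on f -> int_on g -> int_on (fun t => f t + g t).
Proof. by move=> f1 g1; exact: (integrableD itv_meas f1 g1). Qed.
Lemma intZ c f : int_on f -> int_on (fun t => c * f t).
Proof. by move=> f1; exact: (integrableZl itv_meas c f1). Qed.
Lemma intN f : int_on f -> int_on (fun t => - f t).
Proof.
by move=> f1; apply: int_ext (intZ (-1) f1) => t _ /=; rewrite mulN1r.
Qed.
Lemma int_norm f : int_on f -> int_on (fun t => `|f t|).
Proof. exact: integrable_norm. Qed.

Lemma itv_fin : (mu `[a, b] < +oo)%E.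
Proof.
by rewrite lebesgue_measure_itv /=; case: ifP => _; rewrite ?ltry// -EFinB ltry.
Qed.

Lemma int_cst c : int_on (fun=> c).
Proof.
apply: (measurable_bounded_integrable itv_meas itv_fin).
- exact: meas_cst.
- by exists `|c|; split; [exact: num_real | move=> M cM t _; exact: ltW].
Qed.

Lemma bd_cst c : bd_on (fun=> c).
Proof. by split; [exact: meas_cst | exists `|c|]. Qed.
Lemma bdD f g : bd_on f -> bd_on g -> bd_on (fun t => f t + g t).
Proof.
move=> [mf [C fC]] [mg [D gD]]; split; first exact: meas_add.
by exists (C + D) => t tI; rewrite (le_trans (ler_normD _ _))// lerD ?fC ?gD.
Qed.
Lemma bdM f g : bd_on f -> bd_on g -> bd_on (fun t => f t * g t).
Proof.
move=> [mf [C fC]] [mg [D gD]]; split; first exact: meas_mul.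
by exists (C * D) => t tI; rewrite normrM ler_pM ?fC ?gD.
Qed.

Lemma bd_intM f g : bd_on f -> int_on g -> int_on (fun t => f t * g t).
Proof.
move=> [mf [C fC]] ig; apply: int_dom (intZ C (int_norm ig)) _.
  exact: meas_mul (int_meas ig).
by move=> t tI; rewrite normrM ler_wpM2r ?fC.
Qed.
Lemma int_bdM f g : int_on f -> bd_on g -> int_on (fun t => f t * g t).
Proof.
by move=> f1 g1; apply: int_ext (bd_intM g1 f1) => t _; rewrite mulrC.
Qed.
Lemma bd_int f : bd_on f -> int_on f.
Proof.
by move=> /bd_intM/(_ (int_cst 1)); apply: int_ext => t _; rewrite mulr1.
Qed.

Lemma sqM f g : sq_on f -> sq_on g -> int_on (fun t => f t * g t).
Proof.
move=> [mf f2] [mg g2]; apply: int_dom (intD f2 g2) _; first exact: meas_mul.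
move=> t tI; rewrite normrM -(real_normK (num_real (f t))).
rewrite -(real_normK (num_real (g t))).
by have := normr_ge0 (f t); have := normr_ge0 (g t); nra.
Qed.
Lemma bd_sqM f g : bd_on f -> sq_on g -> sq_on (fun t => f t * g t).
Proof.
move=> bf [mg g2]; split; first exact: meas_mul (bd_meas bf) mg.
by apply: int_ext (bd_intM (bdM bf bf) g2) => t _; rewrite exprMn expr2.
Qed.
Lemma sq_bdM f g : sq_on f -> bd_on g -> sq_on (fun t => f t * g t).
Proof.
move=> f1 g1; have [m s] := bd_sqM g1 f1; split.
  by apply: meas_ext m => t _; rewrite mulrC.
by apply: int_ext s => t _; rewrite mulrC.
Qed.
Lemma bd_sq f : bd_on f -> sq_on f.
Proof. by move=> bf; split; [case: bf | exact/bd_int/bdM]. Qed.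
Lemma sqD f g : sq_on f -> sq_on g -> sq_on (fun t => f t + g t).
Proof.
move=> sf sg; split; first exact: meas_add sf.1 sg.1.
have h := intD (intD sf.2 sg.2) (intZ 2 (sqM sf sg)).
by apply: int_ext h => t _; ring.
Qed.

End Predicates.
Section FubiniRestricted.
Local Open Scope ereal_scope.
Context {K : realType} d1 d2 (T1 : measurableType d1) (T2 : measurableType d2).
Variables (m1 : {sigma_finite_measure set T1 -> \bar K}).
Variables (m2 : {sigma_finite_measure set T2 -> \bar K}).

Lemma integrable_indic d (T : measurableType d) (m : {measure set T -> \bar K})
    (w : T -> K) (f : T -> bool) :
  measurable_fun setT f -> m.-integrable setT (EFin \o w) ->
  m.-integrable setT (EFin \o (fun y => (w y * (f y)%:R)%R)).
Proof.
move=> mf iw; apply: (le_integrable measurableT _ _ iw).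
  apply/measurable_EFinP; apply: measurable_funM.
    by have /integrableP[/measurable_EFinP] := iw.
  have -> : (fun y => (f y)%:R%R) = (fun y => if f y then 1%R else 0%R : K).
    by apply/funext => y; case: (f y).
  by apply: measurable_fun_if => //; exact: measurable_funTS.
move=> y _ /=; rewrite lee_fin normrM; case: (f y).
  by rewrite normr1 mulr1.
by rewrite normr0 mulr0.
Qed.

(** The integrand is dominated by the product of [`|u x|] and [`|w y|], so that
    the order of integration can be exchanged over any measurable region. *)
Lemma fubini_restricted (u : T1 -> K) (w : T2 -> K) (e : T1 -> T2 -> bool) :
  m1.-integrable setT (EFin \o u) -> m2.-integrable setT (EFin \o w) ->
  measurable_fun setT (fun z : T1 * T2 => e z.1 z.2) ->
  (\int[m1]_x (u x * \int[m2]_y (w y * (e x y)%:R)) =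
   \int[m2]_y (w y * \int[m1]_x (u x * (e x y)%:R)))%R.
Proof.
move=> iu iw me.
have /integrableP[/measurable_EFinP mu uoo] := iu.
have /integrableP[/measurable_EFinP mw woo] := iw.
have mex x : measurable_fun setT (e x) by exact: measurableT_comp me (measurable_pair1 x).
have mey y : measurable_fun setT (e ^~ y) by exact: measurableT_comp me (measurable_pair2 y).
pose h (z : T1 * T2) : K := (u z.1 * (w z.2 * (e z.1 z.2)%:R))%R.
have mh : measurable_fun setT h.
  apply: measurable_funM; first exact: measurableT_comp mu measurable_fst.
  apply: measurable_funM; first exact: measurableT_comp mw measurable_snd.
  have -> : (fun z : T1 * T2 => (e z.1 z.2)%:R%R) =
            (fun z : T1 * T2 => if e z.1 z.2 then 1%R else 0%R : K).
    by apply/funext => z; case: (e _ _).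
  by apply: measurable_fun_if => //; exact: measurable_funTS.
have inner1 x : \int[m2]_y (h (x, y))%:E = (u x * \int[m2]_y (w y * (e x y)%:R))%R%:E.
  have iwx := integrable_indic (mex x) iw.
  rewrite -RintegralZl// /Rintegral fineK//.
  by apply: integrable_fin_num => //; exact: (integrableZl measurableT (u x) iwx).
have inner2 y : \int[m1]_x (h (x, y))%:E = (w y * \int[m1]_x (u x * (e x y)%:R))%R%:E.
  have iux := integrable_indic (mey y) iu.
  rewrite -RintegralZl// /Rintegral fineK//.
    by congr integral; apply/funext => x; rewrite /h /= mulrCA.
  by apply: integrable_fin_num => //; exact: (integrableZl measurableT (w y) iux).
have := @Fubini _ _ T1 T2 K m1 m2 (EFin \o h).
rewrite /=; under eq_integral do rewrite inner1.
under [X in _ = X]eq_integral do rewrite inner2.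
move=> fub; rewrite /Rintegral [in LHS]fub//.
apply/integrable12ltyP; first exact/measurable_EFinP.
set C := \int[m2]_y `|(w y)%:E| in woo.
have C0 : 0 <= C by apply: integral_ge0.
have Cfin : C \is a fin_num by rewrite ge0_fin_numE.
have mau : measurable_fun setT (fun x => `|(u x)%:E|).
  by apply: measurableT_comp => //; exact/measurable_EFinP.
have maw : measurable_fun setT (fun x => `|(w x)%:E|).
  by apply: measurableT_comp => //; exact/measurable_EFinP.
apply: (@le_lt_trans _ _ (\int[m1]_x (`|(u x)%:E| * C))).
  apply: ge0_le_integral => //.
  - by move=> x _; apply: integral_ge0.
  - apply: (@measurable_fun_fubini_tonelli_F _ _ _ _ K m2 (abse \o (EFin \o h))) => //=.
    by apply: measurableT_comp => //; exact/measurable_EFinP.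
  - exact: emeasurable_funM.
  move=> x _; rewrite -ge0_integralZl//.
  apply: ge0_le_integral => //.
  - apply: measurableT_comp => //; apply/measurable_EFinP.
    by apply: measurableT_comp mh _; exact: measurable_pair1.
  - exact: emeasurable_funM.
  move=> y _; rewrite /h /= -EFinM lee_fin normrM ler_wpM2l// normrM.
  by case: (e x y); rewrite ?normr1 ?mulr1// normr0 mulr0.
have -> : \int[m1]_x (`|(u x)%:E| * C) = (\int[m1]_x `|(u x)%:E|) * C.
  rewrite -(fineK Cfin); apply: ge0_integralZr => //.
  by rewrite lee_fin fine_ge0.
by rewrite lte_mul_pinfty// ?integral_ge0// ge0_fin_numE ?integral_ge0.
Qed.
End FubiniRestricted.

(** * Absolutely continuous functions and the product rule *)

Section Primitive.
Context {K : realType}.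
Local Notation MR := (measurableTypeR K).
Local Notation mu := (@lebesgue_measure K).
Implicit Types (a b c d : K) (f g : K -> K).

Definition prim a b f g : Prop := int_on a b g /\
  forall t, t \in `[a, b] -> f t = f a + \int[mu]_(s in `[a, t]) g s.

Lemma int_sub a b c d f : a <= c -> d <= b -> int_on a b f -> int_on c d f.
Proof.
move=> ac db; apply: integrableS; [exact: measurable_itv..|].
by apply: subset_itv; rewrite bnd_simp.
Qed.

Lemma Rint_ext a b f g : (forall t, t \in `[a, b] -> f t = g t) ->
  \int[mu]_(s in `[a, b]) f s = \int[mu]_(s in `[a, b]) g s.
Proof. by move=> fg; apply: eq_Rintegral => t; rewrite inE; exact: fg. Qed.

Lemma RintD a b f g : int_on a b f -> int_on a b g ->
  \int[mu]_(s in `[a, b]) (f s + g s) =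
  \int[mu]_(s in `[a, b]) f s + \int[mu]_(s in `[a, b]) g s.
Proof. by move=> *; rewrite RintegralD//; exact: measurable_itv. Qed.

Lemma RintZ a b r f : int_on a b f ->
  \int[mu]_(s in `[a, b]) (r * f s) = r * \int[mu]_(s in `[a, b]) f s.
Proof. by move=> *; rewrite RintegralZl//; exact: measurable_itv. Qed.

Lemma RintB a b f g : int_on a b f -> int_on a b g ->
  \int[mu]_(s in `[a, b]) (f s - g s) =
  \int[mu]_(s in `[a, b]) f s - \int[mu]_(s in `[a, b]) g s.
Proof. by move=> *; rewrite RintegralB//; exact: measurable_itv. Qed.

Lemma Rint_le a b f g : int_on a b f -> int_on a b g ->
  (forall t, t \in `[a, b] -> f t <= g t) ->
  \int[mu]_(s in `[a, b]) f s <= \int[mu]_(s in `[a, b]) g s.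
Proof. by move=> *; apply: le_Rintegral => //; exact: measurable_itv. Qed.

Lemma Rint_norm a b f g : meas_on a b f -> int_on a b g ->
  (forall t, t \in `[a, b] -> `|f t| <= g t) ->
  `|\int[mu]_(s in `[a, b]) f s| <= \int[mu]_(s in `[a, b]) g s.
Proof.
move=> mf ig fg; have jf := int_dom mf ig fg.
apply: le_trans (Rint_le (int_norm jf) ig fg).
by apply: le_normr_Rintegral => //; exact: measurable_itv.
Qed.

Lemma Rint0 a b : \int[mu]_(s in `[a, b]) (0 : K) = 0.
Proof.
by rewrite Rintegral_cst ?mul0r//; exact: measurable_itv.
Qed.

Lemma RintN a b f : int_on a b f ->
  \int[mu]_(s in `[a, b]) (- f s) = - \int[mu]_(s in `[a, b]) f s.
Proof.
move=> jf; rewrite -mulN1r -RintZ//; apply: Rint_ext => t _.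
by rewrite mulN1r.
Qed.

Lemma Rint_split a b c f : a <= c -> c <= b -> int_on a b f ->
  \int[mu]_(s in `[a, b]) f s =
  \int[mu]_(s in `[a, c]) f s + \int[mu]_(s in `[c, b]) f s.
Proof.
move=> ac cb jf; apply/eqP; rewrite addrC -subr_eq; apply/eqP.
rewrite (@Rintegral_itvB _ _ (BLeft a) (BRight b) c)//.
rewrite Rintegral_itv_obnd_cbnd//.
apply: integrableS jf; [exact: measurable_itv..|].
by apply: subset_itv; rewrite bnd_simp.
Qed.

Lemma prim_cont a b f g : a <= b -> prim a b f g ->
  {within `[a, b], continuous f}.
Proof.
move=> ab [ig fE].
have := parameterized_integral_continuous ab ig.
move=> c; apply: (subspace_eq_continuous (f := fun t => f a + parameterized_integral mu a t g)).
  by move=> t; rewrite inE => tI; exact/esym/fE.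
by move=> t; apply: cvgD; [exact: cvg_cst | exact: c].
Qed.

Lemma cont_bd a b f : {within `[a, b], continuous f} -> bd_on a b f.
Proof.
move=> cf; split.
  exact: subspace_continuous_measurable_fun (measurable_itv _) cf.
have [ab|ba] := leP a b; last first.
  by exists 0 => t /andP[]; rewrite !bnd_simp => at_ tb; move: (le_trans at_ tb); rewrite leNgt ba.
have [c _ cM] := EVT_max ab cf; have [d _ dm] := EVT_min ab cf.
exists (`|f c| + `|f d|) => t tI; rewrite ler_norml; apply/andP; split.
  rewrite opprD (le_trans _ (dm t tI))// -lerBrDr.
  have := ler_norm (- f d); rewrite normrN; have := normr_ge0 (f c); lra.
rewrite (le_trans (cM t tI))//.
have := ler_norm (f c); have := normr_ge0 (f d); lra.
Qed.

Lemma prim_bd a b f g : a <= b -> prim a b f g -> bd_on a b f.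
Proof. by move=> ab /(prim_cont ab)/cont_bd. Qed.

Lemma indef_prim a b g : int_on a b g ->
  prim a b (fun t => \int[mu]_(s in `[a, t]) g s) g.
Proof.
move=> ig; split => // t _.
by rewrite [X in _ = X + _](_ : _ = 0) ?add0r// set_itv1 Rintegral_set1.
Qed.

Lemma Rint_triangle a c (u w : K -> K) : int_on a c u -> int_on a c w ->
  \int[mu]_(y in `[a, c]) (w y * \int[mu]_(x in `[a, y]) u x) =
  \int[mu]_(x in `[a, c]) (u x * \int[mu]_(y in `[x, c]) w y).
Proof.
move=> iu iw.
have ext_ (v : K -> K) : int_on a c v ->
    mu.-integrable [set: MR] (EFin \o (v \_ `[a, c])).
  move=> iv; rewrite -restrict_EFin.
  apply/(integrable_restrict mu (measurable_itv `[a, c]) measurableT).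
  by rewrite setTI.
have me : measurable_fun [set: MR * MR] (fun z : MR * MR => (z.1 : K) <= z.2).
  exact: measurable_fun_ler measurable_fst measurable_snd.
have e := esym (@fubini_restricted K _ _ MR MR mu mu _ _ (fun x y : K => x <= y)
  (ext_ u iu) (ext_ w iw) me).
rewrite [LHS]Rintegral_mkcond [RHS]Rintegral_mkcond.
apply: etrans (etrans _ e) (esym _); congr Rintegral; apply/funext => y; rewrite !patchE;
  case: ifPn; rewrite ?mul0r// inE /= in_itv /= => /andP[ay yc]; congr (_ * _);
  rewrite [LHS]Rintegral_mkcond; congr Rintegral; apply/funext => x;
  rewrite !patchE !mem_setE !in_itv /=.
- case: (leP x y) => xy; rewrite ?mulr1 ?mulr0 ?andbF ?andbT//.
  by rewrite (le_trans xy yc) andbT.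
- case: (leP y x) => yx; rewrite ?mulr1 ?mulr0//.
  by rewrite (le_trans ay yx).
Qed.

(** Fubini's theorem on the triangle is what makes the product rule hold for
    merely absolutely continuous factors. *)
Lemma prim_mul a b f f' g g' : a <= b -> prim a b f f' -> prim a b g g' ->
  prim a b (fun t => f t * g t) (fun t => f' t * g t + f t * g' t).
Proof.
move=> ab pf pg; have [jf fE] := pf; have [jg gE] := pg.
have bf := prim_bd ab pf; have bg := prim_bd ab pg.
split; first by apply: intD; [exact: int_bdM | exact: bd_intM].
move=> t tI; have /andP[at_ tb] : (a <= t) && (t <= b) by rewrite in_itv /= in tI.
pose phi x := \int[mu]_(s in `[a, x]) f' s.
pose gam x := \int[mu]_(s in `[a, x]) g' s.
have S h : int_on a b h -> int_on a t h by exact: int_sub.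
have bphi : bd_on a t phi by exact: prim_bd at_ (indef_prim (S _ jf)).
have bgam : bd_on a t gam by exact: prim_bd at_ (indef_prim (S _ jg)).
have jfg := int_bdM (S _ jf) bgam.
have jgf := int_bdM (S _ jg) bphi.
have tr := Rint_triangle (S _ jf) (S _ jg).
have tr2 : \int[mu]_(x in `[a, t]) (f' x * \int[mu]_(y in `[x, t]) g' y) =
    \int[mu]_(x in `[a, t]) (gam t * f' x - f' x * gam x).
  apply: Rint_ext => x /[!in_itv]/= /andP[ax xt].
  by rewrite /gam (Rint_split ax xt (S _ jg)); ring.
rewrite tr2 RintB// ?RintZ// in tr; [|exact: S|exact/intZ/S].
have -> : \int[mu]_(s in `[a, t]) (f' s * g s + f s * g' s) =
    \int[mu]_(s in `[a, t]) ((g a * f' s + f a * g' s) + (f' s * gam s + g' s * phi s)).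
  apply: Rint_ext => s /[!in_itv]/= /andP[as_ st].
  have sI : s \in `[a, b] by rewrite in_itv /= as_ (le_trans st tb).
  by rewrite (fE s sI) (gE s sI) -/(phi s) -/(gam s); ring.
rewrite !RintD ?RintZ//; try by do ?[apply: intD|apply: intZ|exact: S].
by rewrite tr (fE t tI) (gE t tI) -/(phi t) -/(gam t); ring.
Qed.

End Primitive.

(** * Calculus of primitives and a Gronwall lemma *)

Section PrimitiveCalculus.
Context {K : realType}.
Local Notation MR := (measurableTypeR K).
Local Notation mu := (@lebesgue_measure K).
Implicit Types (a b c d : K) (f g : K -> K).

Lemma prim_ext a b f f2 g g2 : a <= b ->
  (forall t, t \in `[a, b] -> f t = f2 t) ->
  (forall t, t \in `[a, b] -> g t = g2 t) -> prim a b f g -> prim a b f2 g2.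
Proof.
move=> ab ff gg [jg fE]; split; first exact: int_ext jg.
have aI : a \in `[a, b] by rewrite in_itv /= lexx.
move=> t tI; rewrite -!ff// fE//; congr (_ + _); apply: Rint_ext => s sI.
apply: gg; rewrite !in_itv /= in sI tI *.
by case/andP: sI => -> /le_trans; apply; case/andP: tI.
Qed.

Lemma prim_cst a b (c : K) : prim a b (fun=> c) (fun=> 0).
Proof. by split; [exact: int0 | move=> t _; rewrite Rint0 addr0]. Qed.

Lemma primD a b f f' g g' : prim a b f f' -> prim a b g g' ->
  prim a b (fun t => f t + g t) (fun t => f' t + g' t).
Proof.
move=> [jf fE] [jg gE]; split; first exact: intD.
move=> t tI; have tb : t <= b by case/andP: tI.
have S h : int_on a b h -> int_on a t h by exact: int_sub.
rewrite RintD; [|exact: S..].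
by rewrite fE// gE//; ring.
Qed.

Lemma primZ a b (r : K) f f' : prim a b f f' ->
  prim a b (fun t => r * f t) (fun t => r * f' t).
Proof.
move=> [jf fE]; split; first exact: intZ.
move=> t tI; have tb : t <= b by case/andP: tI.
have jt : int_on a t f' by exact: int_sub jf.
by rewrite RintZ// fE// mulrDr.
Qed.

Lemma int_sum a b (I : Type) (s : seq I) (f : I -> K -> K) :
  (forall i, int_on a b (f i)) -> int_on a b (fun t => \sum_(i <- s) f i t).
Proof.
move=> jf; elim: s => [|i s IH].
  by rewrite (_ : (fun t => _) = fun=> 0); [exact: int0|apply/funext => t; rewrite big_nil].
rewrite (_ : (fun t => _) = fun t => f i t + \sum_(j <- s) f j t); first exact: intD.
by apply/funext => t; rewrite big_cons.
Qed.

Lemma Rint_sum a b (I : Type) (s : seq I) (f : I -> K -> K) :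
  (forall i, int_on a b (f i)) ->
  \int[mu]_(t in `[a, b]) (\sum_(i <- s) f i t) =
  \sum_(i <- s) \int[mu]_(t in `[a, b]) f i t.
Proof.
move=> jf; elim: s => [|i s IH].
  by rewrite big_nil -[RHS](Rint0 a b); apply: Rint_ext => t _; rewrite big_nil.
rewrite big_cons -IH -RintD//; last exact: int_sum.
by apply: Rint_ext => t _; rewrite big_cons.
Qed.

Lemma prim_sum a b (I : Type) (s : seq I) (f f' : I -> K -> K) :
  (forall i, prim a b (f i) (f' i)) ->
  prim a b (fun t => \sum_(i <- s) f i t) (fun t => \sum_(i <- s) f' i t).
Proof.
move=> pf; elim: s => [|i s IH].
  rewrite (_ : (fun t => _) = fun=> 0); last by apply/funext => t; rewrite big_nil.
  rewrite (_ : (fun t => \sum_(i <- _) f' i t) = fun=> 0); first exact: prim_cst.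
  by apply/funext => t; rewrite big_nil.
rewrite (_ : (fun t => _) = fun t => f i t + \sum_(j <- s) f j t); last first.
  by apply/funext => t; rewrite big_cons.
rewrite (_ : (fun t => \sum_(j <- i :: s) f' j t) =
    fun t => f' i t + \sum_(j <- s) f' j t); last first.
  by apply/funext => t; rewrite big_cons.
exact: primD.
Qed.

Lemma prim_incr a b f g s t : a <= s -> s <= t -> t <= b -> prim a b f g ->
  f t = f s + \int[mu]_(u in `[s, t]) g u.
Proof.
move=> as_ st tb [jg fE].
rewrite (fE t) ?in_itv /= ?tb ?(le_trans as_ st)//.
rewrite (fE s) ?in_itv /= ?as_ ?(le_trans st tb)//.
have jt : int_on a t g by exact: int_sub jg.
by rewrite -addrA -(Rint_split as_ st jt).
Qed.

Definition ind (t s : K) : K := (t <= s)%R%:R.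

Lemma bd_ind a b t : bd_on a b (ind t).
Proof.
split; last first.
  by exists 1 => s _; rewrite /ind; case: (t <= s); rewrite ?normr1 ?normr0.
rewrite /meas_on (_ : ind t = (fun s => if t <= s then 1 else 0)).
  apply: (measurable_fun_if (measurable_itv `[a, b])) => //.
  exact: measurable_fun_ler.
by apply/funext => s; rewrite /ind; case: (t <= s).
Qed.

(** Stopping a function on the left of [t] keeps it absolutely continuous and
    kills its derivative there; this is how the kink of the kernel on the
    diagonal is handled. *)
Lemma prim_max a b f g t : t \in `[a, b] -> prim a b f g ->
  prim a b (fun s => f (Num.max s t)) (fun s => ind t s * g s).
Proof.
move=> /[dup] tI; rewrite in_itv /= => /andP[at_ tb] pf; have [jg fE] := pf.
split; first exact: bd_intM (bd_ind a b t) jg.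
move=> s /[!in_itv]/= /andP[as_ sb].
have z u : u <= t -> a <= u -> \int[mu]_(x in `[a, u]) (ind t x * g x) = 0.
  move=> ut au; rewrite -Rintegral_itv_bndo_bndc.
    rewrite -[RHS](Rint0 a u) -[RHS]Rintegral_itv_bndo_bndc.
      apply: eq_Rintegral => x; rewrite inE /= in_itv /= => /andP[_ xu].
      by rewrite /ind leNgt (lt_le_trans xu ut) mul0r.
    apply: integrableS (int0 a u); [exact: measurable_itv..|].
    by apply: subset_itv; rewrite bnd_simp.
  have j := bd_intM (bd_ind a u t) (int_sub (lexx a) (le_trans ut tb) jg).
  apply: integrableS j; [exact: measurable_itv..|].
  by apply: subset_itv; rewrite bnd_simp.
rewrite (max_idPr at_); case: (leP s t) => st; first by rewrite z ?addr0.
rewrite (Rint_split at_ (ltW st)); last first.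
  exact: bd_intM (bd_ind a s t) (int_sub (lexx a) sb jg).
rewrite z// add0r (prim_incr at_ (ltW st) sb pf); congr (_ + _).
by apply: Rint_ext => x /[!in_itv]/= /andP[tx _]; rewrite /ind tx mul1r.
Qed.

(** A bootstrapping form of Gronwall's lemma. The absolute continuity of the
    integral gives a step length, uniform in [c], on which a maximum of [N]
    started at a zero is at most half of itself. *)
Lemma gronwall_zero a b (N al : K -> K) c :
  {within `[a, b], continuous N} -> (forall t, 0 <= N t) ->
  int_on a b al -> (forall t, 0 <= al t) ->
  (forall s t, a <= s -> s <= t -> t <= b ->
     `|N t - N s| <= \int[mu]_(u in `[s, t]) (al u * N u)) ->
  c \in `[a, b] -> N c = 0 -> forall t, t \in `[a, b] -> N t = 0.
Proof.
move=> cN N0 jal al0 incr cI Nc.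
have jalT : mu.-integrable [set: MR] (EFin \o (al \_ `[a, b])).
  rewrite -restrict_EFin; apply/(integrable_restrict mu (measurable_itv `[a, b]) measurableT).
  by rewrite setTI.
have h0 : 0 < 2^-1 :> K by rewrite invr_gt0.
have [e [e0 small]] := integral_normr_continuous jalT h0.
have half s t : a <= s -> s <= t -> t <= b -> t - s < e ->
    \int[mu]_(u in `[s, t]) al u < 2^-1.
  move=> as_ st tb tse.
  have mst : (mu `[s, t] < e%:E)%E.
    rewrite lebesgue_measure_itv /=; case: ifP => _; last by rewrite lte_fin.
    by rewrite -EFinB lte_fin.
  have := small _ (measurable_itv `[s, t]) mst; apply: le_lt_trans.
  rewrite le_eqVlt; apply/orP; left; apply/eqP; apply: Rint_ext => u uI.
  have uab : u \in `[a, b].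
    rewrite !in_itv /= in uI *.
    by case/andP: uI => su ut; rewrite (le_trans as_ su) (le_trans ut tb).
  by rewrite patchE mem_setE uab ger0_norm.
have bound s t M : a <= s -> s <= t -> t <= b -> t - s < e -> 0 <= M ->
    (forall u, u \in `[s, t] -> N u <= M) -> `|N t - N s| <= M * 2^-1.
  move=> as_ st tb tse M0 NM; apply: le_trans (incr s t as_ st tb) _.
  have jal' := int_sub as_ tb jal.
  apply: (@le_trans _ _ (\int[mu]_(u in `[s, t]) (M * al u))).
    apply: Rint_le; last by move=> u uI; rewrite mulrC ler_wpM2r ?NM.
      apply: int_bdM jal' _; apply: cont_bd; apply: continuous_subspaceW cN.
      by apply: subset_itv; rewrite bnd_simp.
    exact: intZ.
  by rewrite RintZ// ler_wpM2l// ltW// half.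
have step s t : a <= s -> t <= b -> s <= t -> t - s < e ->
    (N s = 0 -> N t = 0) /\ (N t = 0 -> N s = 0).
  move=> as_ tb st tse.
  have cst : {within `[s, t], continuous N}.
    by apply: continuous_subspaceW cN; apply: subset_itv; rewrite bnd_simp.
  have [p pI pmax] := EVT_max st cst.
  have /andP[sp pt] : (s <= p) && (p <= t) by rewrite in_itv /= in pI.
  have tI : t \in `[s, t] by rewrite in_itv /= st lexx.
  have sI : s \in `[s, t] by rewrite in_itv /= st lexx.
  split => z.
  - have := bound s p (N p) as_ sp (le_trans pt tb).
    rewrite (le_lt_trans _ tse) ?lerB// => /(_ isT (N0 p)).
    rewrite z subr0 ger0_norm// => h.
    have : N t <= 0.
      apply: le_trans (pmax t tI) _; have := N0 p; have : N p <= N p * 2^-1.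
        apply: h => u /[!in_itv]/= /andP[su up]; apply: pmax.
        by rewrite in_itv /= su (le_trans up pt).
      lra.
    by move=> Nt; apply/eqP; rewrite eq_le Nt N0.
  - have := bound p t (N p) (le_trans as_ sp) pt tb.
    rewrite (le_lt_trans _ tse) ?lerB// => /(_ isT (N0 p)).
    rewrite z sub0r normrN ger0_norm// => h.
    have : N s <= 0.
      apply: le_trans (pmax s sI) _; have := N0 p; have : N p <= N p * 2^-1.
        apply: h => u /[!in_itv]/= /andP[pu ut]; apply: pmax.
        by rewrite in_itv /= ut (le_trans sp pu).
      lra.
    by move=> Nt; apply/eqP; rewrite eq_le Nt N0.
(* induction on the number k of steps that separate t from c; the intermediate
   point s lies at the fraction k / k.+1 of the way from c to t *)
pose e' := e / 2; have e'0 : 0 < e' by rewrite divr_gt0.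
have reach k : forall t, t \in `[a, b] -> `|t - c| <= k%:R * e' -> N t = 0.
  elim: k => [|k IH] t tI.
    by rewrite mul0r normr_le0 subr_eq0 => /eqP ->.
  rewrite !in_itv /= in tI cI; move=> tc.
  have k0 : 0 < k.+1%:R :> K by rewrite ltr0n.
  pose th : K := k%:R / k.+1%:R.
  have th0 : 0 <= th by rewrite divr_ge0.
  have th1 : 1 - th = k.+1%:R^-1.
    by rewrite /th -[X in X - _](divff (lt0r_neq0 k0)) -mulrBl -natrB ?subSnn ?mul1r.
  have thle : th <= 1 by rewrite -subr_ge0 th1 invr_ge0 ltW.
  pose s := c + th * (t - c).
  have ts : t - s = (1 - th) * (t - c) by rewrite /s; ring.
  have sI : (a <= s) && (s <= b).
    case/andP: tI => at_ tb; case/andP: cI => ac cb.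
    have -> : s = th * t + (1 - th) * c by rewrite /s; ring.
    by apply/andP; split; nra.
  have Ns : N s = 0.
    apply: IH; first by rewrite in_itv.
    rewrite /s addrAC subrr add0r normrM ger0_norm//.
    apply: le_trans (ler_wpM2l th0 tc) _.
    by rewrite /th mulrA mulrVK ?unitfE ?lt0r_neq0.
  have tse : `|t - s| < e.
    rewrite ts normrM ger0_norm ?subr_ge0// th1.
    apply: (@le_lt_trans _ _ e'); last by rewrite /e'; lra.
    by rewrite ler_pdivrMl.
  case/andP: sI => as_ sb; case/andP: tI => at_ tb.
  have [st|/ltW st] := leP s t.
    by have [] := step s t as_ tb st (le_lt_trans (ler_norm _) tse) => /(_ Ns).
  have [] := step t s at_ sb st; last by move=> _ /(_ Ns).
  by rewrite distrC in tse; exact: le_lt_trans (ler_norm _) tse.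
move=> t tI; apply: (reach (Num.truncn (`|t - c| / e')).+1) => //.
by rewrite -ler_pdivrMr// ltW// truncnS_gt.
Qed.
End PrimitiveCalculus.

(** * Matrix functions and uniqueness for linear equations *)

Section MatrixFunctions.
Context {K : realType} (a b : K).
Local Notation MR := (measurableTypeR K).
Local Notation mu := (@lebesgue_measure K).

Definition mx_on (P : (K -> K) -> Prop) p q (A : K -> 'M[K]_(p, q)) : Prop :=
  forall i j, P (fun t => A t i j).

Section Generic.
Variables P1 P2 P3 : (K -> K) -> Prop.
Hypothesis P3_0 : P3 (fun=> 0).
Hypothesis P3_D : forall f g, P3 f -> P3 g -> P3 (fun t => f t + g t).
Hypothesis P123 : forall f g, P1 f -> P2 g -> P3 (fun t => f t * g t).

Lemma mx_onT p q (A : K -> 'M[K]_(p, q)) :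
  mx_on P1 A -> mx_on P1 (fun t => (A t)^T).
Proof.
by move=> PA i j; rewrite (_ : (fun t => _) = fun t => A t j i)//; apply/funext => t; rewrite mxE.
Qed.

Lemma mx_onD p q (A B : K -> 'M[K]_(p, q)) :
  mx_on P3 A -> mx_on P3 B -> mx_on P3 (fun t => A t + B t).
Proof.
move=> PA PB i j; rewrite (_ : (fun t => _) = fun t => A t i j + B t i j); first exact: P3_D.
by apply/funext => t; rewrite mxE.
Qed.

Lemma mx_on_sum (I : Type) (s : seq I) (f : I -> K -> K) :
  (forall i, P3 (f i)) -> P3 (fun t => \sum_(i <- s) f i t).
Proof.
move=> Pf; elim: s => [|i s IH].
  by rewrite (_ : (fun t => _) = fun=> 0)//; apply/funext => t; rewrite big_nil.
rewrite (_ : (fun t => _) = fun t => f i t + \sum_(j <- s) f j t); first exact: P3_D.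
by apply/funext => t; rewrite big_cons.
Qed.

Lemma mx_onM p q l (A : K -> 'M[K]_(p, q)) (B : K -> 'M[K]_(q, l)) :
  mx_on P1 A -> mx_on P2 B -> mx_on P3 (fun t => A t *m B t).
Proof.
move=> PA PB i j; rewrite (_ : (fun t => _) = fun t => \sum_k A t i k * B t k j).
  by apply: mx_on_sum => k; exact: P123.
by apply/funext => t; rewrite mxE.
Qed.

Lemma mx_onZ p q (f : K -> K) (A : K -> 'M[K]_(p, q)) :
  P1 f -> mx_on P2 A -> mx_on P3 (fun t => f t *: A t).
Proof.
move=> Pf PA i j; rewrite (_ : (fun t => _) = fun t => f t * A t i j); first exact: P123.
by apply/funext => t; rewrite mxE.
Qed.

Lemma dotE n (x y : 'cV[K]_n) : dot x y = (x^T *m y) 0 0.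
Proof. by rewrite /dot mxE; apply: eq_bigr => i _; rewrite mxE. Qed.

End Generic.

Lemma on_dot (P1 P2 P3 : (K -> K) -> Prop) n (x y : K -> 'cV[K]_n) :
  P3 (fun=> 0) -> (forall f g, P3 f -> P3 g -> P3 (fun t => f t + g t)) ->
  (forall f g, P1 f -> P2 g -> P3 (fun t => f t * g t)) ->
  mx_on P1 x -> mx_on P2 y -> P3 (fun t => dot (x t) (y t)).
Proof.
move=> P0 PD PM Px Py.
by rewrite /dot; apply: (mx_on_sum P0 PD) => i; exact: PM.
Qed.

Local Notation meas := (meas_on a b).
Local Notation bd := (bd_on a b).
Local Notation int := (int_on a b).
Local Notation sq := (sq_on a b).

Definition mx_bd_bd := mx_onM (bd_cst a b 0) (@bdD _ a b) (@bdM _ a b).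
Definition mx_bd_int := mx_onM (int0 a b) (@intD _ a b) (@bd_intM _ a b).
Definition mx_int_bd := mx_onM (int0 a b) (@intD _ a b) (@int_bdM _ a b).
Definition mx_sq_sq := mx_onM (int0 a b) (@intD _ a b) (@sqM _ a b).
Definition mx_bd_sq := mx_onM (bd_sq (bd_cst a b 0)) (@sqD _ a b) (@bd_sqM _ a b).
Definition mx_sq_bd := mx_onM (bd_sq (bd_cst a b 0)) (@sqD _ a b) (@sq_bdM _ a b).
Definition mx_meas := mx_onM (@meas_cst _ a b 0) (@meas_add _ a b) (@meas_mul _ a b).
Definition mx_meas_add := mx_onD (@meas_add _ a b).

Lemma mx_meas_sub p q (A B : K -> 'M[K]_(p, q)) :
  mx_on meas A -> mx_on meas B -> mx_on meas (fun t => A t - B t).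
Proof.
move=> mA mB i j; apply: meas_ext (meas_sub (mA i j) (mB i j)) => t _.
by rewrite !mxE.
Qed.

End MatrixFunctions.

Section Derivatives.
Context {K : realType} (a b : K) (ab : a <= b).
Local Notation MR := (measurableTypeR K).
Local Notation mu := (@lebesgue_measure K).

Let mI := itv_meas a b.

Lemma Lfun_meas e (f : K -> K) :
  (f \_ `[a, b]) \in Lfun mu e -> meas_on a b f.
Proof.
rewrite inE => /andP[/[!inE]/= mf _].
have := @measurable_restrictT _ _ MR K `[a, b] f mI.
by move=> h; apply/h.
Qed.

Lemma Lfun1P (f : K -> K) : (f \_ `[a, b]) \in Lfun mu 1%E <-> int_on a b f.
Proof.
rewrite Lfun1_integrable -restrict_EFin.
by rewrite -(integrable_restrict mu mI measurableT) setTI.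
Qed.

Lemma Lfun2P (f : K -> K) : (f \_ `[a, b]) \in Lfun mu 2%:E <-> sq_on a b f.
Proof.
have e : (fun x => (f \_ `[a, b]) x ^+ 2) = (fun t => f t ^+ 2) \_ `[a, b].
  by apply/funext => x; rewrite !patchE; case: ifP => // _; rewrite expr0n.
split => [Lf|[mf f2]].
  split; first exact: Lfun_meas Lf.
  have := Lfun2_integrable_sqr Lf; rewrite e -restrict_EFin.
  by rewrite -(integrable_restrict mu mI measurableT) setTI.
rewrite inE; apply/andP; split; rewrite inE /=.
  exact/(@measurable_restrictT _ _ MR K `[a, b] f mI).
rewrite /finite_norm unlock; apply: poweR_lty.
have : mu.-integrable [set: MR] (EFin \o ((fun t => f t ^+ 2) \_ `[a, b])).
  rewrite -restrict_EFin; apply/(integrable_restrict mu mI measurableT).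
  by rewrite setTI.
move=> /integrableP[_]; rewrite -e; apply: le_lt_trans.
rewrite le_eqVlt; apply/orP; left; apply/eqP; apply: eq_integral => x _ /=.
by rewrite normrX powR_mulrn.
Qed.

Lemma mx_Lp1P p q (A : K -> 'M[K]_(p, q)) :
  mx_Lp a b 1%E A <-> mx_on (int_on a b) A.
Proof. by split => h i j; apply/Lfun1P. Qed.

Lemma mx_Lp2P p q (A : K -> 'M[K]_(p, q)) :
  mx_Lp a b 2%:E A <-> mx_on (sq_on a b) A.
Proof. by split => h i j; apply/Lfun2P. Qed.

Lemma hdP p q (f g : K -> 'M[K]_(p, q)) : has_derivative a b f g <->
  forall i j, prim a b (fun t => f t i j) (fun t => g t i j).
Proof.
split=> [[/mx_Lp1P jg fE] i j|h].
  split => // t tI; have /matrixP/(_ i j) := fE t tI.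
  by rewrite !mxE.
split; first by apply/mx_Lp1P => i j; case: (h i j).
move=> t tI; apply/matrixP => i j; rewrite !mxE.
by have [_ /(_ t tI)] := h i j.
Qed.

Implicit Types p q : nat.

Lemma hd_ext p q (f f2 g g2 : K -> 'M[K]_(p, q)) :
  (forall t, t \in `[a, b] -> f t = f2 t) ->
  (forall t, t \in `[a, b] -> g t = g2 t) ->
  has_derivative a b f g -> has_derivative a b f2 g2.
Proof.
move=> ff gg /hdP h; apply/hdP => i j; apply: prim_ext (h i j) => // t tI.
  by rewrite ff.
by rewrite gg.
Qed.

Lemma hd_int p q (f g : K -> 'M[K]_(p, q)) :
  has_derivative a b f g -> mx_on (int_on a b) g.
Proof. by case=> /mx_Lp1P. Qed.

Lemma hd_cst p q (c : 'M[K]_(p, q)) : has_derivative a b (fun=> c) (fun=> 0).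
Proof.
by apply/hdP => i j; apply: prim_ext (prim_cst a b (c i j)) => // t _; rewrite mxE.
Qed.

Lemma hdD p q (f f' g g' : K -> 'M[K]_(p, q)) :
  has_derivative a b f f' -> has_derivative a b g g' ->
  has_derivative a b (fun t => f t + g t) (fun t => f' t + g' t).
Proof.
move=> /hdP hf /hdP hg; apply/hdP => i j.
by apply: prim_ext (primD (hf i j) (hg i j)) => // t _; rewrite mxE.
Qed.

Lemma hdZ p q r (f f' : K -> 'M[K]_(p, q)) : has_derivative a b f f' ->
  has_derivative a b (fun t => r *: f t) (fun t => r *: f' t).
Proof.
move=> /hdP hf; apply/hdP => i j.
by apply: prim_ext (primZ r (hf i j)) => // t _; rewrite mxE.
Qed.

Lemma hdN p q (f f' : K -> 'M[K]_(p, q)) : has_derivative a b f f' ->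
  has_derivative a b (fun t => - f t) (fun t => - f' t).
Proof. by move=> /(hdZ (-1)); apply: hd_ext => t _; rewrite scaleN1r. Qed.

Lemma hdT p q (f f' : K -> 'M[K]_(p, q)) : has_derivative a b f f' ->
  has_derivative a b (fun t => (f t)^T) (fun t => (f' t)^T).
Proof.
by move=> /hdP hf; apply/hdP => i j; apply: prim_ext (hf j i) => // t _; rewrite mxE.
Qed.

Lemma hdM p q l (f f' : K -> 'M[K]_(p, q)) (g g' : K -> 'M[K]_(q, l)) :
  has_derivative a b f f' -> has_derivative a b g g' ->
  has_derivative a b (fun t => f t *m g t) (fun t => f' t *m g t + f t *m g' t).
Proof.
move=> /hdP hf /hdP hg; apply/hdP => i j.
have := prim_sum (index_enum 'I_q) (fun k => prim_mul ab (hf i k) (hg k j)).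
apply: prim_ext => // t _; rewrite !mxE ?big_split//.
Qed.

Lemma hd_max p q t (f g : K -> 'M[K]_(p, q)) : t \in `[a, b] ->
  has_derivative a b f g ->
  has_derivative a b (fun s => f (Num.max s t)) (fun s => ind t s *: g s).
Proof.
move=> tI /hdP h; apply/hdP => i j.
by apply: prim_ext (prim_max tI (h i j)) => // s _; rewrite mxE.
Qed.

Lemma hd_indef p q (g : K -> 'M[K]_(p, q)) : mx_on (int_on a b) g ->
  has_derivative a b (fun t => mx_int `[a, t] g) g.
Proof.
move=> jg; apply/hdP => i j.
by apply: prim_ext (indef_prim (jg i j)) => // t _; rewrite mxE.
Qed.

Lemma hd_bd p q (f g : K -> 'M[K]_(p, q)) :
  has_derivative a b f g -> mx_on (bd_on a b) f.
Proof. by move=> /hdP h i j; exact: prim_bd (h i j). Qed.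

Lemma hd_dot n (f f' g g' : K -> 'cV[K]_n) :
  has_derivative a b f f' -> has_derivative a b g g' ->
  prim a b (fun t => dot (f t) (g t))
           (fun t => dot (f' t) (g t) + dot (f t) (g' t)).
Proof.
move=> hf hg; have /hdP/(_ 0 0) := hdM (hdT hf) hg.
by apply: prim_ext => // t _; rewrite !dotE// mxE.
Qed.

Definition nrm1 p q (A : 'M[K]_(p, q)) : K := \sum_i \sum_j `|A i j|.

Lemma nrm1_ge0 p q (A : 'M[K]_(p, q)) : 0 <= nrm1 A.
Proof. by do 2 (apply: sumr_ge0 => ? _). Qed.

Lemma nrm1_ge p q (A : 'M[K]_(p, q)) i j : `|A i j| <= nrm1 A.
Proof.
rewrite /nrm1 (bigD1 i)//= (bigD1 j)//= -addrA lerDl addr_ge0//.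
  exact: sumr_ge0.
by do 2 (apply: sumr_ge0 => ? _).
Qed.

Lemma nrm1M p q l (A : 'M[K]_(p, q)) (B : 'M[K]_(q, l)) :
  nrm1 (A *m B) <= nrm1 A * nrm1 B.
Proof.
rewrite {1 2}/nrm1 mulr_suml; apply: ler_sum => i _.
apply: (@le_trans _ _ (\sum_j \sum_k `|A i k| * `|B k j|)).
  apply: ler_sum => j _; rewrite mxE; apply: le_trans (ler_norm_sum _ _ _) _.
  by apply: ler_sum => k _; rewrite normrM.
rewrite exchange_big /= mulr_suml; apply: ler_sum => k _.
rewrite -mulr_sumr ler_wpM2l// /nrm1 [leRHS](bigD1 k)//= lerDl.
by do 2 (apply: sumr_ge0 => ? _).
Qed.

Lemma cont_sum (I : Type) (s : seq I) (f : I -> K -> K) :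
  (forall i, {within `[a, b], continuous (f i)}) ->
  {within `[a, b], continuous (fun t => \sum_(i <- s) f i t)}.
Proof.
move=> cf; elim: s => [|i s IH].
  rewrite (_ : (fun t => _) = fun=> 0); first by move=> t; exact: cvg_cst.
  by apply/funext => t; rewrite big_nil.
rewrite (_ : (fun t => _) = fun t => f i t + \sum_(j <- s) f j t).
  by move=> t; apply: cvgD; [exact: cf | exact: IH].
by apply/funext => t; rewrite big_cons.
Qed.

Lemma int_nrm1 p q (A : K -> 'M[K]_(p, q)) : mx_on (int_on a b) A ->
  int_on a b (fun t => nrm1 (A t)).
Proof. by move=> jA; do 2 (apply: int_sum => ?); exact: int_norm. Qed.

(** Gronwall's lemma for the entrywise norm. The zero [c] is allowed to be an
    interior point because the transition matrix is compared both forwards and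
    backwards in time. *)
Lemma ode_zero n q (A : K -> 'M[K]_n) (y : K -> 'M[K]_(n, q)) c :
  mx_on (int_on a b) A -> has_derivative a b y (fun t => A t *m y t) ->
  c \in `[a, b] -> y c = 0 -> forall t, t \in `[a, b] -> y t = 0.
Proof.
move=> jA hy cI yc t tI.
suff Nt : nrm1 (y t) = 0.
  apply/matrixP => i j; rewrite mxE; apply/eqP; rewrite -normr_le0 -Nt.
  exact: nrm1_ge.
have /hdP h := hy.
apply: (@gronwall_zero _ a b (fun t => nrm1 (y t)) (fun t => nrm1 (A t)) c) tI => //.
- do 2 (apply: cont_sum => ?); move=> u.
  apply: cvg_comp; last exact: norm_continuous.
  exact: (prim_cont ab (h _ _)).
- by move=> u; exact: nrm1_ge0.
- exact: int_nrm1.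
- by move=> u; exact: nrm1_ge0.
- move=> s u as_ su ub.
  have jAs p l (B : K -> 'M[K]_(p, l)) : mx_on (int_on a b) B -> mx_on (int_on s u) B.
    by move=> jB i j; exact: int_sub as_ ub (jB i j).
  have jAy := jAs _ _ _ (hd_int hy).
  apply: (@le_trans _ _ (\int[mu]_(x in `[s, u]) nrm1 (A x *m y x))).
    rewrite /nrm1 -sumrB; apply: le_trans (ler_norm_sum _ _ _) _.
    rewrite Rint_sum; last by move=> i; apply: int_sum => j; exact/int_norm/jAy.
    apply: ler_sum => i _; rewrite -sumrB; apply: le_trans (ler_norm_sum _ _ _) _.
    rewrite Rint_sum; last by move=> j; exact/int_norm/jAy.
    apply: ler_sum => j _; apply: (@le_trans _ _ `|y u i j - y s i j|).
      exact: ler_dist_dist.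
    rewrite (prim_incr as_ su ub (h i j)) addrC addKr.
    exact: (Rint_norm (int_meas (jAy i j)) (int_norm (jAy i j)) (fun _ _ => lexx _)).
  apply: Rint_le => [||x _]; last exact: nrm1M.
    by do 2 (apply: int_sum => ?); exact: int_norm.
  apply: int_bdM.
    by do 2 (apply: int_sum => ?); exact/int_norm/jAs.
  have cN : {within `[a, b], continuous (fun t => nrm1 (y t))}.
    do 2 (apply: cont_sum => ?); move=> x.
    apply: cvg_comp; last exact: norm_continuous.
    exact: (prim_cont ab (h _ _)).
  apply: cont_bd; apply: continuous_subspaceW cN.
  by apply: subset_itv; rewrite bnd_simp.
- by rewrite yc; apply: big1 => i _; apply: big1 => j _; rewrite mxE normr0.
Qed.

End Derivatives.

(** * The transition matrix in its second variable *)

Section TransitionMatrix.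
Context {K : realType} (a b : K) (ab : a <= b) (n : nat).
Local Notation mu := (@lebesgue_measure K).
Variables (A : K -> 'M[K]_n) (Phi : K -> K -> 'M[K]_n).
Hypothesis jA : mx_on (int_on a b) A.
Hypothesis Phi1 : forall t, t \in `[a, b] -> Phi t t = 1%:M.
Hypothesis hPhi : forall t, t \in `[a, b] ->
  has_derivative a b (Phi ^~ t) (fun tau => A tau *m Phi tau t).

Let aI : a \in `[a, b]. Proof. by rewrite in_itv /= lexx. Qed.

Lemma cont_mul (f g : K -> K) : {within `[a, b], continuous f} ->
  {within `[a, b], continuous g} -> {within `[a, b], continuous (fun t => f t * g t)}.
Proof. by move=> cf cg t; apply: cvgM; [exact: cf | exact: cg]. Qed.

Lemma cont_prod (I : Type) (s : seq I) (f : I -> K -> K) :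
  (forall i, {within `[a, b], continuous (f i)}) ->
  {within `[a, b], continuous (fun t => \prod_(i <- s) f i t)}.
Proof.
move=> cf; elim: s => [|i s IH].
  rewrite (_ : (fun t => _) = fun=> 1); first by move=> t; exact: cvg_cst.
  by apply/funext => t; rewrite big_nil.
rewrite (_ : (fun t => _) = fun t => f i t * \prod_(j <- s) f j t).
  exact: cont_mul.
by apply/funext => t; rewrite big_cons.
Qed.

Lemma cont_det p (X : K -> 'M[K]_p) : mx_on (fun f => {within `[a, b], continuous f}) X ->
  {within `[a, b], continuous (fun t => \det (X t))}.
Proof.
move=> cX; apply: cont_sum => s; apply: cont_mul.
  by move=> t; exact: cvg_cst.
by apply: cont_prod => i; exact: cX.
Qed.

(** The determinant is continuous without zero on a compact interval, hence
    bounded away from zero. *)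
Lemma bd_invmx p (X : K -> 'M[K]_p) :
  mx_on (fun f => {within `[a, b], continuous f}) X ->
  (forall t, t \in `[a, b] -> X t \in unitmx) ->
  mx_on (bd_on a b) (fun t => invmx (X t)).
Proof.
move=> cX uX i j.
have cd : {within `[a, b], continuous (fun t => (\det (X t))^-1)}.
  have := cont_det cX; move=> c.
  apply/subspace_continuousP => t /= tI; apply: cvgV.
    by have := uX t tI; rewrite unitmxE unitfE.
  by have /subspace_continuousP := c; apply.
have ca : {within `[a, b], continuous (fun t => \det (row' j (col' i (X t))))}.
  apply: cont_det => k l.
  rewrite (_ : (fun t => _) = fun t => X t (lift j k) (lift i l)); first exact: cX.
  by apply/funext => t; rewrite !mxE.
have bi := bdM (cont_bd cd) (bdM (bd_cst a b ((-1) ^+ (j + i))) (cont_bd ca)).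
case: bi => mi [C Ci].
have e t : t \in `[a, b] ->
    (\det (X t))^-1 * ((-1) ^+ (j + i) * \det (row' j (col' i (X t)))) =
    invmx (X t) i j.
  by move=> tI; rewrite /invmx (uX t tI) !mxE /cofactor.
split; first exact: meas_ext mi.
by exists C => t tI; rewrite -e// Ci.
Qed.

(** Both sides solve the same linear equation in [tau] and agree at [s]. *)
Lemma transition_comp tau s t : tau \in `[a, b] -> s \in `[a, b] ->
  t \in `[a, b] -> Phi tau s *m Phi s t = Phi tau t.
Proof.
move=> tauI sI tI.
have h := hdD ab (hdM ab (hPhi sI) (hd_cst ab (Phi s t))) (hdN ab (hPhi tI)).
apply/eqP; rewrite -subr_eq0; apply/eqP.
apply: (@ode_zero _ a b ab _ _ A (fun u => Phi u s *m Phi s t - Phi u t) s) => //.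
  apply: hd_ext h => // u _.
  by rewrite mulmx0 addr0 -mulmxA -mulmxN -mulmxDr.
by rewrite Phi1// mul1mx subrr.
Qed.

Lemma transition_inv s t : s \in `[a, b] -> t \in `[a, b] ->
  Phi s t *m Phi t s = 1%:M.
Proof. by move=> sI tI; rewrite transition_comp// Phi1. Qed.

(** The transition matrix is only given through its equation in the first
    variable; its dependence on the second one is found by integrating the
    adjoint equation and comparing. *)
Lemma hd_adjoint :
  has_derivative a b (fun s => Phi a s) (fun s => - (Phi a s *m A s)).
Proof.
pose X s := Phi s a; pose Y s := Phi a s.
have YX s : s \in `[a, b] -> Y s *m X s = 1%:M by move=> sI; exact: transition_inv.
have XY s : s \in `[a, b] -> X s *m Y s = 1%:M by move=> sI; exact: transition_inv.
have hX : has_derivative a b X (fun s => A s *m X s) := hPhi aI.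
have bX := hd_bd ab hX.
have uX s : s \in `[a, b] -> X s \in unitmx.
  by move=> sI; case/mulmx1_unit: (XY s sI).
have bY : mx_on (bd_on a b) Y.
  have /hdP hX' := hX.
  have bi := bd_invmx (fun i j => prim_cont ab (hX' i j)) uX.
  have e t : t \in `[a, b] -> invmx (X t) = Y t.
    by move=> tI; rewrite -[LHS]mul1mx -(YX t tI) mulmxK// uX.
  move=> i j; have [m [C Ci]] := bi i j; split.
    by apply: meas_ext m => t tI; rewrite e.
  by exists C => t tI; rewrite -e// Ci.
have jYA := mx_bd_int bY jA.
(* Z is the primitive that Y should be; the difference D = Z X - 1 solves the
   linear equation D' = D (Y A X) and vanishes at a *)
pose Z t := 1%:M - mx_int `[a, t] (fun s => Y s *m A s).
have hZ : has_derivative a b Z (fun t => - (Y t *m A t)).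
  have := hdD ab (hd_cst ab 1%:M) (hdN ab (hd_indef ab jYA)).
  by apply: hd_ext => // t _; rewrite add0r.
have hD := hdD ab (hdM ab hZ hX) (hd_cst ab (- 1%:M)).
pose B t := (Y t *m A t *m X t)^T.
have jB : mx_on (int_on a b) B by apply: mx_onT; exact: mx_int_bd.
have D0 t : t \in `[a, b] -> (Z t *m X t - 1%:M)^T = 0.
  move=> tI; apply: (@ode_zero _ a b ab _ _ B (fun t => (Z t *m X t - 1%:M)^T) a jB _ aI _ t tI).
    apply: hd_ext (hdT ab hD) => // u uI.
    rewrite /B -trmx_mul; congr (_^T).
    move: (Z u) => z.
    rewrite addr0 mulmxBl mul1mx mulNmx addrC -(mulmxA z); congr (z *m _ - _).
    by rewrite -(mulmxA (Y u)) mulmxA XY// mul1mx.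
  by rewrite /X Phi1// mulmx1 /Z /mx_int set_itv1 (_ : \matrix_(i, j) _ = 0) ?subr0 ?subrr ?trmx0//;
    apply/matrixP => i j; rewrite !mxE Rintegral_set1.
have ZY t : t \in `[a, b] -> Z t = Y t.
  move=> tI; have /(congr1 trmx) := D0 t tI; rewrite trmxK trmx0 => /eqP.
  by rewrite subr_eq0 => /eqP e; rewrite -[Z t]mulmx1 -(XY t tI) mulmxA e mul1mx.
by apply: hd_ext hZ => // t tI; rewrite ?ZY.
Qed.

End TransitionMatrix.

(** * Coercive and positive semidefinite matrices *)

Section Dot.
Context {K : realType}.
Implicit Types n m : nat.

Lemma dotC n (x y : 'cV[K]_n) : dot x y = dot y x.
Proof. by apply: eq_bigr => i _; rewrite mulrC. Qed.
Lemma dotDl n (x y z : 'cV[K]_n) : dot (x + y) z = dot x z + dot y z.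
Proof. by rewrite /dot -big_split; apply: eq_bigr => i _; rewrite mxE mulrDl. Qed.
Lemma dotZl n a (x z : 'cV[K]_n) : dot (a *: x) z = a * dot x z.
Proof. by rewrite /dot mulr_sumr; apply: eq_bigr => i _; rewrite mxE mulrA. Qed.
Lemma dotNl n (x z : 'cV[K]_n) : dot (- x) z = - dot x z.
Proof. by rewrite -scaleN1r dotZl mulN1r. Qed.
Lemma dotBl n (x y z : 'cV[K]_n) : dot (x - y) z = dot x z - dot y z.
Proof. by rewrite dotDl dotNl. Qed.
Lemma dotDr n (x y z : 'cV[K]_n) : dot z (x + y) = dot z x + dot z y.
Proof. by rewrite dotC dotDl !(dotC _ z). Qed.
Lemma dotZr n a (x z : 'cV[K]_n) : dot z (a *: x) = a * dot z x.
Proof. by rewrite dotC dotZl dotC. Qed.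
Lemma dotNr n (x z : 'cV[K]_n) : dot z (- x) = - dot z x.
Proof. by rewrite dotC dotNl dotC. Qed.
Lemma dotBr n (x y z : 'cV[K]_n) : dot z (x - y) = dot z x - dot z y.
Proof. by rewrite dotDr dotNr. Qed.
Lemma dot0l n (z : 'cV[K]_n) : dot 0 z = 0.
Proof. by rewrite -(scale0r z) dotZl mul0r. Qed.
Lemma dot0r n (z : 'cV[K]_n) : dot z 0 = 0.
Proof. by rewrite dotC dot0l. Qed.

Lemma dot_ge0 n (x : 'cV[K]_n) : 0 <= dot x x.
Proof. by apply: sumr_ge0 => i _; rewrite -expr2 sqr_ge0. Qed.

Lemma sqr_le_dot n (x : 'cV[K]_n) i : x i 0 ^+ 2 <= dot x x.
Proof.
rewrite /dot (bigD1 i)//= -expr2 lerDl; apply: sumr_ge0 => j _.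
by rewrite -expr2 sqr_ge0.
Qed.

Lemma dot_eq0 n (x : 'cV[K]_n) : dot x x <= 0 -> x = 0.
Proof.
move=> x0; apply/matrixP => i j; rewrite ord1 mxE; apply/eqP.
by rewrite -sqrf_eq0 eq_le sqr_ge0 (le_trans (sqr_le_dot x i) x0).
Qed.

Lemma dot_mulmx n m (A : 'M[K]_(m, n)) x (y : 'cV[K]_m) :
  dot (A *m x) y = dot x (A^T *m y).
Proof. by rewrite !dotE trmx_mul mulmxA. Qed.

Lemma dot_young n s (x y : 'cV[K]_n) : 0 < s ->
  `|dot x y| <= s * dot y y + s^-1 * dot x x.
Proof.
move=> s0; have si : 0 < s^-1 by rewrite invr_gt0.
have h e : e ^+ 2 = 1 -> 2 * (e * dot x y) <= s * dot y y + s^-1 * dot x x.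
  move=> ee; have := mulr_ge0 (ltW si) (dot_ge0 (x - (e * s) *: y)).
  have -> : s^-1 * dot (x - (e * s) *: y) (x - (e * s) *: y)
    = s^-1 * dot x x - 2 * (e * dot x y) + e ^+ 2 * s * dot y y.
    rewrite !(dotDl, dotDr, dotNl, dotNr, dotZl, dotZr) (dotC y x).
    by field; exact: lt0r_neq0.
  by rewrite ee; lra.
have h1 := h 1 (expr1n _ _).
have h2 : 2 * (-1 * dot x y) <= s * dot y y + s^-1 * dot x x by apply: h; rewrite sqrrN expr1n.
have p1 : 0 <= s * dot y y by rewrite mulr_ge0 ?dot_ge0 ?ltW.
have p2 : 0 <= s^-1 * dot x x by rewrite mulr_ge0 ?dot_ge0 ?ltW.
by rewrite ler_norml; apply/andP; split; lra.
Qed.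

Lemma dot_delta n (x : 'cV[K]_n) i : dot (delta_mx i 0) x = x i 0.
Proof.
rewrite /dot (bigD1 i)//= mxE !eqxx mul1r big1 ?addr0// => j ji.
by rewrite mxE (negbTE ji) mul0r.
Qed.

Lemma inj_unitmx n (A : 'M[K]_n) :
  (forall x : 'cV[K]_n, A *m x = 0 -> x = 0) -> A \in unitmx.
Proof.
move=> inj; rewrite -unitmx_tr -row_free_unit -kermx_eq0.
apply/eqP/row_matrixP => i; rewrite row0; apply: trmx_inj; rewrite trmx0; apply: inj.
apply: trmx_inj; rewrite trmx_mul trmxK trmx0.
by apply/eqP; rewrite -sub_kermx row_sub.
Qed.

Lemma psd_sym n (A : 'M[K]_n) : psd A -> A^T = A. Proof. by case. Qed.

Section Coercive.
Variables (m : nat) (R : 'M[K]_m) (r : K).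
Hypotheses (r0 : 0 < r) (Rr : psd (R - r%:M)).

Lemma coercive_sym : R^T = R.
Proof.
have /eqP := psd_sym Rr.
by rewrite raddfB /= tr_scalar_mx => /eqP/addIr.
Qed.

Lemma coercive_ge x : r * dot x x <= dot (R *m x) x.
Proof.
by have := Rr.2 x; rewrite mulmxBl mul_scalar_mx dotBl dotZl subr_ge0.
Qed.

Lemma coercive_ge0 x : 0 <= dot (R *m x) x.
Proof. by apply: le_trans (coercive_ge x); rewrite mulr_ge0 ?dot_ge0 ?ltW. Qed.

Lemma coercive_unit : R \in unitmx.
Proof.
apply: inj_unitmx => x Rx; apply: dot_eq0.
by have := coercive_ge x; rewrite Rx dot0l pmulr_rle0.
Qed.

Lemma coercive_formC x y : dot (R *m x) y = dot (R *m y) x.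
Proof. by rewrite dot_mulmx coercive_sym dotC. Qed.

(** For the column [x = R^-1 e_j], coercivity reads [r <x, x> <= x_j]. This gives
    first [x_j <= 1 / r], then [x_i ^ 2 <= <x, x> <= 1 / r ^ 2]. *)
Lemma coercive_invmx_le i j : `|invmx R i j| <= r^-1.
Proof.
pose x := invmx R *m delta_mx j 0 : 'cV[K]_m.
have Rx : R *m x = delta_mx j 0 by rewrite mulKVmx// coercive_unit.
have xE k : x k 0 = invmx R k j.
  rewrite /x mxE (bigD1 j)//= mxE !eqxx mulr1 big1 ?addr0// => l lj.
  by rewrite mxE (negbTE lj) mulr0.
have h : r * dot x x <= x j 0 by rewrite -dot_delta -Rx coercive_ge.
have hj := sqr_le_dot x j; have hi := sqr_le_dot x i; rewrite -xE.
have xj : x j 0 <= r^-1.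
  have : r * x j 0 ^+ 2 <= x j 0 by apply: le_trans h; rewrite ler_wpM2l// ltW.
  have [x0|x0] := leP (x j 0) 0; first by move=> _; rewrite (le_trans x0)// invr_ge0 ltW.
  by rewrite -div1r ler_pdivlMr// expr2 mulrA ger_pMl// mulrC.
rewrite -(@ler_pXn2r _ 2) ?nnegrE ?invr_ge0 ?normr_ge0 ?(ltW r0)//.
rewrite real_normK ?num_real//; apply: le_trans hi _.
rewrite -(ler_pM2l r0) (le_trans h)// expr2 mulrA divff ?mul1r//.
exact: lt0r_neq0.
Qed.
End Coercive.

(** A vector [x] of the kernel satisfies [<x, x> + <P S x, S x> = 0]. *)
Lemma unitmx_1SPS n (S P : 'M[K]_n) : S^T = S -> psd P ->
  1%:M + S *m P *m S \in unitmx.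
Proof.
move=> Ss [_ P0]; apply: inj_unitmx => x h; apply: dot_eq0.
have : dot (x + S *m (P *m (S *m x))) x = 0.
  have <- : (1%:M + S *m P *m S) *m x = x + S *m (P *m (S *m x)).
    by rewrite mulmxDl mul1mx !mulmxA.
  by rewrite h dot0l.
rewrite dotDl dot_mulmx Ss; have := P0 (S *m x); lra.
Qed.
End Dot.

(** * Vectors of minimal norm in a semi-Hilbert space *)

Section MinimalNorm.
Context {K : realType} {V : lmodType K}.
Variables (D : set V) (B : V -> V -> K).

Definition sq_cvg (u : nat -> V) (x : V) := forall eps, 0 < eps ->
  exists N : nat, forall i, (N <= i)%N -> B (u i - x) (u i - x) < eps.

Definition sq_cauchy (u : nat -> V) := forall eps, 0 < eps ->
  exists N : nat, forall i j, (N <= i)%N -> (N <= j)%N ->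
    B (u i - u j) (u i - u j) < eps.

(** A Hilbert space whose norm may vanish on nonzero vectors: controls are
    honest functions here and are never quotiented by equality almost
    everywhere. *)
Record semi_hilbert : Prop := {
  sh_zero : D 0;
  sh_lin : forall c x y, D x -> D y -> D (c *: x + y);
  sh_sym : forall x y, D x -> D y -> B x y = B y x;
  sh_form_lin : forall c x y z, D x -> D y -> D z ->
    B (c *: x + y) z = c * B x z + B y z;
  sh_ge0 : forall x, D x -> 0 <= B x x;
  sh_complete : forall u, (forall k, D (u k)) -> sq_cauchy u ->
    exists2 x, D x & sq_cvg u x
}.

Hypothesis HD : semi_hilbert.

Lemma shD x y : D x -> D y -> D (x + y).
Proof. by move=> Dx Dy; rewrite -(scale1r x); exact: sh_lin. Qed.
Lemma shZ c x : D x -> D (c *: x).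
Proof. by move=> Dx; rewrite -(addr0 (c *: x)); apply: (sh_lin HD) => //; exact: sh_zero. Qed.
Lemma shN x : D x -> D (- x).
Proof. by move=> Dx; rewrite -scaleN1r; exact: shZ. Qed.
Lemma shB x y : D x -> D y -> D (x - y).
Proof. by move=> Dx Dy; apply: shD => //; exact: shN. Qed.

Lemma formDl x y z : D x -> D y -> D z -> B (x + y) z = B x z + B y z.
Proof. by move=> Dx Dy Dz; rewrite -{1}(scale1r x) (sh_form_lin HD)// mul1r. Qed.
Lemma form0l z : D z -> B 0 z = 0.
Proof.
move=> Dz; have D0 := sh_zero HD; have := formDl D0 D0 Dz.
by rewrite addr0 => /eqP; rewrite -subr_eq0 opprD addNKr oppr_eq0 => /eqP.
Qed.
Lemma formZl c x z : D x -> D z -> B (c *: x) z = c * B x z.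
Proof.
move=> Dx Dz; have D0 := sh_zero HD.
by rewrite -(addr0 (c *: x)) (sh_form_lin HD)// form0l// addr0.
Qed.
Lemma formNl x z : D x -> D z -> B (- x) z = - B x z.
Proof. by move=> Dx Dz; rewrite -scaleN1r formZl// mulN1r. Qed.
Lemma formBl x y z : D x -> D y -> D z -> B (x - y) z = B x z - B y z.
Proof. by move=> Dx Dy Dz; rewrite formDl ?formNl//; exact: shN. Qed.
Lemma formDr x y z : D x -> D y -> D z -> B z (x + y) = B z x + B z y.
Proof.
by move=> Dx Dy Dz; rewrite (sh_sym HD) ?formDl ?(sh_sym HD _ Dz)//; exact: shD.
Qed.
Lemma formZr c x z : D x -> D z -> B z (c *: x) = c * B z x.
Proof. by move=> Dx Dz; rewrite (sh_sym HD) ?formZl ?(sh_sym HD _ Dz)//; exact: shZ. Qed.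
Lemma formBr x y z : D x -> D y -> D z -> B z (x - y) = B z x - B z y.
Proof.
by move=> Dx Dy Dz; rewrite (sh_sym HD) ?formBl ?(sh_sym HD _ Dz)//; exact: shB.
Qed.

Lemma form_sqrD x y : D x -> D y ->
  B (x + y) (x + y) = B x x + 2 * B x y + B y y.
Proof.
move=> Dx Dy; rewrite formDl ?formDr//; try exact: shD.
by rewrite (sh_sym HD Dy Dx); ring.
Qed.

Lemma parallelogram x y : D x -> D y ->
  B (x - y) (x - y) = 2 * B x x + 2 * B y y
     - 4 * B (2^-1 *: (x + y)) (2^-1 *: (x + y)).
Proof.
move=> Dx Dy; have DN := shN Dy; have Dxy := shD Dx Dy; have Dh := shZ 2^-1 Dxy.
rewrite formZl// formZr// !form_sqrD// formNl// (sh_sym HD Dy DN) formNl//.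
rewrite (sh_sym HD Dx DN) formNl// (sh_sym HD Dy Dx).
by field.
Qed.

Lemma form_young d x y : 0 < d -> D x -> D y ->
  B (x + y) (x + y) <= (1 + d) * B x x + (1 + d^-1) * B y y.
Proof.
move=> d0 Dx Dy; rewrite form_sqrD//.
have Ddx := shZ d Dx; have Ddy := shB Ddx Dy.
have := sh_ge0 HD Ddy.
rewrite formBl ?formBr// !formZl// !formZr// (sh_sym HD Dy Dx) => h.
have e : d^-1 * (d * (d * B x x) - d * B x y - (d * B x y - B y y))
   = d * B x x - 2 * B x y + d^-1 * B y y.
  by field; exact: lt0r_neq0.
have di : 0 <= d^-1 by rewrite invr_ge0 ltW.
by have := mulr_ge0 di h; rewrite e; lra.
Qed.

(** The parallelogram law makes a minimising sequence Cauchy. The limit is known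
    only through [B (u k - x) (u k - x)], whence the appeal to [form_young] to
    compare norms. *)
Lemma minimal_norm (A : set V) x0 : A `<=` D -> A x0 ->
  (forall x y, A x -> A y -> A (2^-1 *: (x + y))) ->
  (forall u x, (forall k, A (u k)) -> D x -> sq_cvg u x -> A x) ->
  exists2 x, A x & forall y, A y -> B x x <= B y y.
Proof.
move=> AD Ax0 Amid Acl.
pose E := [set B x x | x in A].
have E0 : has_inf E.
  split; first by exists (B x0 x0); exists x0.
  by exists 0 => _ [x Ax <-]; exact/(sh_ge0 HD)/AD.
pose c := inf E.
have cle x : A x -> c <= B x x by move=> Ax; apply: (ge_inf E0.2); exists x.
have near k : exists x, A x /\ B x x < c + k.+1%:R^-1.
  have k0 : 0 < k.+1%:R^-1 :> K by rewrite invr_gt0 ltr0n.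
  by have [_ [x Ax <-] h] := inf_adherent k0 E0; exists x.
have [u uP] := choice near.
have uA k : A (u k) by case: (uP k).
have small (eps : K) : 0 < eps -> exists N : nat, forall i, (N <= i)%N -> i.+1%:R^-1 < eps.
  move=> e0; exists (Num.truncn eps^-1) => i Ni.
  rewrite invf_plt ?posrE ?ltr0n//; apply: lt_le_trans (truncnS_gt _) _.
  by rewrite ler_nat ltnS.
have uC : sq_cauchy u.
  move=> eps e0; have e4 : 0 < eps / 4 by rewrite divr_gt0.
  have [N HN] := small _ e4.
  exists N => i j Ni Nj; rewrite parallelogram; try exact: AD.
  have near_c k : (N <= k)%N -> B (u k) (u k) < c + eps / 4.
    by move=> Nk; apply: lt_trans (uP k).2 _; rewrite ltrD2l HN.
  have := cle _ (Amid _ _ (uA i) (uA j)).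
  by have := near_c i Ni; have := near_c j Nj; lra.
have [x Dx ux] := sh_complete HD (fun k => AD _ (uA k)) uC.
have Ax := Acl u x uA Dx ux.
exists x => // y Ay; apply: le_trans (cle _ Ay).
apply/ler_addgt0Pr => eps e0.
have c0 : 0 <= c by apply: (lb_le_inf E0.1) => _ [z Az <-]; exact/(sh_ge0 HD)/AD.
pose d := eps / (4 * (c + 1)).
have d0 : 0 < d by rewrite divr_gt0// mulr_gt0//; lra.
have dE : d * (c + 1) = eps / 4.
  by rewrite /d; field; rewrite lt0r_neq0//; lra.
have s0 : 0 < eps / (4 * (1 + d^-1)).
  by rewrite divr_gt0// mulr_gt0// ltr_wpDr// invr_ge0 ltW.
have m0 : 0 < Num.min 1 (eps / 4) by rewrite lt_min ltr01 divr_gt0.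
have [N1 H1] := small _ m0; have [N2 H2] := ux _ s0.
pose k := maxn N1 N2; have [_ uk] := uP k.
have := H1 k (leq_maxl _ _); rewrite lt_min => /andP[k1 k4].
have := H2 k (leq_maxr _ _); set w := u k - x => wk.
have Dw : D w by apply: shB => //; exact: AD.
have -> : x = u k + (- w) by rewrite /w opprB addrC subrK.
apply: le_trans (form_young d0 (AD _ (uA k)) (shN Dw)) _.
rewrite formNl ?(sh_sym HD Dw) ?formNl ?opprK//; try exact: shN.
have di : 0 < 1 + d^-1 by rewrite ltr_wpDr// invr_ge0 ltW.
have w4 : (1 + d^-1) * B w w <= eps / 4.
  rewrite mulrC -ler_pdivlMr//; apply: le_trans (ltW wk) _.
  by rewrite le_eqVlt; apply/orP; left; apply/eqP; field; rewrite !lt0r_neq0//; nra.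
have uk1 : B (u k) (u k) < c + 1 by apply: lt_trans uk _; rewrite ltrD2l.
have uk4 : B (u k) (u k) < c + eps / 4 by apply: lt_trans uk _; rewrite ltrD2l.
have : d * B (u k) (u k) <= eps / 4 by rewrite -dE ler_wpM2l ?(ltW d0) ?(ltW uk1).
lra.
Qed.

Lemma minimal_orthogonal x w : D x -> D w ->
  (forall s, B x x <= B (x + s *: w) (x + s *: w)) -> B x w = 0.
Proof.
move=> Dx Dw h; have Dsw s := shZ s Dw.
(* s would be the minimiser of the quadratic if g + 1 were g, which may vanish *)
pose g := B w w; have g0 : 0 <= g := sh_ge0 HD Dw.
have g1 : 0 < g + 1 by lra.
pose s := - B x w / (g + 1).
have := h s; rewrite form_sqrD// formZr// formZl// formZr// -/g => {}h.
have e : 2 * (s * B x w) + s * (s * g) = - (B x w ^+ 2) * (g + 2) / (g + 1) ^+ 2.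
  by rewrite /s; field; exact: lt0r_neq0.
have : 0 <= - (B x w ^+ 2) * (g + 2) / (g + 1) ^+ 2 by rewrite -e; lra.
rewrite pmulr_lge0 ?invr_gt0 ?exprn_gt0// pmulr_lge0; last lra.
rewrite oppr_ge0 => b0; apply/eqP; rewrite -sqrf_eq0 eq_le b0 sqr_ge0//.
Qed.

End MinimalNorm.

(** * Limits of real sequences and series of functions *)

Section Limits.
Context {K : realType}.
Local Notation mu := (@lebesgue_measure K).
Local Notation MR := (measurableTypeR K).

(** Square increments summable against [2 ^ k] have summable absolute values,
    since [x <= 2 ^- k + 2 ^ k * x ^ 2]. *)
Lemma cvg_sq_increments (w e : nat -> K) :
  (forall k, (w k.+1 - w k) ^+ 2 <= e k) ->
  cvgn (series (fun k => 2 ^+ k * e k)) -> cvgn w.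
Proof.
move=> we ce.
have e0 k : 0 <= e k by apply: le_trans (we k); exact: sqr_ge0.
suff ct : cvgn (series (telescope w)).
  rewrite (_ : w = fun n => w 0%N + series (telescope w) n); last first.
    by apply/funext => n; rewrite -eq_sum_telescope.
  by apply: is_cvgD => //; exact: is_cvg_cst.
apply: normed_cvg; pose g : nat -> K := geometric 1 2^-1.
have g0 k : 0 <= g k by rewrite /g /= mul1r exprn_ge0// invr_ge0.
have p0 k : 0 < 2 ^+ k :> K by rewrite exprn_gt0.
apply: (@series_le_cvg _ _ (fun k => g k + 2 ^+ k * e k)).
- by move=> k /=.
- by move=> k; rewrite addr_ge0 ?mulr_ge0 ?e0 ?(ltW (p0 k)).
- move=> k; rewrite /telescope /= /g /= mul1r exprVn.
  set x := w k.+1 - w k.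
  have : 2 ^+ k * x ^+ 2 <= 2 ^+ k * e k by rewrite ler_wpM2l ?(ltW (p0 k))// we.
  move=> h; apply: le_trans (lerD (lexx _) h).
  rewrite -(ler_pM2l (p0 k)) mulrDr divff ?lt0r_neq0// mulrA -expr2 -exprMn.
  rewrite -(real_normK (num_real (_ * x))) normrM (gtr0_norm (p0 k)).
  set z := (2 ^+ k * `|x|); have := sqr_ge0 (z - 2^-1); nra.
- apply: is_cvg_seriesD => //; apply: is_cvg_geometric_series.
  by rewrite ger0_norm ?invr_ge0// invf_lt1// ltr1n.
Qed.

Lemma cvg_fin_sum (I : Type) (s : seq I) (f : nat -> I -> K) (l : I -> K) :
  (forall i, f k i @[k --> \oo] --> l i) ->
  (\sum_(i <- s) f k i) @[k --> \oo] --> \sum_(i <- s) l i.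
Proof.
move=> fl; elim: s => [|i s IH].
  rewrite big_nil (_ : (fun k => _) = fun=> 0); first exact: cvg_cst.
  by apply/funext => k; rewrite big_nil.
rewrite big_cons (_ : (fun k => _) = fun k => f k i + \sum_(j <- s) f k j).
  exact: cvgD.
by apply/funext => k; rewrite big_cons.
Qed.

Lemma cvg_form m (R : 'M[K]_m) (x : nat -> 'cV[K]_m) (y : 'cV[K]_m) :
  (forall i, x k i 0 @[k --> \oo] --> y i 0) ->
  dot (R *m x k) (x k) @[k --> \oo] --> dot (R *m y) y.
Proof.
move=> xy; apply: cvg_fin_sum => i; apply: cvgM; last exact: xy.
rewrite mxE (_ : (fun k => _) = fun k => \sum_j R i j * x k j 0).
  by apply: cvg_fin_sum => j; apply: cvgM; [exact: cvg_cst | exact: xy].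
by apply/funext => k; rewrite mxE.
Qed.

Lemma limn_einf_le (u : nat -> \bar K) (c : \bar K) :
  (exists N : nat, forall k, (N <= k)%N -> (u k <= c)%E) -> (limn_einf u <= c)%E.
Proof.
move=> [N uc]; rewrite limn_einf_lim; apply: lime_le.
  exact: is_cvg_einfs.
apply: nearW => k; apply: (@le_trans _ _ (u (maxn k N))).
  by apply: ereal_inf_lbound; exists (maxn k N) => //=; exact: leq_maxl.
by apply: uc; exact: leq_maxr.
Qed.

(** By monotone convergence the sum of the series is integrable, hence finite
    almost everywhere. *)
Lemma ae_cvg_series (D : set MR) (q : nat -> K -> K) (c : K) :
  measurable D ->
  (forall k, measurable_fun D (q k : MR -> K)) ->
  (forall k t, 0 <= q k t) ->
  (forall n, (\sum_(0 <= k < n) \int[mu]_(t in D) (q k t)%:E <= c%:E)%E) ->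
  exists N : set MR, [/\ measurable N, mu N = 0 &
    forall t, D t -> ~ N t -> cvgn (series (fun k => q k t))].
Proof.
move=> mD mq q0 qc.
pose E (t : MR) := (\sum_(0 <= k <oo) (q k t)%:E)%E.
have mqE k : measurable_fun D (fun t : MR => (q k t)%:E) by exact/measurable_EFinP.
have q0E k (t : MR) : D t -> (0 <= (q k t)%:E)%E by rewrite lee_fin.
have IE : (\int[mu]_(t in D) E t <= c%:E)%E.
  rewrite integral_nneseries//; apply: lime_le; last by apply: nearW => n.
  by apply: is_cvg_nneseries => n _ _; apply: integral_ge0 => t Dt; exact: q0E.
have E0 t : (0 <= E t)%E by apply: nneseries_ge0 => k _ _; rewrite lee_fin.
have iE : mu.-integrable D E.
  apply/integrableP; split.
    apply: (emeasurable_fun_cvg (fun n t => (\sum_(0 <= k < n) (q k t)%:E)%E)).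
      by move=> n; exact: emeasurable_sum.
    by move=> t _; apply: is_cvg_nneseries => k _ _; rewrite lee_fin.
  by under eq_integral do rewrite gee0_abs//; apply: le_lt_trans IE (ltry _).
have [N [mN N0 DN]] := integrable_ae mD iE.
exists N; split => // t Dt Nt.
apply: nnseries_is_cvg => //.
rewrite -ge0_fin_numE; last exact: E0.
by apply: contrapT => h; apply: Nt; apply: DN => /(_ Dt).
Qed.
Lemma vanish (C x : K) : (forall eps, 0 < eps -> `|x| <= C * eps) -> x = 0.
Proof.
move=> h; apply/eqP; rewrite -normr_le0; apply/ler_addgt0Pr => e e0.
have C1 : 0 < `|C| + 1 by rewrite ltr_wpDl.
have d0 : 0 < e / (`|C| + 1) by rewrite divr_gt0.
apply: le_trans (h _ d0) _; rewrite add0r mulrA ler_pdivrMr//.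
by rewrite mulrC ler_wpM2l ?(ltW e0)// (le_trans (ler_norm C))// lerDl.
Qed.

(** The Cauchy-Schwarz inequality for the form behind the quadratic, read off
    its values at [eps] and [- eps]. *)
Lemma quad_bound (x y z C eps : K) :
  (forall s, 0 <= s ^+ 2 * x + 2 * s * y + z) -> x <= C -> 0 <= C ->
  0 < eps -> z < eps ^+ 2 -> `|y| <= (C + 1) * eps.
Proof.
move=> sq xC C0 e0 ze; have s1 := sq eps; have s2 := sq (- eps).
rewrite sqrrN in s2; rewrite ler_norml.
have xCe : eps ^+ 2 * x <= eps ^+ 2 * C by rewrite ler_wpM2l ?sqr_ge0.
have aux v : 0 <= eps ^+ 2 * C + 2 * eps * v + eps ^+ 2 -> - ((C + 1) * eps) <= v.
  move=> h; have : 0 <= eps * (eps * (C + 1) + 2 * v).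
    by apply: le_trans h _; rewrite le_eqVlt; apply/orP; left; apply/eqP; ring.
  by rewrite pmulr_rge0// => h2; nra.
apply/andP; split; first by apply: aux; lra.
by rewrite -lerN2; apply: aux; lra.
Qed.

Lemma cauchy_limit (a : nat -> K) :
  (forall eps, 0 < eps -> exists N, forall i j, (N <= i)%N -> (N <= j)%N ->
     `|a i - a j| < eps) -> cvgn a.
Proof.
move=> aC; apply: cauchy_cvg; apply: cauchy_exP => eps e0.
have [N h] := aC eps e0; exists (a N); exists N => // k /= Nk.
exact: h.
Qed.

Lemma limit_bound (a : nat -> K) l x e N : a k @[k --> \oo] --> l ->
  (forall k, (N <= k)%N -> `|x - a k| <= e) -> `|x - l| <= e.
Proof.
move=> al h; have c : `|x - a k| @[k --> \oo] --> `|x - l|.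
  by apply: cvg_norm; apply: cvgB => //; exact: cvg_cst.
by apply: (cvgr_to_le c); exists N => // k /= Nk; exact: h.
Qed.

End Limits.

(** * Completeness of the controls of finite energy *)

Section NullSets.
Context {K : realType}.
Local Notation mu := (@lebesgue_measure K).
Local Notation MR := (measurableTypeR K).

Lemma EFin_Rint a b (f : K -> K) : int_on a b f ->
  (\int[mu]_(t in `[a, b]) (f t)%:E = (\int[mu]_(t in `[a, b]) f t)%:E)%E.
Proof.
move=> jf; rewrite /Rintegral fineK//.
exact: (@integrable_fin_num _ _ _ mu _ (itv_meas a b) (EFin \o f)).
Qed.

Lemma ae_int a b (N : set MR) (f g : K -> K) : measurable N -> mu N = 0 ->
  (forall t, t \in `[a, b] -> ~ N t -> f t = g t) -> meas_on a b g ->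
  int_on a b f ->
  int_on a b g /\ \int[mu]_(t in `[a, b]) f t = \int[mu]_(t in `[a, b]) g t.
Proof.
move=> mN N0 fg mg jf; have mf := int_meas jf.
have aeq (h : K -> \bar K) :
    ae_eq mu `[a, b]%classic (fun t : MR => h (f t)) (fun t => h (g t)).
  exists N; split => // t /=; apply: contra_notP => Nt tI.
  by rewrite fg.
have mE (u : K -> K) : meas_on a b u -> measurable_fun (`[a, b] : set MR) (EFin \o u).
  by move=> mu_; exact/measurable_EFinP.
have e : (\int[mu]_(t in `[a, b]) (f t)%:E = \int[mu]_(t in `[a, b]) (g t)%:E)%E.
  by apply: ae_eq_integral (aeq EFin); [exact: itv_meas | exact: mE..].
have e2 : (\int[mu]_(t in `[a, b]) `|(f t)%:E| = \int[mu]_(t in `[a, b]) `|(g t)%:E|)%E.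
  apply: ae_eq_integral (aeq (fun x => `|x%:E|%E)); first exact: itv_meas.
    by apply: measurableT_comp => //; exact: mE.
  by apply: measurableT_comp => //; exact: mE.
split; last by rewrite /Rintegral e.
apply/integrableP; split; first exact: mE.
by move/integrableP : jf => [_]; rewrite /= e2.
Qed.
End NullSets.

Section ControlSpace.
Context {K : realType} (a b : K) (n m : nat).
Local Notation mu := (@lebesgue_measure K).
Local Notation MR := (measurableTypeR K).
Variables (R : K -> 'M[K]_m) (r : K).
Hypotheses (mR : mx_on (meas_on a b) R) (r0 : 0 < r).
Hypothesis Rr : forall t, psd (R t - r%:M).

Local Notation ctlT := ('cV[K]_n * (K -> 'cV[K]_m))%type.

(** Pairs of finite energy; coercivity makes their controls square
    integrable. *)
Definition ctl : set ctlT := [set zv | mx_on (meas_on a b) zv.2 /\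
  int_on a b (fun t => dot (R t *m zv.2 t) (zv.2 t))].

Definition ctl_form (zv zv' : ctlT) : K := dot zv.1 zv'.1 +
  \int[mu]_(t in `[a, b]) dot (R t *m zv.2 t) (zv'.2 t).

Lemma meas_form (v w : K -> 'cV[K]_m) : mx_on (meas_on a b) v ->
  mx_on (meas_on a b) w -> meas_on a b (fun t => dot (R t *m v t) (w t)).
Proof.
move=> mv mw.
apply: (on_dot (P1 := meas_on a b) (P2 := meas_on a b) _ (@meas_add _ a b) (@meas_mul _ a b)) => //.
  exact: meas_cst.
exact: mx_meas.
Qed.

Lemma form_le t (x y : 'cV[K]_m) :
  `|dot (R t *m x) y| <= dot (R t *m x) x + dot (R t *m y) y.
Proof.
have hp := coercive_ge0 r0 (Rr t) (x + y); have hm := coercive_ge0 r0 (Rr t) (x - y).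
move: hp hm; rewrite !mulmxDr mulmxN !(dotDl, dotDr, dotNl, dotNr).
rewrite (coercive_formC (Rr t) y x) => hp hm.
have := coercive_ge0 r0 (Rr t) x; have := coercive_ge0 r0 (Rr t) y.
by move=> hy hx; rewrite ler_norml; apply/andP; split; lra.
Qed.

Lemma int_form (x y : ctlT) : ctl x -> ctl y ->
  int_on a b (fun t => dot (R t *m x.2 t) (y.2 t)).
Proof.
move=> [mx jx] [my jy]; apply: int_dom (intD jx jy) _; first exact: meas_form.
by move=> t _; exact: form_le.
Qed.

Lemma ctl_sq (x : ctlT) : ctl x -> mx_on (sq_on a b) x.2.
Proof.
move=> [mx jx] i j; split; first exact: mx.
apply: int_dom (intZ r^-1 jx) _; first exact: meas_mul.
move=> t _; rewrite ger0_norm ?sqr_ge0// ord1.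
rewrite mulrC ler_pdivlMr//; apply: le_trans (coercive_ge (Rr t) (x.2 t)).
by rewrite mulrC ler_wpM2l ?(ltW r0)// sqr_le_dot.
Qed.

Lemma ctl_zero : ctl 0.
Proof.
split => [i j|].
  apply: meas_ext (@meas_cst _ a b 0) => t _; by rewrite mxE.
by apply: int_ext (int0 a b) => t _; rewrite dot0r.
Qed.

Lemma ctl_lin c (x y : ctlT) : ctl x -> ctl y -> ctl (c *: x + y).
Proof.
move=> cx cy; have [mx jx] := cx; have [my jy] := cy; split => [i j|].
  apply: meas_ext (meas_add (meas_mul (@meas_cst _ a b c) (mx i j)) (my i j)) => t _.
  by rewrite /= !mxE.
have h := intD (intZ (c ^+ 2) jx) (intD (intZ (2 * c) (int_form cx cy)) jy).
apply: int_ext h => t _ /=.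
rewrite mulmxDr -scalemxAr !(dotDl, dotDr, dotZl, dotZr).
by rewrite (coercive_formC (Rr t) (y.2 t)); ring.
Qed.

Lemma ctl_form_lin c (x y z : ctlT) : ctl x -> ctl y -> ctl z ->
  ctl_form (c *: x + y) z = c * ctl_form x z + ctl_form y z.
Proof.
move=> cx cy cz; rewrite /ctl_form /= dotDl dotZl.
rewrite (@Rint_ext _ _ _ _ (fun t => c * dot (R t *m x.2 t) (z.2 t) + dot (R t *m y.2 t) (z.2 t))).
  rewrite RintD ?RintZ; try by [exact: int_form | exact/intZ/int_form].
  by ring.
by move=> t _; rewrite mulmxDr -scalemxAr dotDl dotZl.
Qed.

Lemma ctl_form_sym (x y : ctlT) : ctl_form x y = ctl_form y x.
Proof.
rewrite /ctl_form dotC; congr (_ + _); apply: Rint_ext => t _.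
exact: coercive_formC (Rr t) _ _.
Qed.

Lemma ctl_energy_ge0 (x : ctlT) : 0 <= \int[mu]_(t in `[a, b]) dot (R t *m x.2 t) (x.2 t).
Proof. by apply: Rintegral_ge0 => t _; exact: coercive_ge0 r0 (Rr t) _. Qed.

Lemma ctl_form_ge0 (x : ctlT) : 0 <= ctl_form x x.
Proof. by rewrite addr_ge0 ?dot_ge0 ?ctl_energy_ge0. Qed.

(** The Riesz-Fischer argument, run on the weighted energy itself: along a fast
    subsequence the controls converge almost everywhere, and Fatou's lemma turns
    the Cauchy estimate into convergence of the energy. Completeness of the
    unweighted square integrable functions would not be enough, as the weight
    need not be bounded. *)
Lemma ctl_complete (u : nat -> ctlT) : (forall k, ctl (u k)) -> sq_cauchy ctl_form u ->
  exists2 x, ctl x & sq_cvg ctl_form u x.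
Proof.
move=> cu uC.
have cuB i j : ctl (u i - u j).
  rewrite addrC -scaleN1r; exact: ctl_lin.
pose q (v : K -> 'cV[K]_m) t := dot (R t *m v t) (v t).
have q_ge0 v t : 0 <= q v t := coercive_ge0 r0 (Rr t) _.
have p4 k : 0 < 4 ^- k :> K by rewrite invr_gt0 exprn_gt0.
have [N NP] := choice (fun k => uC (4 ^- k) (p4 k)).
pose sg k := (\max_(i < k.+1) N i)%N.
have sgN k : (N k <= sg k)%N by exact: (@leq_bigmax _ (fun i : 'I_k.+1 => N i) ord_max).
have sgS k : (sg k <= sg k.+1)%N by rewrite /sg [X in (_ <= X)%N]big_ord_recr /= leq_maxl.
have sgm i k : (i <= k)%N -> (sg i <= sg k)%N.
  elim: k => [|k IH]; first by rewrite leqn0 => /eqP ->.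
  by rewrite leq_eqVlt => /predU1P[->//|/IH/leq_trans->].
have fast k : ctl_form (u (sg k.+1) - u (sg k)) (u (sg k.+1) - u (sg k)) < 4 ^- k.
  by apply: NP => //; exact: leq_trans (sgS k).
pose v k := (u k).2.
have mv k : mx_on (meas_on a b) (v k) by case: (cu k).
pose dv k := (u (sg k.+1) - u (sg k)).2.
have dvE k t : dv k t = v (sg k.+1) t - v (sg k) t by [].
have cdv k : int_on a b (q (dv k)) by case: (cuB (sg k.+1) (sg k)).
have sum2 l : \sum_(0 <= k < l) 2 ^- k = 2 - 2 * 2 ^- l :> K.
  elim: l => [|l IH]; first by rewrite big_nil expr0 invr1; ring.
  by rewrite big_nat_recr//= IH exprS; field; rewrite expf_neq0.
have ee (k : nat) : 2 ^+ k * 4 ^- k = 2 ^- k :> K.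
  have -> : 4 = 2 * 2 :> K by ring.
  by rewrite exprMn; field; rewrite expf_neq0.
have sums l : (\sum_(0 <= k < l) \int[mu]_(t in `[a, b]) (2 ^+ k * q (dv k) t)%:E <= 2%:E)%E.
  apply: (@le_trans _ _ (\sum_(0 <= k < l) (2 ^- k)%:E)%E).
    apply: lee_sum => k _.
    have jk := intZ (2 ^+ k) (cdv k).
    rewrite EFin_Rint// lee_fin RintZ// -ee.
    rewrite ler_wpM2l ?exprn_ge0//; apply: le_trans (ltW (fast k)).
    by rewrite /ctl_form lerDr dot_ge0.
  rewrite sumEFin lee_fin sum2 gerBl mulr_ge0// invr_ge0 exprn_ge0//.
have mq k : meas_on a b (fun t => 2 ^+ k * q (dv k) t).
  exact: meas_mul (@meas_cst _ a b _) (int_meas (cdv k)).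
have q2_ge0 k t : 0 <= 2 ^+ k * q (dv k) t by rewrite mulr_ge0 ?exprn_ge0.
have [Z [mZ Z0 Zc]] := ae_cvg_series (itv_meas a b) mq q2_ge0 sums.
(* off the null set Z the subsequence converges; on Z it is replaced by 0 *)
pose cut (w : K -> 'cV[K]_m) t := (1 - \1_Z t : K) *: w t.
have cutE w t : ~ Z t -> cut w t = w t.
  by move=> Zt; rewrite /cut indicE memNset// subr0 scale1r.
have cut0 w t : Z t -> cut w t = 0.
  by move=> Zt; rewrite /cut indicE mem_set// subrr scale0r.
have mcut w : mx_on (meas_on a b) w -> mx_on (meas_on a b) (cut w).
  apply: mx_onZ; first exact: meas_mul.
  exact: meas_sub (@meas_cst _ a b 1) (measurable_indic mZ).
pose h k := cut (v (sg k)).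
pose w t : 'cV[K]_m := \col_i limn (fun k => h k t i 0).
have hw t i : t \in `[a, b] -> h k t i 0 @[k --> \oo] --> w t i 0.
  move=> tI; rewrite mxE.
  have [Zt|Zt] := pselect (Z t).
    rewrite (_ : (fun k => h k t i 0) = fun=> 0); first exact: is_cvg_cst.
    by apply/funext => k; rewrite /h cut0// mxE.
  apply: (@cvg_sq_increments _ _ (fun k => r^-1 * q (dv k) t)).
    move=> k; rewrite /h !cutE//.
    have -> : v (sg k.+1) t i 0 - v (sg k) t i 0 = dv k t i 0 by rewrite dvE !mxE.
    rewrite mulrC ler_pdivlMr// mulrC; apply: le_trans (coercive_ge (Rr t) (dv k t)).
    by rewrite ler_wpM2l ?(ltW r0)// sqr_le_dot.
  rewrite (_ : (fun k => _) = r^-1 *: (fun k => 2 ^+ k * q (dv k) t)).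
    by apply: is_cvg_seriesZ; exact: Zc.
  by apply/funext => k; rewrite mulrCA.
have mw : mx_on (meas_on a b) w.
  move=> i j; rewrite ord1.
  apply: (@measurable_fun_cvg _ _ _ _ (fun k t => h k t i 0)).
    by move=> k; exact: mcut.
  by move=> t tI; exact: hw.
have zc i : cvgn (fun k => (u (sg k)).1 i 0).
  apply: (@cvg_sq_increments _ _ (fun k => 4 ^- k)).
    move=> k; apply: le_trans (ltW (fast k)).
    rewrite /ctl_form; apply: ler_wpDr; first exact: ctl_energy_ge0.
    apply: le_trans (sqr_le_dot _ i).
    by rewrite /= !mxE.
  under [X in series X]eq_fun do rewrite ee -exprVn.
  rewrite (_ : (fun k => _) = geometric 1 2^-1).
    by apply: is_cvg_geometric_series; rewrite ger0_norm ?invr_ge0// invf_lt1// ltr1n.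
  by apply/funext => k; rewrite /= mul1r.
pose z : 'cV[K]_n := \col_i limn (fun k => (u (sg k)).1 i 0).
have zw i : (u (sg k)).1 i 0 @[k --> \oo] --> z i 0 by rewrite mxE; exact: zc.
(* passing to the limit in the second index of the Cauchy estimate *)
have subE p (x y : 'cV[K]_p) l : (x - y) l 0 = x l 0 - y l 0 by rewrite !mxE.
have key i k0 (eps : K) :
    (forall k, (k0 <= k)%N -> ctl_form (u i - u (sg k)) (u i - u (sg k)) < eps) ->
    [/\ dot ((u i).1 - z) ((u i).1 - z) <= eps,
        int_on a b (q (fun t => v i t - w t)) &
        \int[mu]_(t in `[a, b]) q (fun t => v i t - w t) t <= eps].
  move=> close.
  have mvw : meas_on a b (q (fun t => v i t - w t)).
    by have mm := mx_meas_sub (mv i) mw; exact: meas_form.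
  pose f k := q (fun t => cut (v i) t - h k t).
  have mf k : meas_on a b (f k).
    by have mm := mx_meas_sub (mcut _ (mv i)) (mcut _ (mv (sg k))); exact: meas_form.
  have fint k : int_on a b (f k) /\
      \int[mu]_(t in `[a, b]) q ((u i - u (sg k)).2) t = \int[mu]_(t in `[a, b]) f k t.
    apply: (ae_int mZ Z0) => //; last by case: (cuB i (sg k)).
    by move=> t _ Zt; rewrite /f /q /h !cutE.
  have fle k : (k0 <= k)%N -> (\int[mu]_(t in `[a, b]) (f k t)%:E <= eps%:E)%E.
    move=> k0k; have [jf e] := fint k.
    rewrite EFin_Rint// lee_fin -e; apply: le_trans (ltW (close k k0k)).
    by rewrite /ctl_form lerDr dot_ge0.
  have lim_f t : t \in `[a, b] -> (f k t)%:E @[k --> \oo] --> (q (fun t => cut (v i) t - w t) t)%:E.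
    move=> tI; apply: cvg_EFin; first exact: nearW.
    apply: cvg_form => l; rewrite subE.
    rewrite (_ : (fun k => _) = fun k => cut (v i) t l 0 - h k t l 0).
      by apply: cvgB; [exact: cvg_cst | exact: hw].
    by apply/funext => k; rewrite subE.
  have fat : (\int[mu]_(t in `[a, b]) (q (fun t => cut (v i) t - w t) t)%:E <= eps%:E)%E.
    have F := @fatou _ _ _ mu _ (itv_meas a b) (fun k t => (f k t)%:E).
    apply: (@le_trans _ _ (\int[mu]_(t in `[a, b]) limn_einf (fun k => (f k t)%:E))%E).
      rewrite le_eqVlt; apply/orP; left; apply/eqP; apply: eq_integral => t.
      by rewrite inE => tI; rewrite (cvg_limn_einf_sup (lim_f t tI)).1.
    have mfE k : measurable_fun (`[a, b]%classic : set MR) (fun t : MR => (f k t)%:E).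
      by apply/measurable_EFinP; exact: mf.
    have f0E k (t : MR) : `[a, b]%classic t -> (0 <= (f k t)%:E)%E by rewrite lee_fin q_ge0.
    by apply: le_trans (F mfE f0E) _; apply: limn_einf_le; exists k0.
  have mcw : meas_on a b (q (fun t => cut (v i) t - w t)).
    by have mm := mx_meas_sub (mcut _ (mv i)) mw; exact: meas_form.
  have jcw : int_on a b (q (fun t => cut (v i) t - w t)).
    apply/integrableP; split; first exact/measurable_EFinP.
    apply: le_lt_trans (ltry eps); apply: le_trans fat.
    rewrite le_eqVlt; apply/orP; left; apply/eqP; apply: eq_integral => t _ /=.
    by rewrite ger0_norm.
  have off t : t \in `[a, b] -> ~ Z t ->
      q (fun t => cut (v i) t - w t) t = q (fun t => v i t - w t) t.
    by move=> _ Zt; rewrite /q cutE.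
  have [jvw e] := ae_int mZ Z0 off mvw jcw.
  split => //.
    have cz : dot (1%:M *m ((u i).1 - (u (sg k)).1)) ((u i).1 - (u (sg k)).1) @[k --> \oo]
        --> dot (1%:M *m ((u i).1 - z)) ((u i).1 - z).
      apply: cvg_form => l; rewrite subE.
      rewrite (_ : (fun k => _) = fun k => (u i).1 l 0 - (u (sg k)).1 l 0).
        by apply: cvgB; [exact: cvg_cst | exact: zw].
      by apply/funext => k; rewrite subE.
    rewrite -[X in dot X _]mul1mx.
    apply: (cvgr_to_le cz); exists k0 => // k /= k0k; rewrite mul1mx.
    apply: le_trans (ltW (close k k0k)); rewrite /ctl_form lerDl.
    exact: ctl_energy_ge0.
  by rewrite -e -lee_fin -EFin_Rint.
have sgP k0 i : (sg k0 <= i)%N -> forall k, (k0 <= k)%N ->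
    ctl_form (u i - u (sg k)) (u i - u (sg k)) < 4 ^- k0.
  move=> ki k kk; apply: NP; first exact: leq_trans (sgN _) ki.
  exact: leq_trans (sgN k0) (sgm _ _ kk).
have cx : ctl (z, w).
  have [_ jd _] := key _ _ _ (sgP 0%N _ (leqnn _)).
  have cd : ctl ((u (sg 0%N)).1 - z, fun t => v (sg 0%N) t - w t).
    by split => //=; exact: mx_meas_sub (mv _) mw.
  have := ctl_lin (-1) cd (cu (sg 0%N)).
  congr ctl; congr pair => /=; first by rewrite scaleN1r opprB subrK.
  by apply/funext => t /=; rewrite scaleN1r opprB subrK.
exists (z, w) => // eps e0.
have [k0 k0e] : exists k0, 4 ^- k0 * 2 < eps.
  pose k0 := Num.truncn (2 / eps); exists k0.
  rewrite mulrC ltr_pdivrMr ?exprn_gt0// mulrC -ltr_pdivrMr//.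
  apply: lt_le_trans (truncnS_gt _) _.
  by rewrite -/k0 -natrX ler_nat ltn_expl.
exists (sg k0) => i ki; apply: le_lt_trans k0e.
have [hz hj hv] := key _ _ _ (sgP k0 i ki).
by rewrite mulr_natr mulr2n /ctl_form lerD.
Qed.
End ControlSpace.

(** * Measurability of inverses *)

Section Inverses.
Context {K : realType} (a b : K).
Local Notation mu := (@lebesgue_measure K).
Local Notation MR := (measurableTypeR K).

Lemma measurable_inv : measurable_fun [set: K] (fun x : K => x^-1).
Proof.
have o : open [set x : K | x != 0].
  rewrite (_ : [set x : K | x != 0] = ~` [set 0]); first exact: closed_openC.
  by apply/seteqP; split => x /= /eqP.
have -> : [set: K] = [set 0] `|` [set x : K | x != 0].
  by apply/seteqP; split => // x _ /=; have [->|] := eqVneq x 0; [left|right].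
apply/measurable_funU => //; first exact: open_measurable.
split; first exact: measurable_fun_set1.
apply: open_continuous_measurable_fun => // x; rewrite inE /= => x0.
exact: inv_continuous.
Qed.

Lemma meas_sum (I : Type) (s : seq I) (f : I -> K -> K) :
  (forall i, meas_on a b (f i)) -> meas_on a b (fun t => \sum_(i <- s) f i t).
Proof.
by move=> mf; exact: (mx_on_sum (@meas_cst _ a b 0) (@meas_add _ a b)).
Qed.

Lemma meas_prod (I : Type) (s : seq I) (f : I -> K -> K) :
  (forall i, meas_on a b (f i)) -> meas_on a b (fun t => \prod_(i <- s) f i t).
Proof.
move=> mf; elim: s => [|i s IH].
  by apply: meas_ext (@meas_cst _ a b 1) => t _; rewrite big_nil.
by apply: meas_ext (meas_mul (mf i) IH) => t _; rewrite big_cons.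
Qed.

Lemma meas_det p (X : K -> 'M[K]_p) : mx_on (meas_on a b) X ->
  meas_on a b (fun t => \det (X t)).
Proof.
move=> mX; apply: meas_sum => s; apply: meas_mul; first exact: meas_cst.
by apply: meas_prod => i; exact: mX.
Qed.

Lemma meas_invmx p (X : K -> 'M[K]_p) : mx_on (meas_on a b) X ->
  mx_on (meas_on a b) (fun t => invmx (X t)).
Proof.
move=> mX i j.
have md : meas_on a b (fun t => (\det (X t))^-1).
  by apply: measurableT_comp; [exact: measurable_inv | exact: meas_det].
have ma : meas_on a b (fun t => \det (row' j (col' i (X t)))).
  apply: meas_det => k l; apply: meas_ext (mX (lift j k) (lift i l)) => t _.
  by rewrite !mxE.
have mc := meas_mul md (meas_mul (@meas_cst _ a b ((-1) ^+ (j + i))) ma).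
pose f t := if \det (X t) == 0 then X t i j else
  (\det (X t))^-1 * ((-1) ^+ (j + i) * \det (row' j (col' i (X t)))).
apply: (@meas_ext _ _ _ f).
  move=> t _; rewrite /f /invmx unitmxE unitfE; case: eqP => //= _.
  by rewrite !mxE.
apply: (measurable_fun_if (itv_meas a b)).
- by apply: measurable_fun_eqr; [exact: meas_det | exact: meas_cst].
- by apply: measurable_funS (mX i j); [exact: itv_meas|].
- by apply: measurable_funS mc; [exact: itv_meas|].
Qed.

Lemma mx_int_mul p q l k (C : 'M[K]_(p, q)) (f : K -> 'M[K]_(q, l)) (D : 'M[K]_(l, k)) :
  mx_on (int_on a b) f ->
  mx_int `[a, b] (fun t => C *m f t *m D) = C *m mx_int `[a, b] f *m D.
Proof.
move=> jf; apply/matrixP => i j; rewrite !mxE.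
transitivity (\int[mu]_(t in `[a, b]) (\sum_y \sum_x (D y j * C i x) * f t x y)).
  apply: Rint_ext => t _; rewrite mxE; apply: eq_bigr => y _; rewrite mxE mulr_suml.
  by apply: eq_bigr => x _; ring.
rewrite Rint_sum; last by move=> y; apply: int_sum => x; exact: intZ.
apply: eq_bigr => y _; rewrite Rint_sum; last by move=> x; exact: intZ.
rewrite mxE mulr_suml; apply: eq_bigr => x _; rewrite RintZ// mxE.
ring.
Qed.

End Inverses.

(** * The data of the problem *)

Section Kernel.
Context {K : realType} (t0 T : K) (n m d : nat).
Local Notation mu := (@lebesgue_measure K).
Variables (F : K -> 'M[K]_n) (G : K -> 'M[K]_(n, d)) (H : K -> 'M[K]_(m, n)).
Variables (Q : K -> 'M[K]_d) (R : K -> 'M[K]_m) (r : K).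
Variables (Pi0 S : 'M[K]_n) (Pi : K -> 'M[K]_n) (Phi : K -> K -> 'M[K]_n).
Hypotheses (t0T : t0 <= T).
Hypotheses (jF : mx_on (int_on t0 T) F) (sH : mx_on (sq_on t0 T) H).
Hypotheses (mR : mx_on (meas_on t0 T) R) (r0 : 0 < r).
Hypothesis Rr : forall t, psd (R t - r%:M).
Hypotheses (Ssym : S^T = S) (Qpsd : forall t, psd (Q t)).
Hypothesis Pi_riccati : is_riccati_solution t0 T F G H Q R Pi0 Pi.
Hypothesis Phi_transition : is_transition_matrix t0 T F H R Pi Phi.

Local Notation W t := ((H t)^T *m invmx (R t) *m H t).
Local Notation GQG t := (G t *m Q t *m (G t)^T).
Local Notation A t := (F t - Pi t *m (H t)^T *m invmx (R t) *m H t).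

Let t0I : t0 \in `[t0, T]. Proof. by rewrite in_itv /= lexx. Qed.
Let TI : T \in `[t0, T]. Proof. by rewrite in_itv /= t0T lexx. Qed.

Lemma unitR t : R t \in unitmx. Proof. exact: coercive_unit r0 (Rr t). Qed.

Lemma symRi t : (invmx (R t))^T = invmx (R t).
Proof. by rewrite trmx_inv (coercive_sym (Rr t)). Qed.

Lemma bdRi : mx_on (bd_on t0 T) (fun t => invmx (R t)).
Proof.
move=> i j; split; first exact: meas_invmx mR i j.
by exists r^-1 => t _; exact: coercive_invmx_le r0 (Rr t) i j.
Qed.

Lemma sqRiH : mx_on (sq_on t0 T) (fun t => invmx (R t) *m H t).
Proof. exact: mx_bd_sq bdRi sH. Qed.

Lemma intW : mx_on (int_on t0 T) (fun t => W t).
Proof.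
have h := mx_sq_sq (mx_onT sH) sqRiH.
by move=> i j; apply: int_ext (h i j) => t _; rewrite mulmxA.
Qed.

Lemma GQGsym s : (GQG s)^T = GQG s.
Proof. by rewrite !trmx_mul trmxK (psd_sym (Qpsd s)) mulmxA. Qed.

Lemma hPi : has_derivative t0 T Pi (fun t =>
  F t *m Pi t + Pi t *m (F t)^T - Pi t *m W t *m Pi t + GQG t).
Proof.
have [_ _] := Pi_riccati; apply: hd_ext => // t _.
by rewrite !mulmxA.
Qed.

Lemma symPi t : t \in `[t0, T] -> (Pi t)^T = Pi t.
Proof. by have [h _ _] := Pi_riccati => /h[]. Qed.

Lemma bdPi : mx_on (bd_on t0 T) Pi. Proof. exact: hd_bd hPi. Qed.

Lemma intPiW : mx_on (int_on t0 T) (fun t => Pi t *m (H t)^T *m invmx (R t) *m H t).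
Proof.
have h := mx_bd_int bdPi intW.
by move=> i j; apply: int_ext (h i j) => t _; rewrite !mulmxA.
Qed.

Lemma intA : mx_on (int_on t0 T) (fun t => A t).
Proof.
move=> i j; apply: int_ext (intD (jF i j) (intN (intPiW i j))) => t _.
by rewrite !mxE.
Qed.

(** The product of two square integrable factors and an integrable one need not
    be integrable. Integrability is read off the Riccati equation, all of whose
    other terms are integrable. *)
Lemma intGQG : mx_on (int_on t0 T) (fun t => GQG t).
Proof.
have h1 := mx_int_bd jF bdPi; have h2 := mx_bd_int bdPi (mx_onT jF).
have h3 := mx_int_bd (mx_bd_int bdPi intW) bdPi; have h4 := hd_int hPi.
move=> i j.
have := intD (intD (h4 i j) (h3 i j)) (intN (intD (h1 i j) (h2 i j))).
apply: int_ext => t _; rewrite !mxE.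
by set x1 := \sum_(j0 < n) _; set x2 := \sum_(j0 < n) _; ring.
Qed.

Lemma Phi1 t : t \in `[t0, T] -> Phi t t = 1%:M.
Proof. by move=> /Phi_transition[]. Qed.

Lemma hPhi t : t \in `[t0, T] ->
  has_derivative t0 T (Phi ^~ t) (fun tau => A tau *m Phi tau t).
Proof. by move=> /Phi_transition[]. Qed.

Let X s := Phi s t0.
Let Y s := Phi t0 s.
Let M := invmx (1%:M + S *m Pi T *m S).

Lemma PhiE s u : s \in `[t0, T] -> u \in `[t0, T] -> Phi s u = X s *m Y u.
Proof.
by move=> sI uI; rewrite (transition_comp t0T intA Phi1 hPhi).
Qed.

Let XY s : s \in `[t0, T] -> X s *m Y s = 1%:M.
Proof. by move=> sI; rewrite -PhiE// Phi1. Qed.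

Lemma bdX : mx_on (bd_on t0 T) X. Proof. exact: hd_bd (hPhi t0I). Qed.

Lemma intXWX : mx_on (int_on t0 T) (fun s => (X s)^T *m W s *m X s).
Proof. exact: mx_int_bd (mx_bd_int (mx_onT bdX) intW) bdX. Qed.

(* the kernel without its outer transition matrices:
   Lam(s, t) = (Y s)^T (Kt (max s t)) (Y t) *)
Let Kt u := (X T)^T *m S *m M *m S *m X T +
  mx_int `[u, T] (fun s => (X s)^T *m W s *m X s).

Lemma hKt : has_derivative t0 T Kt (fun s => - ((X s)^T *m W s *m X s)).
Proof.
have h := hdD t0T (hd_cst t0T (Kt t0)) (hdN t0T (hd_indef t0T intXWX)).
apply: hd_ext h => // s sI; last by rewrite add0r.
rewrite /Kt -addrA; congr (_ + _); apply/matrixP => i j; rewrite !mxE.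
have /andP[s0 sT] : (t0 <= s) && (s <= T) by rewrite in_itv /= in sI.
by rewrite (Rint_split s0 sT (intXWX i j)) addrC addKr.
Qed.

Lemma bd_diagonal : mx_on (bd_on t0 T) (fun s => (Y s)^T *m Kt s *m Y s).
Proof.
have bY : mx_on (bd_on t0 T) Y := hd_bd t0T (hd_adjoint t0T intA Phi1 hPhi).
exact: mx_bd_bd (mx_bd_bd (mx_onT bY) (hd_bd t0T hKt)) bY.
Qed.

(** * Sections of the kernel *)

Section OneSection.
Variables (t : K) (tI : t \in `[t0, T]) (p : 'cV[K]_n).

Let psi s := Phi s t *m p.

Definition section_fun (s : K) : 'cV[K]_n :=
  ((Phi T s)^T *m S *m M *m S *m Phi T t
   + mx_int `[Num.max s t, T] (fun tau =>
       (Phi tau s)^T *m (H tau)^T *m invmx (R tau) *m H tau *m Phi tau t)) *m p.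

Let y s := ind t s *: psi s - Pi s *m section_fun s.

Definition section_control : 'cV[K]_n * (K -> 'cV[K]_m) :=
  (M *m S *m psi T, fun s => invmx (R s) *m (H s *m y s)).

(** Separating the two time variables of the kernel. *)
Lemma section_factor s : s \in `[t0, T] ->
  section_fun s = (Y s)^T *m Kt (Num.max s t) *m (Y t *m p).
Proof.
move=> sI; rewrite /section_fun [RHS]mulmxA; congr (_ *m p).
rewrite !(PhiE TI)// trmx_mul /Kt mulmxDr mulmxDl; congr (_ + _).
  by rewrite !mulmxA.
have mI : t0 <= Num.max s t.
  by move: sI; rewrite in_itv /= le_max => /andP[->].
rewrite -mx_int_mul; last by move=> i j; exact: int_sub (intXWX i j).
apply/matrixP => i j; rewrite !mxE; apply: Rint_ext => u uI.
have uI' : u \in `[t0, T].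
  by rewrite !in_itv /= in uI *; case/andP: uI => h1 h2; rewrite (le_trans mI h1).
by rewrite (PhiE uI' sI) (PhiE uI' tI) trmx_mul !mulmxA.
Qed.

Lemma section_equation : has_derivative t0 T section_fun (fun s =>
  - ((F s)^T *m section_fun s + (H s)^T *m section_control.2 s)).
Proof.
have hY := hdT t0T (hd_adjoint t0T intA Phi1 hPhi).
have h := hdM t0T (hdM t0T hY (hd_max t0T tI hKt)) (hd_cst t0T (Y t *m p)).
apply: hd_ext h => // s sI; first by rewrite section_factor.
have sF := section_factor sI.
have sW : (Y s)^T *m ((X s)^T *m W s *m X s) *m (Y t *m p) = W s *m psi s.
  rewrite !mulmxA -(trmx_mul (X s)) XY// trmx1 mul1mx -!mulmxA; do 3 congr (_ *m _).
  by rewrite /psi (PhiE sI tI) mulmxA.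
have AT : (A s)^T = (F s)^T - W s *m Pi s.
  rewrite linearB /=; congr (_ - _).
  by rewrite !trmx_mul trmxK symRi symPi// !mulmxA.
transitivity (- ((A s)^T *m section_fun s) - ind t s *: (W s *m psi s)).
  rewrite -sW sF mulmx0 addr0 linearN /= trmx_mul mulmxDl !mulNmx !mulmxA.
  by congr (_ + _); rewrite scalerN mulmxN -scalemxAr !mulNmx -!scalemxAl !mulmxA.
rewrite AT mulmxBl /section_control /= /y !mulmxA mulmxBr -scalemxAr !mulmxA.
by rewrite opprB opprD opprB addrA [- _ + _]addrC.
Qed.

Lemma section_terminal : section_fun T = S *m section_control.1.
Proof.
have tT : t <= T by move: tI; rewrite in_itv /= => /andP[].
rewrite /section_fun (max_idPl tT) (_ : mx_int _ _ = 0).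
  by rewrite addr0 Phi1// trmx1 mul1mx /section_control /= /psi !mulmxA.
by apply/matrixP => i j; rewrite !mxE set_itv1 Rintegral_set1.
Qed.

Lemma bd_section : mx_on (bd_on t0 T) section_fun.
Proof. exact: hd_bd section_equation. Qed.

Lemma hpsi : has_derivative t0 T psi (fun s => A s *m psi s).
Proof.
have := hdM t0T (hPhi tI) (hd_cst t0T p).
by apply: hd_ext => // s _; rewrite mulmx0 addr0 mulmxA.
Qed.

Lemma bd_y : mx_on (bd_on t0 T) y.
Proof.
move=> i j.
have h1 := mx_onZ (@bdM _ t0 T) (bd_ind t0 T t) (hd_bd t0T hpsi) i j.
have h2 := bdM (bd_cst t0 T (-1)) (mx_bd_bd bdPi bd_section i j).
rewrite (_ : (fun s => y s i j) = fun s =>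
   (ind t s *: psi s) i j + -1 * (Pi s *m section_fun s) i j); first exact: bdD.
by apply/funext => s; rewrite /y mxE [X in _ + X]mxE mulN1r.
Qed.

Lemma section_sq : mx_on (sq_on t0 T) section_control.2.
Proof. exact: mx_bd_sq bdRi (mx_sq_bd sH bd_y). Qed.

Lemma R_section s : R s *m section_control.2 s = H s *m y s.
Proof. by rewrite /section_control /= mulKVmx// unitR. Qed.

Lemma section_ctl : ctl t0 T R section_control.
Proof.
split; first by move=> i j; case: (section_sq i j).
have h : int_on t0 T (fun s => dot (H s *m y s) (section_control.2 s)).
  exact: on_dot (int0 _ _) (@intD _ t0 T) (@sqM _ t0 T) (mx_sq_bd sH bd_y) section_sq.
by apply: int_ext h => s _; rewrite R_section.
Qed.

(** The energy product of any control of [f] with the control of the section is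
    a boundary term: the Riccati equation makes [<f, Pi lam>] absorb everything
    but the running cost, and [<f, psi>] produces the value of [f] at [t]. It
    depends on the control of [f] through [f] only; for [f = 0] this says that
    the section's control is orthogonal to all controls without effect. *)
Lemma section_form (f : K -> 'cV[K]_n) zv : ctl t0 T R zv ->
  has_derivative t0 T f (fun s => - ((F s)^T *m f s + (H s)^T *m zv.2 s)) ->
  f T = S *m zv.1 ->
  ctl_form t0 T R zv section_control = dot p (f t)
    - dot (Pi0 *m f t0) (section_fun t0)
    - \int[mu]_(s in `[t0, T]) dot (GQG s *m f s) (section_fun s).
Proof.
move=> czv hf fT; set k := section_fun; pose g s := (F s)^T *m f s + (H s)^T *m zv.2 s.
have hk : has_derivative t0 T k (fun s => - ((F s)^T *m k s + (H s)^T *m section_control.2 s)).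
  exact: section_equation.
have p1 := hd_dot t0T hf hpsi.
have p2 := hd_dot t0T hf (hdM t0T hPi hk).
have p1t := prim_max tI p1.
(* c1 and c2 are the derivatives of <f, psi> and <f, Pi lam> *)
set c1 := (fun s => dot (- _) (psi s) + _) in p1 p1t.
set c2 := (fun s => dot (- _) (Pi s *m k s) + _) in p2.
have jG : int_on t0 T (fun s => dot (GQG s *m f s) (k s)).
  apply: on_dot (int0 _ _) (@intD _ t0 T) (@int_bdM _ t0 T) _ bd_section.
  exact: mx_int_bd intGQG (hd_bd t0T hf).
have pt s : s \in `[t0, T] -> dot (R s *m zv.2 s) (section_control.2 s) =
    c2 s - ind t s * c1 s - dot (GQG s *m f s) (k s).
  move=> sI; rewrite dot_mulmx (coercive_sym (Rr s)) R_section -[H s]trmxK -dot_mulmx.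
  have -> : (H s)^T *m zv.2 s = g s - (F s)^T *m f s by rewrite /g addrC addKr.
  have Apsi : A s *m psi s = F s *m psi s - Pi s *m (W s *m psi s).
    by rewrite mulmxBl !mulmxA.
  have HtV : (H s)^T *m section_control.2 s = ind t s *: (W s *m psi s) - W s *m (Pi s *m k s).
    by rewrite /section_control /= /y !mulmxA mulmxBr -scalemxAr !mulmxA.
  have ab (v1 v2 v3 v4 v5 : 'cV[K]_n) :
      v1 + v2 - v3 + v4 - (v2 + (v5 - v3)) = v1 + v4 - v5.
    by apply/matrixP => i j; rewrite !mxE; ring.
  have Pik : (F s *m Pi s + Pi s *m (F s)^T - Pi s *m W s *m Pi s + GQG s) *m k s +
      Pi s *m - ((F s)^T *m k s + (H s)^T *m section_control.2 s) =
      F s *m (Pi s *m k s) + GQG s *m k s - ind t s *: (Pi s *m (W s *m psi s)).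
    rewrite HtV !mulmxDl mulNmx mulmxN !mulmxDr mulmxN -scalemxAr !mulmxA.
    exact: ab.
  rewrite /c1 /c2 Pik Apsi (dot_mulmx (GQG s)) GQGsym.
  rewrite !(dotDl, dotDr, dotNl, dotNr, dotZl, dotZr) !(dot_mulmx (F s)^T) trmxK.
  by rewrite -/k; ring.
have jc2 : int_on t0 T c2 by case: p2.
have jc1 : int_on t0 T (fun s => ind t s * c1 s) by case: p1t.
have [_ /(_ T TI) E1] := p1t; have [_ /(_ T TI) E2] := p2.
have [at_ tT] : t0 <= t /\ t <= T by move: tI; rewrite in_itv /= => /andP[].
rewrite (max_idPl tT) (max_idPr at_) in E1.
rewrite /ctl_form (Rint_ext pt) RintB//; last exact: intD jc2 (intN jc1).
rewrite RintB//.
have [psdPi PiE _] := Pi_riccati.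
have psit : psi t = p by rewrite /psi Phi1// mul1mx.
have boundary : dot zv.1 section_control.1 + dot (f T) (Pi T *m k T)
    - dot (f T) (psi T) = 0.
  have uM := unitmx_1SPS Ssym (psdPi T TI).
  rewrite fT /k section_terminal !dot_mulmx Ssym -dotDr -dotBr.
  have zE : (1%:M + S *m Pi T *m S) *m section_control.1 = S *m psi T.
    by rewrite /section_control /= -(mulmxA M) /M mulKVmx.
  by rewrite -zE mulmxDl mul1mx !mulmxA subrr dot0r.
have initial : dot (f t0) (Pi t0 *m k t0) = dot (Pi0 *m f t0) (k t0).
  by rewrite [RHS]dot_mulmx -PiE (psd_sym (psdPi t0 t0I)).
rewrite psit in E1; rewrite initial in E2.
have I1 : \int[mu]_(s in `[t0, T]) (ind t s * c1 s) =
    dot (f T) (psi T) - dot (f t) p by rewrite E1 addrC addKr.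
have I2 : \int[mu]_(s in `[t0, T]) c2 s =
    dot (f T) (Pi T *m k T) - dot (Pi0 *m f t0) (k t0) by rewrite E2 addrC addKr.
have zE : dot zv.1 section_control.1 = dot (f T) (psi T) - dot (f T) (Pi T *m k T).
  by apply/eqP; rewrite eq_sym subr_eq -subr_eq0 -oppr_eq0 opprB boundary.
by rewrite I1 I2 zE (dotC p); ring.
Qed.
Lemma section_diagonal : section_fun t = (Y t)^T *m Kt t *m Y t *m p.
Proof. by rewrite section_factor// maxxx !mulmxA. Qed.

End OneSection.

Lemma section_diagonal_bound : exists C, forall t i, t \in `[t0, T] ->
  `|section_fun t (delta_mx i 0) t i 0| <= C.
Proof.
pose N s := nrm1 ((Y s)^T *m Kt s *m Y s).
have [_ [C NC]] : bd_on t0 T N.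
  apply: (mx_on_sum (bd_cst t0 T 0) (@bdD _ t0 T)) => i.
  apply: (mx_on_sum (bd_cst t0 T 0) (@bdD _ t0 T)) => j.
  have [mb [C bC]] := bd_diagonal i j; split; first exact: measurableT_comp.
  by exists C => s sI; rewrite normr_id bC.
exists C => t i tI; apply: le_trans (NC t tI); rewrite section_diagonal//.
rewrite -colE mxE; apply: le_trans (nrm1_ge _ i i) _.
exact: ler_norm.
Qed.

(** * Representatives *)

Local Notation I := (set_type (`[t0, T] : set K)).
Local Notation ctlT := ('cV[K]_n * (K -> 'cV[K]_m))%type.
Local Notation Ctl := (@ctl K t0 T n m R).
Local Notation form := (@ctl_form K t0 T n m R).
Local Notation adm := (@admissible K t0 T n m F H S).
Local Notation Slam := (S_lambda t0 T F H R S).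
Local Notation rep := (@is_representative K t0 T n m F H R S).

Lemma extE (lam : I -> 'cV[K]_n) (s : I) : ext lam (set_val s) = lam s.
Proof. exact: (congr1 (fun f => f s) (valLK 0 lam)). Qed.

Lemma I_lift (u : K) : u \in `[t0, T] -> exists s : I, set_val s = u.
Proof. by move=> uI; exists (SigSub (mem_set uI : u \in `[t0, T]%classic)). Qed.

Lemma I_in (s : I) : set_val s \in `[t0, T].
Proof. by have := set_valP s. Qed.

Lemma ext_lin c (f g : I -> 'cV[K]_n) u : u \in `[t0, T] ->
  ext (c *: f + g) u = c *: ext f u + ext g u.
Proof. by move=> /I_lift[s <-]; rewrite !extE. Qed.

Lemma ext0 u : u \in `[t0, T] -> ext (0 : I -> 'cV[K]_n) u = 0.
Proof. by move=> /I_lift[s <-]; rewrite extE. Qed.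

Lemma semi_hilbert_ctl : semi_hilbert Ctl form.
Proof.
split.
- exact: ctl_zero.
- by move=> c x y; exact: (ctl_lin mR r0 Rr).
- by move=> x y _ _; exact: (@ctl_form_sym K t0 T n m R r Rr).
- by move=> c x y z; exact: (ctl_form_lin mR r0 Rr).
- by move=> x _; exact: (@ctl_form_ge0 K t0 T n m R r r0 Rr).
- exact: (ctl_complete mR r0 Rr).
Qed.

Let HS := semi_hilbert_ctl.

Lemma cost_ctl zv : Ctl zv -> cost t0 T R zv = (form zv zv)%:E.
Proof.
move=> [_ j]; rewrite /cost (EFin_Rint j) -EFinD /ctl_form; congr (_%:E).
by rewrite addrC.
Qed.

(** The integrand of the cost is nonnegative, so that a finite integral means
    integrability. *)
Lemma cost_lty zv : mx_on (meas_on t0 T) zv.2 -> (cost t0 T R zv < +oo)%E ->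
  Ctl zv.
Proof.
move=> mv fin; split => //; apply/integrableP; split.
  by apply/measurable_EFinP; exact: (meas_form mR mv mv).
move: fin; rewrite /cost; set J := (integral _ _ _); set J' := (integral _ _ _).
have -> : J' = J.
  apply: eq_integral => t _ /=; rewrite ger0_norm//.
  exact: (coercive_ge0 r0 (Rr t)).
have J0 : (0 <= J)%E.
  by apply: integral_ge0 => t _; rewrite lee_fin; exact: (coercive_ge0 r0 (Rr t)).
by case: J J0 => [x||]//= _ _; rewrite ltry.
Qed.

Lemma adm_meas lam zv : adm lam zv -> mx_on (meas_on t0 T) zv.2.
Proof. by move=> [/mx_Lp2P h _ _] i j; case: (h i j). Qed.

Lemma SlamP lam : Slam lam <-> exists zv, adm lam zv /\ Ctl zv.
Proof.
split=> -[zv [av h]]; exists zv; split => //.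
  by apply: cost_lty h; exact: adm_meas av.
by rewrite (cost_ctl h) ltry.
Qed.

Lemma adm_lin c f g x y : adm f x -> adm g y -> adm (c *: f + g) (c *: x + y).
Proof.
move=> [/mx_Lp2P sx hf fT] [/mx_Lp2P sy hg gT]; split.
- apply/mx_Lp2P => i j.
  have h := sqD (bd_sqM (bd_cst t0 T c) (sx i j)) (sy i j).
  rewrite (_ : (fun t => _) = fun t => c * x.2 t i j + y.2 t i j)//.
  by apply/funext => t; rewrite /= !mxE.
- have h := hdD t0T (hdZ t0T c hf) hg.
  apply: hd_ext h => // u uI; first by rewrite ext_lin.
  rewrite (ext_lin c f g uI) /= scalerN -opprD scalerDr.
  rewrite !mulmxDr -!scalemxAr addrACA//.
- by rewrite ext_lin// fT gT /= mulmxDr -scalemxAr.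
Qed.

Lemma adm_sub f x y : adm f x -> adm f y -> adm 0 (x - y).
Proof.
move=> ax ay; have := adm_lin (-1) ay ax.
by rewrite !scaleN1r addNr addrC.
Qed.

Lemma adm_shift f x c w : adm f x -> adm 0 w -> adm f (x + c *: w).
Proof. by move=> ax aw; have := adm_lin c aw ax; rewrite scaler0 add0r addrC. Qed.

Lemma adm0 : adm 0 0.
Proof.
split.
- apply/mx_Lp2P => i j; rewrite (_ : (fun t => _) = fun=> 0).
    exact: bd_sq (bd_cst t0 T 0).
  by apply/funext => t; rewrite mxE.
- apply: hd_ext (hd_cst t0T 0) => // u uI; first by rewrite ext0.
  by rewrite (ext0 uI) /= !mulmx0 addr0 oppr0.
- by rewrite ext0// mulmx0.
Qed.

(** The first-order condition for the minimisation that defines the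
    representative. *)
Lemma repP f zv : Slam f -> rep f zv <->
  [/\ adm f zv, Ctl zv & forall w, adm 0 w -> Ctl w -> form zv w = 0].
Proof.
move=> /SlamP[zv0 [a0 c0]]; split.
  move=> [av min].
  have cv : Ctl zv.
    apply: cost_lty; first exact: adm_meas av.
    by apply: le_lt_trans (min _ a0) _; rewrite (cost_ctl c0) ltry.
  split => // w aw cw; apply: (minimal_orthogonal HS cv cw) => s.
  have cs : Ctl (zv + s *: w) by apply: (shD HS) => //; exact: (shZ HS).
  by have := min _ (adm_shift s av aw); rewrite !cost_ctl// lee_fin.
move=> [av cv orth]; split => // zv' av'.
have [fin|] := boolP (cost t0 T R zv' < +oo)%E; last first.
  by rewrite -leNgt leye_eq => /eqP ->; exact: leey.
have cv' := cost_lty (adm_meas av') fin.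
have cd := shB HS cv' cv.
have e : zv' = zv + (zv' - zv) by rewrite addrC subrK.
rewrite !cost_ctl// lee_fin {1 2}e (form_sqrD HS)//.
by rewrite (orth _ (adm_sub av' av) cd) mulr0 addr0 lerDl (sh_ge0 HS).
Qed.

Lemma form_eq0 w : Ctl w -> form w w = 0 -> w.1 = 0 /\
  {ae mu, forall t, t \in `[t0, T] -> w.2 t = 0}.
Proof.
move=> cw; have [mw jw] := cw; rewrite /ctl_form => e.
have e0 := @ctl_energy_ge0 K t0 T n m R r r0 Rr w.
have d0 := dot_ge0 w.1.
split; first by apply: dot_eq0; lra.
have J0 : \int[mu]_(t in `[t0, T]) dot (R t *m w.2 t) (w.2 t) = 0 by lra.
have /(ae_eq_integral_abs mu (itv_meas t0 T))[+ _] :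
    measurable_fun (`[t0, T]%classic : set (measurableTypeR K))
    (EFin \o (fun t => dot (R t *m w.2 t) (w.2 t))).
  by apply/measurable_EFinP; exact: (meas_form mR mw mw).
have : (\int[mu]_(t in `[t0, T]) `|(EFin \o (fun t => dot (R t *m w.2 t) (w.2 t))) t| = 0)%E.
  transitivity ((\int[mu]_(t in `[t0, T]) dot (R t *m w.2 t) (w.2 t))%:E).
    rewrite -(EFin_Rint jw); apply: eq_integral => t _ /=.
    by rewrite ger0_norm// (coercive_ge0 r0 (Rr t)).
  by rewrite J0.
move=> z /(_ z) [N [mN N0 hN]]; exists N; split => //.
move=> t; apply: contra_notP => Nt tI; apply: dot_eq0.
have [//|] := pselect (dot (R t *m w.2 t) (w.2 t) = 0).
  move=> q0; have := coercive_ge (Rr t) (w.2 t); rewrite q0 pmulr_rle0//.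
move=> q0; exfalso; apply: Nt; apply: hN => /= /(_ tI) [].
exact: q0.
Qed.

(* the contribution of a control to the trajectory up to time u *)
Let effect u (zv : ctlT) := mx_int `[t0, u] (fun s => (H s)^T *m zv.2 s).

Lemma form_ge0 w : 0 <= form w w.
Proof. exact: (@ctl_form_ge0 K t0 T n m R r r0 Rr). Qed.

Lemma energy_le w : \int[mu]_(t in `[t0, T]) dot (R t *m w.2 t) (w.2 t) <= form w w.
Proof. by rewrite /ctl_form lerDr dot_ge0. Qed.

(** Young's inequality with weight [eps] makes the estimate linear in [eps]. *)
Lemma effect_bound : exists C, forall u i w eps, u \in `[t0, T] -> Ctl w ->
  0 < eps -> form w w < eps ^+ 2 -> `|effect u w i 0| <= C * eps.
Proof.
pose h (i : 'I_n) s : 'cV[K]_m := H s *m delta_mx i 0.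
have jh i : int_on t0 T (fun s => dot (h i s) (h i s)).
  apply: on_dot (int0 _ _) (@intD _ t0 T) (@sqM _ t0 T) _ _;
    by apply: mx_sq_bd sH _ => j k; exact: bd_cst.
pose c i := \int[mu]_(s in `[t0, T]) dot (h i s) (h i s).
have c0 i : 0 <= c i by apply: Rintegral_ge0 => s _; exact: dot_ge0.
exists (\sum_i c i + r^-1) => u i w eps uI cw e0 we.
have /andP[t0u uT] : (t0 <= u) && (u <= T) by move: uI; rewrite in_itv.
have [mw jw] := cw; have sw := ctl_sq r0 Rr cw.
pose g s := eps * dot (h i s) (h i s) + eps^-1 * (r^-1 * dot (R s *m w.2 s) (w.2 s)).
have jg : int_on t0 T g by apply: intD; apply: intZ => //; exact: intZ.
have g0 s : 0 <= g s.
  rewrite addr_ge0 ?mulr_ge0 ?dot_ge0 ?invr_ge0 ?(ltW r0) ?(ltW e0)//.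
  exact: (coercive_ge0 r0 (Rr s)).
have le_g s : `|((H s)^T *m w.2 s) i 0| <= g s.
  rewrite -dot_delta dotC dot_mulmx trmxK; apply: le_trans (dot_young _ _ e0) _.
  rewrite lerD2l ler_wpM2l ?invr_ge0 ?(ltW e0)// mulrC ler_pdivlMr// mulrC.
  exact: (coercive_ge (Rr s)).
have jHw : mx_on (int_on t0 T) (fun s => (H s)^T *m w.2 s).
  exact: mx_sq_sq (mx_onT sH) sw.
have S1 f : int_on t0 T f -> int_on t0 u f by exact: int_sub.
rewrite /effect mxE; apply: le_trans (Rint_norm _ (S1 _ jg) _) _.
- exact: (int_meas (S1 _ (jHw i 0))).
- by move=> s _; exact: le_g.
apply: (@le_trans _ _ (\int[mu]_(s in `[t0, T]) g s)).
  rewrite (Rint_split t0u uT jg) lerDl; exact: Rintegral_ge0.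
rewrite RintD ?RintZ//; try by do ?apply: intZ.
rewrite -/(c i) mulrDl mulrC; apply: lerD.
  rewrite ler_wpM2r ?(ltW e0)// (bigD1 i)//= lerDl; exact: sumr_ge0.
rewrite mulrCA ler_wpM2l ?invr_ge0 ?(ltW r0)// mulrC ler_pdivrMr// -expr2.
exact: le_trans (energy_le w) (ltW we).
Qed.

Lemma effect_sub u x y : u \in `[t0, T] -> Ctl x -> Ctl y ->
  effect u (x - y) = effect u x - effect u y.
Proof.
move=> uI cx cy; apply/matrixP => i j; rewrite ord1 !mxE.
have /andP[t0u uT] : (t0 <= u) && (u <= T) by move: uI; rewrite in_itv.
have S1 w : Ctl w -> int_on t0 u (fun s => ((H s)^T *m w.2 s) i 0).
  move=> cw; apply: int_sub (lexx _) uT _.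
  exact: (mx_sq_sq (mx_onT sH) (ctl_sq r0 Rr cw) i 0).
rewrite -RintB; try exact: S1.
by apply: Rint_ext => s _; rewrite /= mulmxBr !mxE.
Qed.

Lemma terminal_bound : exists C, forall i w eps,
  0 < eps -> form w w < eps ^+ 2 -> `|(S *m w.1) i 0| <= C * eps.
Proof.
exists (nrm1 S) => i w eps e0 we; rewrite mxE.
have wj j : `|w.1 j 0| <= eps.
  rewrite -(@ler_pXn2r _ 2) ?nnegrE ?normr_ge0 ?(ltW e0)//.
  rewrite real_normK ?num_real//; apply: le_trans (ltW we).
  apply: le_trans (sqr_le_dot _ j) _.
  by rewrite /ctl_form lerDl (@ctl_energy_ge0 K t0 T n m R r r0 Rr).
apply: le_trans (ler_norm_sum _ _ _) _; rewrite /nrm1 mulr_suml.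
rewrite [leRHS](bigD1 i)//= mulr_suml ler_wpDr//.
  by apply: sumr_ge0 => k _; rewrite mulr_ge0 ?(ltW e0)//; exact: sumr_ge0.
by apply: ler_sum => j _; rewrite normrM ler_wpM2l.
Qed.

Lemma adm_bd f x : adm f x -> mx_on (bd_on t0 T) (ext f).
Proof. by case=> _ /(hd_bd t0T). Qed.

(** The equation in integrated form, with the control isolated: both sides then
    pass to the limit by [effect_bound] and uniform convergence. *)
Lemma admP f x : mx_on (bd_on t0 T) (ext f) -> Ctl x -> adm f x <->
  S *m x.1 = ext f T /\ forall u, u \in `[t0, T] ->
  effect u x = ext f t0 - ext f u - mx_int `[t0, u] (fun s => (F s)^T *m ext f s).
Proof.
move=> bf cx; have sx := ctl_sq r0 Rr cx.
have jFf : mx_on (int_on t0 T) (fun s => (F s)^T *m ext f s).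
  exact: mx_int_bd (mx_onT jF) bf.
have jHx : mx_on (int_on t0 T) (fun s => (H s)^T *m x.2 s).
  exact: mx_sq_sq (mx_onT sH) sx.
have split_int u : u \in `[t0, T] ->
    mx_int `[t0, u] (fun s => - ((F s)^T *m ext f s + (H s)^T *m x.2 s)) =
    - (mx_int `[t0, u] (fun s => (F s)^T *m ext f s) + effect u x).
  move=> uI; have /andP[t0u uT] : (t0 <= u) && (u <= T) by move: uI; rewrite in_itv.
  have S1 g : int_on t0 T g -> int_on t0 u g by exact: int_sub.
  apply/matrixP => i j; rewrite !mxE -RintD; try exact: S1.
  rewrite -RintN; last by apply: intD; exact: S1.
  by apply: Rint_ext => s _; rewrite !mxE.
split=> [[_ [_ fE] fT]|[fT fE]].
  split => // u uI; rewrite (fE u uI) split_int//.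
  by apply/matrixP => i j; rewrite !mxE; ring.
split; [exact/mx_Lp2P | split | by []].
  apply/mx_Lp1P => i j; apply: int_ext (intN (intD (jFf i j) (jHx i j))) => s _.
  by rewrite [RHS]mxE [in RHS]mxE.
move=> u uI; rewrite split_int// (fE u uI).
by apply/matrixP => i j; rewrite !mxE; ring.
Qed.

(** Each relation of [admP] is an equation between quantities that are controlled
    by the energy of the control and by the supremum of the trajectory, so that
    its defect at the limit is at most a constant times [eps]. *)
Lemma adm_limit (g : nat -> I -> 'cV[K]_n) (zv : nat -> ctlT) f x :
  (forall k, adm (g k) (zv k)) -> (forall k, Ctl (zv k)) -> Ctl x ->
  mx_on (bd_on t0 T) (ext f) ->
  (forall eps, 0 < eps -> exists k, form (zv k - x) (zv k - x) < eps ^+ 2 /\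
     forall u i, u \in `[t0, T] -> `|ext (g k) u i 0 - ext f u i 0| <= eps) ->
  adm f x.
Proof.
move=> ag cz cx bf lim; apply/(admP bf cx).
have [Ct tb] := terminal_bound; have [Ce eb] := effect_bound.
have cd k : Ctl (zv k - x) by exact: (shB HS).
have subE (v w : 'cV[K]_n) i : (v - w) i 0 = v i 0 - w i 0 by rewrite !mxE.
split.
  apply/matrixP => i j; rewrite ord1; apply/eqP; rewrite -subr_eq0; apply/eqP.
  apply: (@vanish _ (Ct + 1)) => eps e0; have [k [zk gk]] := lim eps e0.
  have [+ _] := (admP (adm_bd (ag k)) (cz k)).1 (ag k).
  move=> /matrixP/(_ i 0) e.
  have -> : (S *m x.1) i 0 - ext f T i 0 =
      (ext (g k) T i 0 - ext f T i 0) - (S *m (zv k - x).1) i 0.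
    by rewrite -e /= mulmxBr subE; ring.
  apply: le_trans (ler_normB _ _) _.
  by rewrite mulrDl mul1r addrC lerD ?gk// tb.
move=> u uI; apply/matrixP => i j; rewrite ord1; apply/eqP; rewrite -subr_eq0; apply/eqP.
pose cF := \int[mu]_(s in `[t0, T]) nrm1 (F s)^T.
have jN : int_on t0 T (fun s => nrm1 (F s)^T) by apply: int_nrm1; exact: mx_onT.
have /andP[t0u uT] : (t0 <= u) && (u <= T) by move: uI; rewrite in_itv.
apply: (@vanish _ (Ce + 2 + cF)) => eps e0; have [k [zk gk]] := lim eps e0.
have [_ /(_ u uI)/matrixP/(_ i 0)] := (admP (adm_bd (ag k)) (cz k)).1 (ag k).
rewrite !mxE => e.
have := effect_sub uI (cz k) cx => /matrixP/(_ i 0); rewrite !mxE => e2.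
have jFi (w : I -> 'cV[K]_n) : mx_on (bd_on t0 T) (ext w) ->
    int_on t0 u (fun s => ((F s)^T *m ext w s) i 0).
  move=> bw; apply: int_sub (lexx _) uT _.
  exact: (mx_int_bd (mx_onT jF) bw i 0).
have e3 := RintB (jFi _ (adm_bd (ag k))) (jFi _ bf).
pose dI := \int[mu]_(s in `[t0, u]) (((F s)^T *m ext (g k) s) i 0 - ((F s)^T *m ext f s) i 0).
have bI : `|dI| <= cF * eps.
  apply: (@le_trans _ _ (\int[mu]_(s in `[t0, u]) (eps * nrm1 (F s)^T))).
    apply: Rint_norm.
    - exact: (int_meas (intD (jFi _ (adm_bd (ag k))) (intN (jFi _ bf)))).
    - by apply: intZ; exact: int_sub jN.
    move=> s sI; have sI' : s \in `[t0, T].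
      by move: sI; rewrite !in_itv /= => /andP[-> /le_trans]; apply.
    rewrite !mxE -sumrB; apply: le_trans (ler_norm_sum _ _ _) _.
    rewrite mulrC /nrm1 mulr_suml [leRHS](bigD1 i)//= ler_wpDr//.
      by apply: sumr_ge0 => l _; rewrite mulr_ge0 ?(ltW e0)//; exact: sumr_ge0.
    rewrite mulr_suml; apply: ler_sum => l _; rewrite -mulrBr normrM ler_wpM2l//.
    exact: gk.
  rewrite RintZ; last exact: int_sub jN.
  rewrite mulrC ler_wpM2r ?(ltW e0)// /cF (Rint_split t0u uT jN) lerDl.
  by apply: Rintegral_ge0 => s _; exact: nrm1_ge0.
have eb1 := eb u i _ eps uI (cd k) e0 zk; rewrite /effect mxE in eb1.
have g1 := gk t0 i t0I; have g2 := gk u i uI.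
set E1 := \int[mu]_(_ in _) ((_ *m (zv k - x).2 _) _ _) in eb1 e2.
move: e e2 e3; rewrite -/dI.
set E2 := \int[mu]_(_ in _) ((_ *m (zv k).2 _) _ _).
set E3 := \int[mu]_(_ in _) ((_ *m x.2 _) _ _).
set F1 := \int[mu]_(_ in _) ((_ *m ext (g k) _) _ _).
set F2 := \int[mu]_(_ in _) ((_ *m ext f _) _ _).
move=> e e2 e3.
rewrite (_ : _ - _ = ext (g k) t0 i 0 - ext f t0 i 0
    - (ext (g k) u i 0 - ext f u i 0) - dI - E1); last first.
  by rewrite e3 e2 e; ring.
move: g1 g2 bI eb1; rewrite !ler_norml => /andP[? ?] /andP[? ?] /andP[? ?] /andP[? ?].
rewrite !mulrDl; apply/andP; split; lra.
Qed.

Local Notation rho := (representative F H R S : (I -> 'cV[K]_n) -> ctlT).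
Local Notation ip := (ip_lambda t0 T F G H Q R S Pi0).

Lemma rep_exists f : Slam f -> exists zv, rep f zv.
Proof.
move=> Sf; have /SlamP[x0 [a0 c0]] := Sf.
have bf := adm_bd a0.
have [||x [ax cx] xmin] := @minimal_norm _ _ _ _ HS
  [set x | adm f x /\ Ctl x] x0 (fun x h => h.2) (conj a0 c0).
- move=> x y [ax cx] [ay cy]; split; last by apply: (shZ HS); exact: (shD HS).
  have -> : 2^-1 *: (x + y) = x + 2^-1 *: (y - x).
    rewrite scalerBr scalerDr addrCA addrC; congr (_ + _).
    rewrite -{2}(scale1r x) -scalerBl; by congr (_ *: _); field.
  exact: adm_shift (adm_sub ay ax).
- move=> u x uA cx ux; split => //.
  apply: (@adm_limit (fun=> f) u) => //; [by move=> k; case: (uA k).. |].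
  move=> eps e0; have e2 : 0 < eps ^+ 2 by rewrite exprn_gt0.
  have [N /(_ N (leqnn _)) h] := ux _ e2; exists N; split => // v i vI.
  by rewrite subrr normr0 ltW.
exists x; apply/(repP _ Sf); split => // w aw cw.
apply: (minimal_orthogonal HS cx cw) => s; apply: xmin; split.
  exact: adm_shift.
by apply: (shD HS) => //; exact: (shZ HS).
Qed.

(** A vector of norm zero has minimal norm on every line through it. *)
Lemma null_form w x : Ctl w -> Ctl x -> form w w = 0 -> form w x = 0.
Proof.
move=> cw cx w0; apply: (minimal_orthogonal HS cw cx) => s.
by rewrite w0 form_ge0.
Qed.

Lemma rep_diff f x y : Slam f -> rep f x -> rep f y -> form (x - y) (x - y) = 0.
Proof.
move=> Sf /(repP _ Sf)[ax cx ox] /(repP _ Sf)[ay cy oy].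
have ad := adm_sub ax ay; have cd := shB HS cx cy.
by rewrite (formBl HS) ?ox ?oy ?subr0.
Qed.

Lemma rep_unique f x y : Slam f -> rep f x -> rep f y -> x.1 = y.1 /\
  {ae mu, forall t, t \in `[t0, T] -> x.2 t = y.2 t}.
Proof.
move=> Sf rx ry; have xy := rep_diff Sf rx ry.
have [_ cx _] := (repP x Sf).1 rx; have [_ cy _] := (repP y Sf).1 ry.
have [z v] := form_eq0 (shB HS cx cy) xy; split.
  by apply/eqP; rewrite -subr_eq0; apply/eqP.
case: v => N [mN N0 hN]; exists N; split => // t h; apply: hN => /= g.
by apply: h => tI; apply/eqP; rewrite -subr_eq0; apply/eqP; exact: g.
Qed.

Lemma rhoP f : Slam f -> rep f (rho f).
Proof. by move=> /rep_exists; exact: xgetPex. Qed.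

Lemma rho_adm f : Slam f -> adm f (rho f).
Proof. by move=> Sf; have [] := (repP _ Sf).1 (rhoP Sf). Qed.

Lemma rho_ctl f : Slam f -> Ctl (rho f).
Proof. by move=> Sf; have [] := (repP _ Sf).1 (rhoP Sf). Qed.

(** Representatives are unique up to controls of energy zero, so that the form
    does not depend on the choice made by [representative]. *)
Lemma rho_form f x w : Slam f -> rep f x -> Ctl w -> form (rho f) w = form x w.
Proof.
move=> Sf rx cw; have [_ cx _] := (repP x Sf).1 rx.
apply/eqP; rewrite -subr_eq0; apply/eqP.
have cr := rho_ctl Sf; rewrite -(formBl HS cr cx cw).
by apply: null_form (shB HS cr cx) cw _; exact: rep_diff (rhoP Sf) rx.
Qed.

Lemma Slam_lin c f g : Slam f -> Slam g -> Slam (c *: f + g).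
Proof.
move=> /SlamP[x [ax cx]] /SlamP[y [ay cy]]; apply/SlamP.
by exists (c *: x + y); split; [exact: adm_lin | exact: (sh_lin HS)].
Qed.

Lemma Slam0 : Slam 0.
Proof. by apply/SlamP; exists 0; split; [exact: adm0 | exact: (sh_zero HS)]. Qed.

Lemma SlamB f g : Slam f -> Slam g -> Slam (f - g).
Proof. by move=> Sf Sg; rewrite addrC -scaleN1r; exact: Slam_lin. Qed.

Lemma rep_lin c f g x y : Slam f -> Slam g -> rep f x -> rep g y ->
  rep (c *: f + g) (c *: x + y).
Proof.
move=> Sf Sg /(repP _ Sf)[ax cx ox] /(repP _ Sg)[ay cy oy].
apply/(repP _ (Slam_lin c Sf Sg)); split; first exact: adm_lin.
  exact: (sh_lin HS).
by move=> w aw cw; rewrite (sh_form_lin HS)// ox// oy// mulr0 addr0.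
Qed.

(** * Inner product, reproducing property and completeness *)

(* the part of the inner product that does not involve the controls *)
Let bil (f g : I -> 'cV[K]_n) := dot (Pi0 *m ext f t0) (ext g t0) +
  \int[mu]_(s in `[t0, T]) dot (GQG s *m ext f s) (ext g s).

Lemma ipE f g : ip f g = bil f g + form (rho f) (rho g).
Proof. by rewrite /ip_lambda /bil /ctl_form; ring. Qed.

Lemma Slam_bd f : Slam f -> mx_on (bd_on t0 T) (ext f).
Proof. by move=> /SlamP[x [ax _]]; exact: adm_bd ax. Qed.

Lemma int_GQG f g : Slam f -> Slam g ->
  int_on t0 T (fun s => dot (GQG s *m ext f s) (ext g s)).
Proof.
move=> Sf Sg.
apply: on_dot (int0 _ _) (@intD _ t0 T) (@int_bdM _ t0 T) _ (Slam_bd Sg).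
exact: mx_int_bd intGQG (Slam_bd Sf).
Qed.

Lemma Pi0psd : psd Pi0.
Proof. by have [h <- _] := Pi_riccati; exact: h. Qed.

Lemma GQG_ge0 s (x : 'cV[K]_n) : 0 <= dot (GQG s *m x) x.
Proof. by rewrite -!mulmxA dot_mulmx; exact: (Qpsd s).2. Qed.

Lemma bilC f g : Slam f -> Slam g -> bil f g = bil g f.
Proof.
move=> Sf Sg; rewrite /bil dot_mulmx (psd_sym Pi0psd) dotC; congr (_ + _).
by apply: Rint_ext => s _; rewrite dot_mulmx GQGsym dotC.
Qed.

Lemma bil_lin c f g h : Slam f -> Slam g -> Slam h ->
  bil (c *: f + g) h = c * bil f h + bil g h.
Proof.
move=> Sf Sg Sh; rewrite /bil ext_lin// mulmxDr -scalemxAr dotDl dotZl.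
have -> : \int[mu]_(s in `[t0, T]) dot (GQG s *m ext (c *: f + g) s) (ext h s) =
  \int[mu]_(s in `[t0, T])
    (c * dot (GQG s *m ext f s) (ext h s) + dot (GQG s *m ext g s) (ext h s)).
  by apply: Rint_ext => s sI; rewrite ext_lin// mulmxDr -scalemxAr dotDl dotZl.
rewrite RintD ?RintZ; try by [exact: int_GQG | apply: intZ; exact: int_GQG].
by ring.
Qed.

Lemma bil_ge0 f : 0 <= bil f f.
Proof.
rewrite /bil addr_ge0 ?(Pi0psd.2)//.
by apply: Rintegral_ge0 => s _; exact: GQG_ge0.
Qed.

Lemma ipC f g : Slam f -> Slam g -> ip f g = ip g f.
Proof.
move=> Sf Sg; rewrite !ipE (bilC Sf Sg); congr (_ + _).
exact: (sh_sym HS (rho_ctl Sf) (rho_ctl Sg)).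
Qed.

Lemma ip_lin c f g h : Slam f -> Slam g -> Slam h ->
  ip (c *: f + g) h = c * ip f h + ip g h.
Proof.
move=> Sf Sg Sh; have rl := rep_lin c Sf Sg (rhoP Sf) (rhoP Sg).
rewrite !ipE (bil_lin c Sf Sg Sh) (rho_form (Slam_lin c Sf Sg) rl (rho_ctl Sh)).
rewrite (sh_form_lin HS c (rho_ctl Sf) (rho_ctl Sg) (rho_ctl Sh)).
by rewrite addrACA -mulrDr.
Qed.

Lemma ip_ge0 f : 0 <= ip f f.
Proof. by rewrite ipE addr_ge0 ?bil_ge0 ?form_ge0. Qed.

Local Notation ker := (kernel_lambda t0 T H R S Pi Phi : I -> I -> 'M[K]_n).
Let sec (t : I) p := section_fun (set_val t) p.
Let sc (t : I) p := section_control (set_val t) p.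
Let kf (t : I) p : I -> 'cV[K]_n := fun s => ker s t *m p.

Lemma ext_kf t p u : u \in `[t0, T] -> ext (kf t p) u = sec t p u.
Proof. by move=> /I_lift[s <-]; rewrite extE. Qed.

Lemma adm_kf t p : adm (kf t p) (sc t p).
Proof.
split.
- exact/mx_Lp2P/section_sq/I_in.
- apply: hd_ext (section_equation (I_in t) p) => // u uI; rewrite ext_kf//.
- by rewrite ext_kf//; exact: section_terminal (I_in t) p.
Qed.

Lemma ctl_sc t p : Ctl (sc t p).
Proof. exact: section_ctl (I_in t) p. Qed.

Lemma Slam_kf t p : Slam (kf t p).
Proof. by apply/SlamP; exists (sc t p); split; [exact: adm_kf | exact: ctl_sc]. Qed.

Lemma form_sc f x t p : adm f x -> Ctl x ->
  form x (sc t p) = dot p (f t) - bil f (kf t p).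
Proof.
move=> [_ hf fT] cx; rewrite /sc (section_form (I_in t) p cx hf fT) extE /bil.
rewrite ext_kf// opprD addrA; congr (_ - _).
by apply: Rint_ext => s sI; rewrite ext_kf.
Qed.

(** [section_form] for the zero trajectory is the orthogonality of [repP]. *)
Lemma rep_kf t p : rep (kf t p) (sc t p).
Proof.
apply/(repP _ (Slam_kf t p)); split; [exact: adm_kf | exact: ctl_sc |].
move=> w aw cw; rewrite (sh_sym HS (ctl_sc t p) cw) (form_sc t p aw cw).
have -> : (0 : I -> 'cV[K]_n) t = 0 by [].
rewrite dot0r /bil ext0// mulmx0 dot0l add0r.
rewrite (@Rint_ext _ _ _ _ (fun=> 0)) ?Rint0 ?addr0 ?oppr0// => s sI.
by rewrite ext0// mulmx0 dot0l.
Qed.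

Lemma reproducing t p f : Slam f -> dot p (f t) = ip f (kf t p).
Proof.
move=> Sf; have Sk := Slam_kf t p; have cf := rho_ctl Sf.
rewrite ipE (sh_sym HS cf (rho_ctl Sk)) (rho_form Sk (rep_kf t p) cf).
rewrite (sh_sym HS (ctl_sc t p) cf) (form_sc t p (rho_adm Sf) cf).
by rewrite addrC subrK.
Qed.

(** By the reproducing property an evaluation is a product with a section, and the
    squared norm of this section is a diagonal entry of the kernel, which is
    bounded in time. *)
Lemma point_bound : exists C, forall f t i eps, Slam f -> 0 < eps ->
  ip f f < eps ^+ 2 -> `|f t i 0| <= C * eps.
Proof.
have [C bC] := section_diagonal_bound.
have C0 (t : I) i : ip (kf t (delta_mx i 0)) (kf t (delta_mx i 0)) <= `|C|.
  rewrite -reproducing; last exact: Slam_kf.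
  rewrite dot_delta (_ : kf _ _ t = section_fun (set_val t) (delta_mx i 0) (set_val t))//.
  apply: le_trans (ler_norm _) _; apply: le_trans (bC _ _ (I_in t)) _.
  exact: ler_norm.
exists (`|C| + 1) => f t i eps Sf e0 fe.
set k := kf t (delta_mx i 0); have Sk : Slam k := Slam_kf _ _.
have fk : f t i 0 = ip f k by rewrite -reproducing// dot_delta.
have sq s : 0 <= s ^+ 2 * ip k k + 2 * s * ip f k + ip f f.
  have := ip_ge0 (s *: k + f).
  have Sl : Slam (s *: k + f) by exact: Slam_lin.
  rewrite (ip_lin s Sk Sf Sl) (ipC Sk Sl) (ipC Sf Sl).
  rewrite (ip_lin s Sk Sf Sk) (ip_lin s Sk Sf Sf) (ipC Sk Sf).
  move: (ip k k) (ip f k) (ip f f) => x y z.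
  by have -> : s ^+ 2 * x + 2 * s * y + z = s * (s * x + y) + (s * y + z) by ring.
by rewrite fk; exact: quad_bound sq (C0 t i) (normr_ge0 _) e0 fe.
Qed.

Lemma rho_norm f x : Slam f -> rep f x -> form (rho f) (rho f) = form x x.
Proof.
move=> Sf rx; have cr := rho_ctl Sf; have [_ cx _] := (repP x Sf).1 rx.
by rewrite (rho_form Sf rx cr) (sh_sym HS cx cr) (rho_form Sf rx cx).
Qed.

Lemma form_rho_sub f g : Slam f -> Slam g ->
  form (rho f - rho g) (rho f - rho g) <= ip (f - g) (f - g).
Proof.
move=> Sf Sg; have := rep_lin (-1) Sg Sf (rhoP Sg) (rhoP Sf).
rewrite !scaleN1r addrC [- rho g + _]addrC => rs.
by rewrite ipE (rho_norm (SlamB Sf Sg) rs) lerDr bil_ge0.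
Qed.

Lemma bil_small : exists C, forall f eps, Slam f -> 0 < eps ->
  (forall u i, u \in `[t0, T] -> `|ext f u i 0| <= eps) -> bil f f <= C * eps ^+ 2.
Proof.
have le_nrm (A : 'M[K]_n) (v : 'cV[K]_n) eps : 0 < eps ->
    (forall i, `|v i 0| <= eps) -> dot (A *m v) v <= nrm1 A * eps ^+ 2.
  move=> e0 ve; apply: le_trans (ler_norm _) _.
  apply: le_trans (ler_norm_sum _ _ _) _; rewrite /nrm1 mulr_suml.
  apply: ler_sum => i _; rewrite normrM expr2 mulrA ler_pM//.
  rewrite mxE; apply: le_trans (ler_norm_sum _ _ _) _; rewrite mulr_suml.
  by apply: ler_sum => j _; rewrite normrM ler_wpM2l.
have jN := int_nrm1 intGQG.
exists (nrm1 Pi0 + \int[mu]_(s in `[t0, T]) nrm1 (GQG s)) => f eps Sf e0 fe.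
rewrite /bil mulrDl; apply: lerD; first by apply: le_nrm => // i; exact: fe.
rewrite mulrC -RintZ//; apply: Rint_le; [exact: int_GQG | exact: intZ |].
by move=> s sI; rewrite mulrC; apply: le_nrm => // i; exact: fe.
Qed.

(** Trajectories converge uniformly and their representatives in energy. The two
    limits fit together by [adm_limit], and the energy of a representative of
    [u i - f] is at most that of [rho (u i) - x]. *)
Lemma Slam_complete (u : nat -> I -> 'cV[K]_n) : (forall k, Slam (u k)) ->
  (forall eps, 0 < eps -> exists N : nat, forall i j : nat,
    (N <= i)%N -> (N <= j)%N -> ip (u i - u j) (u i - u j) < eps) ->
  exists2 f, Slam f & forall eps, 0 < eps -> exists N : nat, forall i,
    (N <= i)%N -> ip (u i - f) (u i - f) < eps.
Proof.
move=> Su uC; have Suu i j := SlamB (Su i) (Su j).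
have rC : sq_cauchy form (fun k => rho (u k)).
  move=> eps e0; have [N h] := uC eps e0; exists N => i j Ni Nj.
  by apply: le_lt_trans (form_rho_sub (Su i) (Su j)) _; exact: h.
have [x cx rx] := ctl_complete mR r0 Rr (fun k => rho_ctl (Su k)) rC.
have [C pb] := point_bound.
have uniC eps : 0 < eps -> exists N, forall i j, (N <= i)%N -> (N <= j)%N ->
    forall t l, `|u i t l 0 - u j t l 0| < eps.
  move=> e0; pose c := `|C| + 1; have c0 : 0 < c by rewrite ltr_wpDl.
  pose e' := eps / (2 * c); have e'0 : 0 < e' by rewrite divr_gt0// mulr_gt0.
  have [N h] := uC (e' ^+ 2) (exprn_gt0 2 e'0); exists N => i j Ni Nj t l.
  have := pb _ t l e' (Suu i j) e'0 (h i j Ni Nj).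
  have -> : (u i - u j) t l 0 = u i t l 0 - u j t l 0 by rewrite !mxE.
  move=> b; apply: le_lt_trans b _.
  have : C * e' <= c * e'.
    by rewrite ler_wpM2r ?(ltW e'0)// (le_trans (ler_norm C))// lerDl.
  have : c * e' = eps / 2 by rewrite /e'; field; rewrite lt0r_neq0.
  by move=> ->; lra.
pose f : I -> 'cV[K]_n := fun t => \col_l limn (fun k => u k t l 0).
have uf t l : u k t l 0 @[k --> \oo] --> f t l 0.
  rewrite mxE; apply: cauchy_limit => eps e0.
  by have [N h] := uniC eps e0; exists N => i j Ni Nj; exact: h.
have uni eps : 0 < eps -> exists N, forall k, (N <= k)%N ->
    forall v l, v \in `[t0, T] -> `|ext (u k) v l 0 - ext f v l 0| <= eps.
  move=> e0; have [N h] := uniC eps e0; exists N => k Nk v l /I_lift[t <-].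
  rewrite !extE; apply: (limit_bound (N := N) (uf t l)) => j Nj.
  exact/ltW/h.
have bf : mx_on (bd_on t0 T) (ext f).
  move=> l j; rewrite ord1; split.
    apply: (@measurable_fun_cvg _ _ _ _ (fun k v => ext (u k) v l 0)).
      by move=> k; case: (Slam_bd (Su k) l 0).
    move=> v /= /I_lift[t <-]; rewrite extE.
    rewrite (_ : (fun k => _) = fun k => u k t l 0); first exact: uf.
    by apply/funext => k; rewrite extE.
  have [N /(_ N (leqnn _)) h] := uni 1 ltr01.
  have [_ [B hB]] := Slam_bd (Su N) l 0; exists (B + 1) => v vI.
  rewrite -(subrK (ext (u N) v l 0) (ext f v l 0)) addrC.
  by apply: le_trans (ler_normD _ _) _; rewrite lerD ?hB// distrC h.
have af : adm f x.
  apply: (adm_limit (fun k => rho_adm (Su k)) (fun k => rho_ctl (Su k)) cx bf).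
  move=> eps e0; have [N1 h1] := rx _ (exprn_gt0 2 e0); have [N2 h2] := uni eps e0.
  exists (maxn N1 N2); split; first by apply: h1; exact: leq_maxl.
  by move=> v i; apply: h2; exact: leq_maxr.
have Sf : Slam f by apply/SlamP; exists x.
exists f => // eps e0; have [B hB] := bil_small.
pose c := `|B| + 1; have c0 : 0 < c by rewrite ltr_wpDl.
have q0 : 0 < eps / (2 * c) by rewrite divr_gt0// mulr_gt0.
pose e' := Num.sqrt (eps / (2 * c)); have e'0 : 0 < e' by rewrite sqrtr_gt0.
have e'E : e' ^+ 2 = eps / (2 * c) by rewrite sqr_sqrtr// ltW.
have e2 : 0 < eps / 2 by rewrite divr_gt0.
have [N1 h1] := uni e' e'0; have [N2 h2] := rx _ e2.
exists (maxn N1 N2) => i; rewrite geq_max => /andP[N1i N2i].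
have Sd := SlamB (Su i) Sf.
have bd : bil (u i - f) (u i - f) <= eps / 2.
  apply: le_trans (hB _ _ Sd e'0 _) _.
    move=> v l vI; have -> : ext (u i - f) v l 0 = ext (u i) v l 0 - ext f v l 0.
      by rewrite addrC -scaleN1r (ext_lin _ _ _ vI) scaleN1r addrC !mxE.
    exact: h1.
  apply: (@le_trans _ _ (c * e' ^+ 2)).
    by rewrite ler_wpM2r ?sqr_ge0// (le_trans (ler_norm B))// lerDl.
  by rewrite e'E le_eqVlt; apply/orP; left; apply/eqP; field; rewrite lt0r_neq0.
have fd : form (rho (u i - f)) (rho (u i - f)) < eps / 2.
  apply: le_lt_trans _ (h2 i N2i).
  have ad : adm (u i - f) (rho (u i) - x).
    have := adm_lin (-1) af (rho_adm (Su i)).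
    by rewrite !scaleN1r addrC [- x + _]addrC.
  have [_ min] := rhoP Sd.
  have := min _ ad; rewrite (cost_ctl (rho_ctl Sd)).
  by rewrite (cost_ctl (shB HS (rho_ctl (Su i)) cx)) lee_fin.
rewrite ipE (splitr eps); exact: ler_ltD.
Qed.

Lemma ip_definite f : Slam f -> ip f f = 0 -> f = 0.
Proof.
move=> Sf f0; have [C pb] := point_bound.
apply/funext => t; apply/matrixP => i j; rewrite ord1 [RHS]mxE.
apply: (@vanish _ C) => eps e0; apply: pb => //.
by rewrite f0 exprn_gt0.
Qed.

Theorem Slam_rkhs : unique_representatives t0 T F H R S Slam /\
  is_rkhs Slam ip ker.
Proof.
split.
  move=> f Sf; split; first exact: rep_exists.
  by move=> x y; exact: rep_unique.
split; last first.
- by move=> t p f Sf; exact: reproducing.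
- by move=> t p; exact: Slam_kf.
split.
- exact: Slam0.
- by move=> c f g; exact: Slam_lin.
- by move=> f g; exact: ipC.
- by move=> c f g h; exact: ip_lin.
- by move=> f _; exact: ip_ge0.
- exact: ip_definite.
move=> u Su uC.
have [|f Sf uf] := Slam_complete Su.
  move=> eps e0; have s0 : 0 < Num.sqrt eps by rewrite sqrtr_gt0.
  have [N h] := uC _ s0; exists N => i j Ni Nj.
  by have := h i j Ni Nj; rewrite ltr_sqrt.
exists f => //; apply/cvgrPdist_lt => eps e0.
have [N h] := uf _ (exprn_gt0 2 e0); exists N => // k /= Nk.
rewrite sub0r normrN ger0_norm ?sqrtr_ge0//.
rewrite -[ltRHS](ger0_norm (ltW e0)) -sqrtr_sqr ltr_sqrt ?exprn_gt0//.
exact: h.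
Qed.

End Kernel.

(** * Essentially bounded functions *)

Section EssentiallyBounded.
Context {K : realType} (a b : K).
Local Notation mu := (@lebesgue_measure K).
Local Notation MR := (measurableTypeR K).

(** Stated with a null set rather than with the essential supremum: cutting the
    null set out by an indicator leaves a bounded function. *)
Definition ebd_on (f : K -> K) := meas_on a b f /\
  exists M (N : set MR), [/\ measurable N, mu N = 0 &
    forall t, t \in `[a, b] -> ~ N t -> `|f t| <= M].

Lemma ebd_sqM f g : ebd_on f -> sq_on a b g -> sq_on a b (fun t => f t * g t).
Proof.
move=> [mf [M [N [mN N0 fM]]]] sg; have [mg _] := sg.
pose h t := f t * (1 - \1_N t).
have bh : bd_on a b h.
  split.
    apply: meas_mul mf (meas_sub (@meas_cst _ a b 1) _).
    exact: measurable_indic.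
  exists `|M| => t tI; rewrite /h indicE; have [Nt|Nt] := pselect (N t).
    by rewrite mem_set// subrr mulr0 normr0.
  rewrite memNset// subr0 mulr1; apply: le_trans (fM t tI Nt) _.
  exact: ler_norm.
have mfg := meas_mul mf mg; split => //.
have [_ jh] := bd_sqM bh sg.
apply: (ae_int mN N0 _ (meas_mul mfg mfg) jh).1 => t tI Nt.
by rewrite /h indicE memNset// subr0 mulr1 expr2.
Qed.

Lemma Lfun_ebd (f : K -> K) : (f \_ `[a, b]) \in Lfun mu +oo%E -> ebd_on f.
Proof.
move=> Lf; split; first exact: Lfun_meas Lf.
move: Lf; rewrite inE => /andP[_]; rewrite inE /= /finite_norm unlock.
case: ifPn => [_|m0 _]; last first.
  (* the essential supremum is only looked at when the measure is not zero *)
  exists 0, setT; split; [exact: measurableT | | by move=> t _ /(_ Logic.I)].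
  by apply/eqP; rewrite eq_le measure_ge0 andbT leNgt.
set y := ess_sup _ _ => yoo.
have [N [mN N0 hN]] := ess_sup_ge mu (abse \o (EFin \o (f \_ `[a, b]))).
have [M yM] : exists M : K, (y <= M%:E)%E.
  by case: y yoo {hN} => [x||] // _; [exists x | exists 0; rewrite leNye].
exists M, N; split => // t tI Nt.
rewrite -lee_fin; apply: le_trans yM.
have : (`|((f \_ `[a, b]) t)%:E| <= y)%E.
  by apply: contrapT => h; apply: Nt; exact: hN.
by rewrite /= patchE mem_setE tI.
Qed.
End EssentiallyBounded.

(** * Coefficients that are positive almost everywhere *)

Section Modification.
Context {K : realType}.
Local Notation mu := (@lebesgue_measure K).
Local Notation MR := (measurableTypeR K).

Lemma hd_ae a b (N : set MR) p q (f g g0 : K -> 'M[K]_(p, q)) :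
  measurable N -> mu N = 0 ->
  (forall t, t \in `[a, b] -> ~ N t -> g t = g0 t) ->
  mx_on (meas_on a b) g0 -> has_derivative a b f g -> has_derivative a b f g0.
Proof.
move=> mN N0 gg m0 /hdP h; apply/hdP => i j; have [jg fE] := h i j.
split; first by apply: (ae_int mN N0 _ (m0 i j) jg).1 => t tI Nt; rewrite gg.
move=> t /[dup] tI; rewrite in_itv /= => /andP[at_ tb].
rewrite fE//; congr (_ + _).
have mt : meas_on a t (fun s => g0 s i j).
  apply: measurable_funS (m0 i j); first exact: itv_meas.
  by apply: subset_itv; rewrite bnd_simp.
apply: (ae_int mN N0 _ mt (int_sub (lexx a) tb jg)).2 => s sI Ns.
rewrite gg//; move: sI; rewrite !in_itv /= => /andP[-> st].
exact: le_trans st tb.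
Qed.

Lemma is_rkhs_ext (X : Type) n (E : set (X -> 'cV[K]_n)) ip ip' Lam Lam' :
  (forall f g, E f -> E g -> ip f g = ip' f g) ->
  (forall s t, Lam s t = Lam' s t) -> is_rkhs E ip Lam -> is_rkhs E ip' Lam'.
Proof.
move=> ipE LE [[h0 hl hs hil hg hd hc] km rp].
have ELam t p : (fun s => Lam s t *m p) = (fun s => Lam' s t *m p).
  by apply/funext => s; rewrite LE.
have EB f g : E f -> E g -> E (f - g).
  by move=> Ef Eg; rewrite addrC -scaleN1r; exact: hl.
split.
- split => //.
  + by move=> f g Ef Eg; rewrite -(ipE f g)// -(ipE g f)//; exact: hs.
  + move=> c f g k Ef Eg Ek; rewrite -(ipE f k)// -(ipE g k)// -(ipE _ k)//; first exact: hil.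
    exact: hl.
  + by move=> f Ef; rewrite -(ipE f f)//; exact: hg.
  + by move=> f Ef; rewrite -(ipE f f)//; exact: hd.
  + move=> u Eu uC; have [|f Ef uf] := hc u Eu.
      move=> eps /uC[N h]; exists N => i j Ni Nj.
      by rewrite ipE; [exact: h | exact: EB..].
    exists f => //; rewrite (_ : (fun k => _) = fun k => Num.sqrt (ip (u k - f) (u k - f)))//.
    by apply/funext => k; rewrite ipE//; exact: EB.
- by move=> t p; rewrite -ELam.
- by move=> t p f Ef; rewrite -ELam -ipE//; exact: rp.
Qed.
End Modification.

Section Reduction.
Context {K : realType} (t0 T : K) (n m d : nat).
Local Notation mu := (@lebesgue_measure K).
Local Notation MR := (measurableTypeR K).
Local Notation I := (set_type (`[t0, T] : set K)).
Variables (F : K -> 'M[K]_n) (G : K -> 'M[K]_(n, d)) (H : K -> 'M[K]_(m, n)).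
Variables (Q : K -> 'M[K]_d) (R : K -> 'M[K]_m) (r : K).
Variables (Pi0 S : 'M[K]_n) (Pi : K -> 'M[K]_n) (Phi : K -> K -> 'M[K]_n).
Hypotheses (t0T : t0 <= T).
Hypotheses (jF : mx_on (int_on t0 T) F) (mG : mx_on (meas_on t0 T) G).
Hypotheses (sH : mx_on (sq_on t0 T) H) (mQ : mx_on (meas_on t0 T) Q).
Hypotheses (mR : mx_on (meas_on t0 T) R) (r0 : 0 < r) (Ssym : S^T = S).
Variables (N : set MR) (mN : measurable N) (N0 : mu N = 0).
Hypothesis Qpsd : forall t, t \in `[t0, T] -> ~ N t -> psd (Q t).
Hypothesis Rr : forall t, t \in `[t0, T] -> ~ N t -> psd (R t - r%:M).
Hypothesis Pi_riccati : is_riccati_solution t0 T F G H Q R Pi0 Pi.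
Hypothesis Phi_transition : is_transition_matrix t0 T F H R Pi Phi.

Let good t : bool := (t \in `[t0, T]) && (t \notin N).
(** Off the good set, the value [r%:M] keeps the coercivity constant. *)
Definition R_fix t := if good t then R t else r%:M.
Definition Q_fix t := if good t then Q t else 0.

Lemma goodP t : t \in `[t0, T] -> ~ N t -> good t.
Proof. by move=> tI Nt; rewrite /good tI notin_setE. Qed.

Lemma R_fixE t : t \in `[t0, T] -> ~ N t -> R t = R_fix t.
Proof. by move=> tI Nt; rewrite /R_fix goodP. Qed.
Lemma Q_fixE t : t \in `[t0, T] -> ~ N t -> Q t = Q_fix t.
Proof. by move=> tI Nt; rewrite /Q_fix goodP. Qed.

Lemma R_fix_psd t : psd (R_fix t - r%:M).
Proof.
rewrite /R_fix; case: ifPn => [/andP[tI]|_]; first by rewrite notin_setE; exact: Rr.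
rewrite subrr; split; first by rewrite trmx0.
by move=> x; rewrite mul0mx dot0l.
Qed.
Lemma Q_fix_psd t : psd (Q_fix t).
Proof.
rewrite /Q_fix; case: ifPn => [/andP[tI]|_]; first by rewrite notin_setE; exact: Qpsd.
split; first by rewrite trmx0.
by move=> x; rewrite mul0mx dot0l.
Qed.

Lemma meas_fix (f : K -> K) c : meas_on t0 T f ->
  meas_on t0 T (fun t => if good t then f t else c).
Proof.
move=> mf.
have mi : meas_on t0 T (\1_N : K -> K) by exact: measurable_indic.
have h := meas_add (meas_mul (meas_sub (@meas_cst _ t0 T 1) mi) mf)
  (meas_mul mi (@meas_cst _ t0 T c)).
apply: meas_ext h => t tI; rewrite /good tI indicE /=.
by case: (t \in N) => /=; ring.
Qed.

Lemma mR_fix : mx_on (meas_on t0 T) R_fix.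
Proof.
move=> i j; apply: meas_ext (meas_fix (r%:M i j) (mR i j)) => t tI.
by rewrite /R_fix; case: ifP.
Qed.
Lemma mQ_fix : mx_on (meas_on t0 T) Q_fix.
Proof.
move=> i j; apply: meas_ext (meas_fix ((0 : 'M[K]_d) i j) (mQ i j)) => t tI.
by rewrite /Q_fix; case: ifP.
Qed.

Let mF : mx_on (meas_on t0 T) F. Proof. by move=> i j; exact: int_meas. Qed.
Let mH : mx_on (meas_on t0 T) H. Proof. by move=> i j; case: (sH i j). Qed.
Let mPi : mx_on (meas_on t0 T) Pi.
Proof. by have [_ _ /(hd_bd t0T) h] := Pi_riccati => i j; case: (h i j). Qed.
Let mRi := meas_invmx mR_fix.

Lemma riccati_fix : is_riccati_solution t0 T F G H Q_fix R_fix Pi0 Pi.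
Proof.
have [pPi PiE hPi] := Pi_riccati; split; [exact: pPi | exact: PiE |].
apply: hd_ae mN N0 _ _ hPi.
  by move=> t tI Nt; rewrite (R_fixE tI Nt) (Q_fixE tI Nt).
apply: mx_meas_add; last exact: mx_meas (mx_meas mG mQ_fix) (mx_onT mG).
have m1 := mx_meas_add (mx_meas mF mPi) (mx_meas mPi (mx_onT mF)).
have m2 := mx_meas (mx_meas (mx_meas (mx_meas mPi (mx_onT mH)) mRi) mH) mPi.
exact: mx_meas_sub m1 m2.
Qed.

Lemma transition_fix : is_transition_matrix t0 T F H R_fix Pi Phi.
Proof.
move=> t tI; have [P1 hP] := Phi_transition tI; split; first exact: P1.
have mP : mx_on (meas_on t0 T) (Phi ^~ t).
  by have h := hd_bd t0T hP => i j; case: (h i j).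
apply: hd_ae mN N0 _ _ hP.
  by move=> s sI Ns; rewrite (R_fixE sI Ns).
apply: mx_meas mP.
have m2 := mx_meas (mx_meas (mx_meas mPi (mx_onT mH)) mRi) mH.
exact: mx_meas_sub mF m2.
Qed.

Lemma cost_fix (zv : 'cV[K]_n * (K -> 'cV[K]_m)) : mx_on (meas_on t0 T) zv.2 ->
  cost t0 T R zv = cost t0 T R_fix zv.
Proof.
move=> mv; rewrite /cost; congr (_ + _)%E; apply: ae_eq_integral.
- exact: itv_meas.
- by apply/measurable_EFinP; exact: (meas_form mR mv mv).
- by apply/measurable_EFinP; exact: (meas_form mR_fix mv mv).
- exists N; split => // t /=; apply: contra_notP => Nt tI.
  by rewrite (R_fixE tI Nt).
Qed.

Local Notation adm := (@admissible K t0 T n m F H S).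

Local Notation rep := (@is_representative K t0 T n m F H).

Lemma rep_fix lam : rep R S lam = rep R_fix S lam.
Proof.
apply/funext => zv; apply/propext; split=> -[av min]; split => // zv' av'.
  by rewrite -!cost_fix; [exact: min | exact: adm_meas av' | exact: adm_meas av].
by rewrite !cost_fix; [exact: min | exact: adm_meas av' | exact: adm_meas av].
Qed.

Lemma representative_fix (lam : I -> 'cV[K]_n) :
  representative F H R S lam = representative F H R_fix S lam.
Proof. by rewrite /representative rep_fix. Qed.

Lemma Slam_fix : S_lambda t0 T F H R S = S_lambda t0 T F H R_fix S.
Proof.
apply/seteqP; split => lam [zv [av c]]; exists zv; split => //.
  by rewrite -cost_fix//; exact: adm_meas av.
by rewrite cost_fix//; exact: adm_meas av.
Qed.

(** Derivatives and integrals ignore the null set on which the coefficients are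
    replaced, so that the result for [R_fix] and [Q_fix] is the result for [R]
    and [Q]. *)
Theorem S_lambda_rkhs :
  unique_representatives t0 T F H R S (S_lambda t0 T F H R S) /\
  is_rkhs (S_lambda t0 T F H R S) (ip_lambda t0 T F G H Q R S Pi0)
    (kernel_lambda t0 T H R S Pi Phi).
Proof.
have [ur rk] := Slam_rkhs t0T jF sH mR_fix r0 R_fix_psd Ssym Q_fix_psd riccati_fix transition_fix.
rewrite Slam_fix; split.
  by move=> lam /ur; rewrite !rep_fix.
apply: is_rkhs_ext rk => [f g Sf Sg | s t].
  have rf := rho_ctl t0T jF sH mR_fix r0 R_fix_psd Sf.
  have rg := rho_ctl t0T jF sH mR_fix r0 R_fix_psd Sg.
  have bf := Slam_bd t0T mR_fix r0 R_fix_psd Sf.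
  have bg := Slam_bd t0T mR_fix r0 R_fix_psd Sg.
  have ms l (v : K -> 'cV[K]_l) (w : K -> 'cV[K]_l) : mx_on (meas_on t0 T) v ->
      mx_on (meas_on t0 T) w -> meas_on t0 T (fun u => dot (v u) (w u)).
    exact: on_dot (@meas_cst _ t0 T 0) (@meas_add _ t0 T) (@meas_mul _ t0 T).
  have mbd l (v : K -> 'cV[K]_l) : mx_on (bd_on t0 T) v -> mx_on (meas_on t0 T) v.
    by move=> bv i j; case: (bv i j).
  rewrite /ip_lambda !representative_fix; congr (_ + _ + _ + _).
    apply: (ae_int mN N0 _ _ (int_GQG t0T jF sH mR_fix r0 R_fix_psd riccati_fix Sf Sg)).2.
      by move=> u uI Nu; rewrite (Q_fixE uI Nu).
    apply: ms (mbd _ _ bg); apply: mx_meas (mbd _ _ bf).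
    exact: mx_meas (mx_meas mG mQ) (mx_onT mG).
  apply: (ae_int mN N0 _ _ (int_form mR_fix r0 R_fix_psd rf rg)).2.
    by move=> u uI Nu; rewrite (R_fixE uI Nu).
  by have [mf _] := rf; have [mg _] := rg; exact: (meas_form mR mf mg).
have [sI tI] := (I_in s, I_in t).
rewrite /kernel_lambda; congr (_ + _); apply/matrixP => i j; rewrite !mxE.
have mI : t0 <= Num.max (set_val s) (set_val t).
  by move: sI; rewrite in_itv /= le_max => /andP[->].
have bPhi u : u \in `[t0, T] -> mx_on (bd_on t0 T) (Phi ^~ u).
  by move=> uI; apply: (hd_bd t0T (transition_fix uI).2).
have mPhi u : u \in `[t0, T] -> mx_on (meas_on t0 T) (Phi ^~ u).
  by move=> uI k l; case: (bPhi u uI k l).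
have jfix : mx_on (int_on t0 T) (fun tau => (Phi tau (set_val s))^T *m (H tau)^T
    *m invmx (R_fix tau) *m H tau *m Phi tau (set_val t)).
  have h := mx_int_bd (mx_bd_int (mx_onT (bPhi _ sI)) (intW sH mR_fix r0 R_fix_psd)) (bPhi _ tI).
  by move=> k l; apply: int_ext (h k l) => u _; rewrite !mulmxA.
apply: (ae_int mN N0 _ _ (int_sub mI (lexx T) (jfix i j))).2.
  move=> u; rewrite in_itv /= => /andP[mu_ uT] Nu.
  have uI : u \in `[t0, T] by rewrite in_itv /= uT (le_trans mI mu_).
  by rewrite (R_fixE uI Nu).
have mHRH := mx_meas (mx_meas (mx_onT mH) (meas_invmx mR)) mH.
have mk := mx_meas (mx_meas (mx_onT (mPhi _ sI)) mHRH) (mPhi _ tI).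
apply: (@measurable_funS _ _ _ _ `[t0, T]); first exact: itv_meas.
  by apply: subset_itv; rewrite bnd_simp.
by apply: meas_ext (mk i j) => u _; rewrite !mulmxA.
Qed.

End Reduction.

(** * Bounded coefficients *)

Section Sobolev.
Context {K : realType} (t0 T : K) (n m : nat).
Local Notation mu := (@lebesgue_measure K).
Variables (F : K -> 'M[K]_n) (H : K -> 'M[K]_(m, n)) (R : K -> 'M[K]_m).
Variables (S : 'M[K]_n).
Hypotheses (t0T : t0 <= T).

(** A bounded [R] makes the cost of square integrable controls finite, and
    [F^T lam + H^T v] is square integrable when [F] is and [H] is bounded. *)
Lemma S_H1_eq : mx_on (sq_on t0 T) F -> mx_on (ebd_on t0 T) H ->
  mx_on (ebd_on t0 T) R ->
  S_H1 t0 T F H S = S_lambda t0 T F H R S.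
Proof.
move=> sF eH eR.
have mul_sq p q l (A : K -> 'M[K]_(p, q)) (B : K -> 'M[K]_(q, l)) :
    mx_on (ebd_on t0 T) A -> mx_on (sq_on t0 T) B ->
    mx_on (sq_on t0 T) (fun t => A t *m B t).
  exact: (mx_onM (bd_sq (bd_cst t0 T 0)) (@sqD _ t0 T) (@ebd_sqM _ t0 T)).
apply/seteqP; split => lam.
  move=> [_ [zv av]]; exists zv; split => //.
  have [/mx_Lp2P sv _ _] := av.
  have jv : int_on t0 T (fun t => dot (R t *m zv.2 t) (zv.2 t)).
    exact: on_dot (int0 _ _) (@intD _ t0 T) (@sqM _ t0 T) (mul_sq _ _ _ _ _ eR sv) sv.
  by rewrite /cost (EFin_Rint jv) -EFinD ltry.
move=> [zv [av _]]; split; last by exists zv.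
have [/mx_Lp2P sv hl _] := av.
exists (fun t => - ((F t)^T *m ext lam t + (H t)^T *m zv.2 t)); split => //.
have s1 := mx_sq_bd (mx_onT sF) (hd_bd t0T hl).
have s2 := mul_sq _ _ _ _ _ (mx_onT eH) sv.
apply/mx_Lp2P => i j.
have h := bd_sqM (bd_cst t0 T (-1)) (sqD (s1 i j) (s2 i j)).
rewrite (_ : (fun t => _) = fun t => -1 *
  (((F t)^T *m ext lam t) i j + ((H t)^T *m zv.2 t) i j))//.
by apply/funext => t; rewrite mulN1r [LHS]mxE [X in - X]mxE.
Qed.
End Sobolev.

Unset Implicit Arguments.

Theorem theorem4 (K : realType) (t0 T : K) (n m d : nat)
  (F : K -> 'M[K]_n) (G : K -> 'M[K]_(n, d)) (H : K -> 'M[K]_(m, n))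
  (Q : K -> 'M[K]_d) (R : K -> 'M[K]_m) (r : K)
  (Pi0 SigmaT sqrtSigmaT : 'M[K]_n)
  (Pi : K -> 'M[K]_n) (Phi : K -> K -> 'M[K]_n)
  (t0_lt_T : t0 < T) (n_gt0 : (0 < n)%N) (m_gt0 : (0 < m)%N) (d_gt0 : (0 < d)%N)
  (F_L1 : mx_Lp t0 T 1%E F) (G_L2 : mx_Lp t0 T 2%:E G)
  (H_L2 : mx_Lp t0 T 2%:E H)
  (Q_L1 : mx_Lp t0 T 1%E Q)
  (Q_psd : {ae @lebesgue_measure K, forall t, t \in `[t0, T] -> psd (Q t)})
  (R_L2 : mx_Lp t0 T 2%:E R)
  (R_sym : {ae @lebesgue_measure K, forall t, t \in `[t0, T] -> (R t)^T = R t})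
  (r_gt0 : 0 < r)
  (R_ge : {ae @lebesgue_measure K,
             forall t, t \in `[t0, T] -> psd (R t - r%:M)})
  (Pi0_psd : psd Pi0) (SigmaT_psd : psd SigmaT)
  (sqrtSigmaT_def : is_psd_sqrt sqrtSigmaT SigmaT)
  (Pi_riccati : is_riccati_solution t0 T F G H Q R Pi0 Pi)
  (Phi_transition : is_transition_matrix t0 T F H R Pi Phi) :
  let Slam := S_lambda t0 T F H R sqrtSigmaT in
  let SH1 := S_H1 t0 T F H sqrtSigmaT in
  let ip := ip_lambda t0 T F G H Q R sqrtSigmaT Pi0 in
  let Lam := kernel_lambda t0 T H R sqrtSigmaT Pi Phi in
  (unique_representatives t0 T F H R sqrtSigmaT Slam /\ is_rkhs Slam ip Lam) /\
  (mx_Lp t0 T 2%:E F -> mx_Lp t0 T +oo%E H -> mx_Lp t0 T +oo%E R ->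
   unique_representatives t0 T F H R sqrtSigmaT SH1 /\ is_rkhs SH1 ip Lam).
Proof.
have t0T := ltW t0_lt_T.
have sqrt_sym : sqrtSigmaT^T = sqrtSigmaT by case: sqrtSigmaT_def => -[].
have jF : mx_on (int_on t0 T) F by exact/mx_Lp1P.
have sH : mx_on (sq_on t0 T) H by exact/mx_Lp2P.
have mG : mx_on (meas_on t0 T) G by move: G_L2 => /mx_Lp2P h i j; case: (h i j).
have mR : mx_on (meas_on t0 T) R by move: R_L2 => /mx_Lp2P h i j; case: (h i j).
have mQ : mx_on (meas_on t0 T) Q by move: Q_L1 => /mx_Lp1P h i j; exact: (int_meas (h i j)).
have [N [mN N0 NQR]] := negligibleU Q_psd R_ge.
have Qgood t : t \in `[t0, T] -> ~ N t -> psd (Q t).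
  move=> tI Nt; apply: contrapT => h; apply: Nt; apply: NQR; left => /= g.
  exact: h (g tI).
have Rgood t : t \in `[t0, T] -> ~ N t -> psd (R t - r%:M).
  move=> tI Nt; apply: contrapT => h; apply: Nt; apply: NQR; right => /= g.
  exact: h (g tI).
have main := S_lambda_rkhs t0T jF mG sH mQ mR r_gt0 sqrt_sym mN N0 Qgood Rgood
  Pi_riccati Phi_transition.
move=> Slam SH1 ip Lam; split; first exact: main.
move=> F_L2 H_Linf R_Linf; rewrite /SH1 (S_H1_eq (R := R) sqrtSigmaT t0T).
- exact: main.
- exact/mx_Lp2P.
- by move=> i j; exact: Lfun_ebd (H_Linf i j).
- by move=> i j; exact: Lfun_ebd (R_Linf i j).
Qed.
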